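(* There is an absolute constant $c>0$ such that the following holds. Let $C>0$ and let $d\ge1$ be an integer, and suppose $n$ is sufficiently large (depending on $C,d$). Suppose $A\subseteq S_n$ is relatively $(2d,K)$-global and $\mu(A)\ge n^{-C}$. Then \[r_d(T_A)\le \frac{\sqrt{K}\,(\log n)^{cd}}{n^{d/2}}.\] If furthermore $A$ is closed under conjugation, then \[r_d(T_A)\le \frac{\sqrt{K}\,(\log n)^{cd}}{n^{d}}.\]
   Context: $\mu$ is the uniform probability measure on $S_n$. $L^2(S_n)$ is the space of real functions on $S_n$ with inner product $\langle f,g\rangle=\mathbb{E}_{\sigma\sim S_n}[f(\sigma)g(\sigma)]$. For ordered tuples $I=(i_1,\dots,i_t)$, $J=(j_1,\dots,j_t)$ of distinct elements of $[n]$, the $t$-umvirate $\mathcal{U}_{I\to J}$ is $\{\pi\in S_n:\pi(i_l)=j_l\ \forall l\}$. $A\subseteq S_n$ is relatively $(t,K)$-global if the density $|A\cap\mathcal U|/|\mathcal U|$ of $A$ inside every $t$-umvirate $\mathcal U$ is at most $K\mu(A)$. Let $W_d$ be the linear span of indicators of $d$-umvirates ($W_0$ = constants), $V_{=d}=W_d\cap W_{d-1}^{\perp}$. For $A\subseteq S_n$ let $T_A$ be the operator $T_Af(x)=\mathbb{E}_{a\sim A}[f(ax)]$ ($a$ uniform in $A$), and $r_d(T_A)=\sup_{0\ne f\in V_{=d}}\|T_Af\|_2/\|f\|_2$. *)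

(* Defs.v *)
From mathcomp Require Import all_boot all_order all_fingroup all_algebra.
From mathcomp Require Import all_classical all_reals all_analysis.

Set Implicit Arguments.
Unset Strict Implicit.
Unset Printing Implicit Defensive.

Import Order.TTheory GRing.Theory Num.Theory.

Local Open Scope ring_scope.

Definition expect (R : realType) (T : finType) (U : {set T}) (F : T -> R) : R :=
  (\sum_(x in U) F x) / #|U|%:R.

Definition density (R : realType) (T : finType) (A U : {set T}) : R :=
  #|A :&: U|%:R / #|U|%:R.

Definition mu (R : realType) (n : nat) (A : {set 'S_n}) : R :=
  density R A [set: 'S_n].

Definition umvirate (n t : nat) (I J : t.-tuple 'I_n) : {set 'S_n} :=
  [set s : 'S_n | [forall l, s (tnth I l) == tnth J l]].

Definition relatively_global (R : realType) (n t : nat) (K : R)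
    (A : {set 'S_n}) : Prop :=
  forall I J : t.-tuple 'I_n, uniq I -> uniq J ->
    density R A (umvirate I J) <= K * mu R A.

(* [R^o] rather than [R], so that the type is a [vectType] over [R]. *)
Definition L2fun (R : realType) (n : nat) := {ffun 'S_n -> R^o}.

Definition inner (R : realType) (n : nat) (f g : L2fun R n) : R :=
  expect [set: 'S_n] (fun s => f s * g s).

Definition norm2 (R : realType) (n : nat) (f : L2fun R n) : R :=
  Num.sqrt (inner f f).

Definition indicator (R : realType) (n : nat) (U : {set 'S_n}) : L2fun R n :=
  [ffun s => (s \in U)%:R].

Definition W (R : realType) (n d : nat) : {vspace {ffun 'S_n -> R^o}} :=
  (\sum_(I : d.-tuple 'I_n | uniq I) \sum_(J : d.-tuple 'I_n | uniq J)
     <[indicator R (umvirate I J)]>)%VS.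

(* For [d = 0] the space [W_{-1}] is zero, so [V_{=0} = W_0]. *)
Definition Veq (R : realType) (n d : nat) : set (L2fun R n) :=
  fun f => f \in W R n d /\
    ((0 < d)%N -> forall g : L2fun R n, g \in W R n d.-1 -> inner f g = 0).

(* The product [a x] of the paper is the composition [a \o x], which is
   [(x * a)%g] here because permutations of [perm] multiply left to right. *)
Definition Top (R : realType) (n : nat) (A : {set 'S_n}) (f : L2fun R n) :
    L2fun R n :=
  [ffun x => expect A (fun a : 'S_n => f (x * a)%g)].

(* The supremum is taken in [\bar R], where it always exists. *)
Definition level_norm (R : realType) (n d : nat) (A : {set 'S_n}) : \bar R :=
  ereal_sup [set (norm2 (Top A f) / norm2 f)%:E |
               f in [set f : L2fun R n | Veq d f /\ f <> 0]]%classic.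

Definition conj_closed (n : nat) (A : {set 'S_n}) : Prop :=
  forall a s : 'S_n, a \in A -> (a ^ s)%g \in A.

(* Main.v *)
(* A level-[d] function is a sum [f x = \sum_I c I (x o I)] over [d]-tuples [I], in
   which [c] is pure in both arguments (supported on injective tuples, with all
   line sums zero) and [sum c^2] is comparable to the squared norm of [f]. So the
   norm of [T_A] at level [d] is comparable to that of the transition matrix of a
   random element of [A] on pure functions of [d]-tuples. A uniformly random
   permutation moves [d] disjoint blocks of about [n / d] points to a random
   place, and a pure function keeps, on average, at least half of its mass when it
   is projected there onto the functions with zero line sums; hence the
   Hilbert-Schmidt norm of the projected transition matrix [coef] bounds the
   operator norm.

   The square of that Hilbert-Schmidt norm is at most [K (log n)^(2d) / n^d], up to constants.
   Testing [coef] against itself turns it into the average over [A] of a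
   statistic [\sum_k Z k (x o pt k)] of a permutation [x]. Its moments under the
   uniform measure are bounded by those of its square function, one coordinate at
   a time, by exchangeable pairs; a high moment then controls the average over the
   dense set [A]. This bounds every slice of the matrix by the square root of the
   largest one.

   If [A] is closed under conjugation, the matrix acts on pure functions through
   alternating sums that do not depend on the place in the block. Averaging
   them over the block gains the further factor [n^(-d)]. *)

Require Import Defs.
From HB Require Import structures.
From mathcomp Require Import all_boot all_order all_fingroup all_algebra.
From mathcomp Require Import zify ring lra.
From mathcomp Require Import all_classical all_reals all_analysis.
From mathcomp Require Import fintype finset.

Set Implicit Arguments.
Unset Strict Implicit.
Unset Printing Implicit Defensive.

Import Order.TTheory GRing.Theory Num.Theory.

Local Open Scope ring_scope.

(** Injective tuples do not form a product set, so a projection onto zero line sums cannot be taken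
    there one coordinate at a time. Rows drawn from disjoint blocks are injective whatever their
    coordinates, so they are indexed by a full product, on which the projection is explicit. Only
    the rows are projected, and the moment bounds use cancellation in the row index alone. The order
    [q] of the moments is about [2 C log n], so that [9 ^+ q] exceeds the inverse density of [A].
    All powers of the logarithm come from [q]: in each coordinate one factor [q] is the price of
    replacing the statistic by its square function, and another comes from the points already
    revealed when a power of the square function is expanded. The squared norm thus carries
    [(log n)^(2d)]; a second such factor absorbs the constants that depend on [C] and [d], and the
    square root leaves the exponent [2 d]. The bound must be linear in [K] before the root is taken,
    so globalness may be used at full strength only once. *)

(** * Tuples and permutations *)

Section Tuples.

Variables (D T : finType).

Definition upd (I : {ffun D -> T}) (l : D) (k : T) : {ffun D -> T} :=
  [ffun m => if m == l then k else I m].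

Definition mix (S : {set D}) (I J : {ffun D -> T}) : {ffun D -> T} :=
  [ffun l => if l \in S then J l else I l].

Lemma updE I l k m : upd I l k m = if m == l then k else I m.
Proof. by rewrite ffunE. Qed.

Lemma mixE S I J l : mix S I J l = if l \in S then J l else I l.
Proof. by rewrite ffunE. Qed.

Lemma upd_eq I l k : upd I l k l = k.
Proof. by rewrite updE eqxx. Qed.

Lemma upd_id I l : upd I l (I l) = I.
Proof. by apply/ffunP => m; rewrite updE; case: eqP => [->|]. Qed.

Lemma upd_upd I l j k : upd (upd I l j) l k = upd I l k.
Proof. by apply/ffunP => m; rewrite !updE; case: eqP. Qed.

Lemma mix_set0 I J : mix set0 I J = I.
Proof. by apply/ffunP => m; rewrite mixE inE. Qed.

(** Exchanging [k] with the entry of [I] at [l] is an involution. *)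
Lemma sum_upd (R : nmodType) l (G : {ffun D -> T} -> T -> R) :
  \sum_I \sum_k G (upd I l k) (I l) = \sum_I \sum_k G I k.
Proof.
rewrite !pair_big /=.
rewrite [RHS](reindex (fun p : {ffun D -> T} * T => (upd p.1 l p.2, p.1 l))) //.
exists (fun p : {ffun D -> T} * T => (upd p.1 l p.2, p.1 l)) => -[I k] _ /=;
  by rewrite upd_upd upd_id upd_eq.
Qed.

Lemma sum_mix (R : nmodType) S (G : {ffun D -> T} -> {ffun D -> T} -> R) :
  \sum_I \sum_J G (mix S I J) (mix S J I) = \sum_I \sum_J G I J.
Proof.
rewrite !pair_big /=.
pose h (p : {ffun D -> T} * {ffun D -> T}) := (mix S p.1 p.2, mix S p.2 p.1).
have hK : involutive h.
  move=> [I J]; rewrite /h /=.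
  by congr (_, _); apply/ffunP => m; rewrite !mixE; case: (m \in S).
by rewrite [RHS](reindex_inj (inv_inj hK)).
Qed.

Lemma sum_line0 (R : numDomainType) l (F : {ffun D -> T} -> R) :
  (forall I, \sum_k F (upd I l k) = 0) -> \sum_I F I = 0.
Proof.
move=> F0.
(* The proof divides by [#|T|]; if [T] is empty there is no tuple at all, since one would have an
   entry at [l]. *)
have [/eqP T0|T0] := boolP (#|T| == 0)%N.
  by rewrite big1 // => I _; move: (card0_eq T0 (I l)); rewrite !inE.
have E := sum_upd l (fun I (_ : T) => F I).
rewrite /= big1 in E; last by move=> I _; exact: F0.
move: E; under eq_bigr do rewrite sumr_const.
rewrite sumrMnl => /esym /eqP; by rewrite mulrn_eq0 (negbTE T0) => /eqP.
Qed.

End Tuples.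

Section Permutations.

Variable n : nat.

Definition act (D : finType) (x : 'S_n) (I : {ffun D -> 'I_n}) : {ffun D -> 'I_n} :=
  [ffun l => x (I l)].

Lemma actE (D : finType) x (I : {ffun D -> 'I_n}) l : act x I l = x (I l).
Proof. by rewrite ffunE. Qed.

Lemma actM (D : finType) x y (I : {ffun D -> 'I_n}) :
  act (x * y)%g I = act y (act x I).
Proof. by apply/ffunP => l; rewrite !actE permM. Qed.

Lemma act_inj (D : finType) x : injective (@act D x).
Proof.
by move=> I J /ffunP E; apply/ffunP => l; move: (E l); rewrite !actE => /perm_inj.
Qed.

Lemma act_upd (D : finType) x (I : {ffun D -> 'I_n}) l k :
  act x (upd I l k) = upd (act x I) l (x k).
Proof. by apply/ffunP => m; rewrite !ffunE; case: ifP. Qed.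

Lemma act_mix (D : finType) x S (I J : {ffun D -> 'I_n}) :
  act x (mix S I J) = mix S (act x I) (act x J).
Proof. by apply/ffunP => m; rewrite !ffunE; case: ifP. Qed.

Lemma injectiveb_act (D : finType) x (I : {ffun D -> 'I_n}) :
  injectiveb (act x I) = injectiveb I.
Proof.
apply/injectiveP/injectiveP => H i j.
  by move=> E; apply: H; rewrite !actE E.
by rewrite !actE => /perm_inj /H.
Qed.

(** Built one point at a time: a transposition corrects the image of the new point, and injectivity
    keeps it away from the images already settled. *)
Lemma perm_extends (D : finType) (A : {set D}) (f g : D -> 'I_n) :
  {in A &, injective f} -> {in A &, injective g} ->
  exists s : 'S_n, {in A, forall i, s (f i) = g i}.
Proof.
move=> fI gI.
suff [s sP] : exists s : 'S_n, {in enum A, forall i, s (f i) = g i}.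
  by exists s => i iA; apply: sP; rewrite mem_enum.
have fI' : {in enum A &, injective f} by move=> i j; rewrite !mem_enum; apply: fI.
have gI' : {in enum A &, injective g} by move=> i j; rewrite !mem_enum; apply: gI.
elim: (enum A) (enum_uniq A) fI' gI' => [|i s IH] /= => [_ _ _|/andP[is_ us] fI' gI'].
  by exists 1%g => i; rewrite in_nil.
have sub j : j \in s -> j \in i :: s by rewrite inE => ->; rewrite orbT.
have [||t tP] := IH us.
- by move=> j k js ks; apply: fI'; exact: sub.
- by move=> j k js ks; apply: gI'; exact: sub.
exists (t * tperm (t (f i)) (g i))%g => j; rewrite inE permM.
case: (eqVneq j i) => [-> _|ji /= js]; first by rewrite tpermL.
rewrite (tP _ js) tpermD //.
  rewrite -(tP _ js) (inj_eq perm_inj); apply/eqP => /fI' E.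
  by rewrite E ?eqxx ?inE ?eqxx // in ji; rewrite js orbT.
apply/eqP => /gI' E; rewrite E ?eqxx // in ji; first by rewrite inE eqxx.
exact: sub.
Qed.

(** The set is a coset of the pointwise stabiliser of the image of [A] under [f]. *)
Lemma card_agree (D : finType) (A : {set D}) (f g : D -> 'I_n) :
  {in A &, injective f} -> {in A &, injective g} ->
  #|[set s : 'S_n | [forall i in A, s (f i) == g i]]| = (n - #|A|)`!.
Proof.
move=> fI gI; have [t tP] := perm_extends fI gI.
have -> : [set s : 'S_n | [forall i in A, s (f i) == g i]] =
    (fun h : 'S_n => h * t)%g @: [set h | perm_on (~: (f @: A)) h].
  apply/setP => s; apply/idP/imsetP => [|[h]].
    rewrite inE => /'forall_implyP sP; exists (s * t^-1)%g; last by rewrite mulgKV.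
    rewrite inE; apply/subsetP => i; rewrite inE permM; apply: contraR.
    rewrite inE negbK => /imsetP[j jA ->].
    by rewrite (eqP (sP _ jA)) -(tP _ jA) permK.
  rewrite !inE => hP ->; apply/'forall_implyP => i iA.
  rewrite permM (out_perm hP) ?tP //; rewrite inE negbK; exact: imset_f.
rewrite card_imset; last exact: mulIg.
rewrite cardsE card_perm; congr factorial.
by rewrite cardsCs setCK card_ord card_in_imset.
Qed.

Lemma card_act_eq (D : finType) (I J : {ffun D -> 'I_n}) :
  injectiveb I -> injectiveb J ->
  #|[set s : 'S_n | act s I == J]| = (n - #|D|)`!.
Proof.
move=> /injectiveP II /injectiveP JI.
rewrite -cardsT -(@card_agree D setT I J); last first.
- by move=> i j _ _; exact: JI.
- by move=> i j _ _; exact: II.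
congr #|pred_of_set _|; apply/setP => s; rewrite !inE.
apply/eqP/'forall_implyP => [<- i _|E]; first by rewrite actE.
by apply/ffunP => i; rewrite actE (eqP (E i _)) ?inE.
Qed.

Lemma sum_act (R : pzRingType) (D : finType) (I : {ffun D -> 'I_n})
    (F : {ffun D -> 'I_n} -> R) : injectiveb I ->
  \sum_(s : 'S_n) F (act s I) =
    (n - #|D|)`!%:R * \sum_(J : {ffun D -> 'I_n} | injectiveb J) F J.
Proof.
move=> II; rewrite (partition_big (fun s => act s I) (fun J => injectiveb J)) /=;
  last by move=> s _; rewrite injectiveb_act.
rewrite mulr_sumr; apply: eq_bigr => J JI.
under eq_bigr => s /eqP -> do rewrite -[F J]mul1r.
rewrite -mulr_suml sumr_const; congr (_%:R * _).
by rewrite -(card_act_eq II JI); apply: eq_card => s; rewrite inE.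
Qed.

End Permutations.

(** * Moments of statistics of a random permutation *)

Section Inequalities.

Variable R : realFieldType.
Implicit Types (x y : R).

Lemma cauchy_schwarz (I : finType) (P : pred I) (f g : I -> R) :
  (\sum_(i | P i) f i * g i) ^+ 2 <=
  (\sum_(i | P i) f i ^+ 2) * (\sum_(i | P i) g i ^+ 2).
Proof.
have : 0 <= \sum_(i | P i) \sum_(j | P j) (f i * g j - f j * g i) ^+ 2.
  by apply: sumr_ge0 => i _; apply: sumr_ge0 => j _; exact: sqr_ge0.
have E i j : (f i * g j - f j * g i) ^+ 2 =
    f i ^+ 2 * g j ^+ 2 + g i ^+ 2 * f j ^+ 2 - 2 * ((f i * g i) * (f j * g j)).
  by ring.
under eq_bigr do under eq_bigr do rewrite E.
under eq_bigr do rewrite sumrB big_split /= -!mulr_sumr.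
rewrite sumrB big_split /= -!mulr_suml -mulr_sumr -mulr_suml.
rewrite (mulrC (\sum_(i | P i) g i ^+ 2)) -expr2; lra.
Qed.

Lemma exp_mul_le_add x y m k : 0 <= x -> 0 <= y ->
  x ^+ m * y ^+ k <= x ^+ (m + k) + y ^+ (m + k).
Proof.
move=> x0 y0; case: (leP x y) => xy.
  apply: (@le_trans _ _ (y ^+ m * y ^+ k)).
    by rewrite ler_wpM2r ?exprn_ge0 // lerXn2r // nnegrE.
  by rewrite -exprD lerDr exprn_ge0.
apply: (@le_trans _ _ (x ^+ m * x ^+ k)).
  by rewrite ler_wpM2l ?exprn_ge0 // lerXn2r ?nnegrE // ltW.
by rewrite -exprD lerDl exprn_ge0.
Qed.

Lemma chebyshev_exp x y m : 0 <= x -> 0 <= y -> 0 <= (x ^+ m - y ^+ m) * (x - y).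
Proof.
move=> x0 y0; case: (leP x y) => xy.
  by apply: mulr_le0; rewrite subr_le0 // lerXn2r ?nnegrE.
by apply: mulr_ge0; rewrite subr_ge0 ?lerXn2r ?nnegrE // ltW.
Qed.

Lemma expB_mulB_le x y m : 0 <= x -> 0 <= y ->
  (x ^+ m.+1 - y ^+ m.+1) * (x - y) <= m.+1%:R * (x - y) ^+ 2 * (x ^+ m + y ^+ m).
Proof.
move=> x0 y0; rewrite subrXX mulrAC -expr2 -[leRHS]mulrA [leRHS]mulrCA.
apply: ler_wpM2l; first exact: sqr_ge0.
have -> : m.+1%:R * (x ^+ m + y ^+ m) = \sum_(i < m.+1) (x ^+ m + y ^+ m) :> R.
  by rewrite sumr_const card_ord mulr_natl.
apply: ler_sum => i _ /=.
have e : ((m - i) + i = m)%N by rewrite subnK // -ltnS.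
by have := exp_mul_le_add (m - i) i x0 y0; rewrite e.
Qed.

(** Splitting [u i * a ^+ r - v i * c ^+ r] into its parts along [u i - v i] and [u i + v i] leaves
    half of [(a ^+ r + c ^+ r) * d] and half of [(a ^+ r - c ^+ r) * (a - c)]. Cauchy-Schwarz bounds
    [(a - c) ^+ 2] by [2 * d * (a + c)], and a Chebyshev inequality restores the power [r]. *)
Lemma vector_exp_lip (I : finType) (u v : I -> R) (a c : R) r :
  a = \sum_i u i ^+ 2 -> c = \sum_i v i ^+ 2 ->
  \sum_i (u i - v i) * (u i * a ^+ r - v i * c ^+ r) <=
  (2 * r%:R + 1) * (\sum_i (u i - v i) ^+ 2) * (a ^+ r + c ^+ r).
Proof.
move=> aE cE; set d := \sum_i (u i - v i) ^+ 2.
have a0 : 0 <= a by rewrite aE; apply: sumr_ge0 => i _; exact: sqr_ge0.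
have c0 : 0 <= c by rewrite cE; apply: sumr_ge0 => i _; exact: sqr_ge0.
have d0 : 0 <= d by apply: sumr_ge0 => i _; exact: sqr_ge0.
have acE : a - c = \sum_i (u i - v i) * (u i + v i).
  by rewrite aE cE -sumrB; apply: eq_bigr => i _; ring.
have -> : \sum_i (u i - v i) * (u i * a ^+ r - v i * c ^+ r) =
    2^-1 * (a ^+ r + c ^+ r) * d + 2^-1 * (a ^+ r - c ^+ r) * (a - c).
  rewrite acE !mulr_sumr -big_split /=; apply: eq_bigr => i _.
  by field.
have ac2 : (a - c) ^+ 2 <= d * (2 * (a + c)).
  rewrite acE; apply: le_trans (cauchy_schwarz _ _ _) _.
  apply: ler_wpM2l => //; rewrite aE cE mulrDr !mulr_sumr -big_split /=.
  apply: ler_sum => i _; rewrite -subr_ge0.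
  have -> : 2 * u i ^+ 2 + 2 * v i ^+ 2 - (u i + v i) ^+ 2 = (u i - v i) ^+ 2 by ring.
  exact: sqr_ge0.
case: r => [|r]; first by rewrite !expr0 subrr; lra.
have H1 := expB_mulB_le r a0 c0.
have H2 := chebyshev_exp r a0 c0.
have H2' : (a ^+ r + c ^+ r) * (a + c) <= 2 * (a ^+ r.+1 + c ^+ r.+1).
  rewrite -subr_ge0; apply: le_trans H2 _; rewrite le_eqVlt; apply/orP; left.
  by apply/eqP; rewrite !exprS; ring.
have p0 : 0 <= a ^+ r + c ^+ r by rewrite addr_ge0 ?exprn_ge0.
have p1 : 0 <= a ^+ r.+1 + c ^+ r.+1 by rewrite addr_ge0 ?exprn_ge0.
have H3 : (a - c) ^+ 2 * (a ^+ r + c ^+ r) <= 4 * d * (a ^+ r.+1 + c ^+ r.+1).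
  apply: le_trans (ler_wpM2r p0 ac2) _.
  apply: (@le_trans _ _ (2 * d * ((a ^+ r + c ^+ r) * (a + c)))).
    by rewrite le_eqVlt; apply/orP; left; apply/eqP; ring.
  apply: le_trans (ler_wpM2l _ H2') _; first by rewrite mulr_ge0.
  by rewrite le_eqVlt; apply/orP; left; apply/eqP; ring.
have H4 : (a ^+ r.+1 - c ^+ r.+1) * (a - c) <= r.+1%:R * (4 * d * (a ^+ r.+1 + c ^+ r.+1)).
  by apply: le_trans H1 _; rewrite -mulrA ler_wpM2l.
have p2 : 0 <= d * (a ^+ r.+1 + c ^+ r.+1) by rewrite mulr_ge0.
move: H4 p2 p1; set A := a ^+ _; set C := c ^+ _; set N := r.+1%:R.
move=> H4 p2 p1.
have -> : (2 * N + 1) * d * (A + C) = 2^-1 * (N * (4 * d * (A + C))) + d * (A + C).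
  by field.
have -> : 2^-1 * (A + C) * d = 2^-1 * (d * (A + C)) by ring.
rewrite -(mulrA 2^-1 (A - C)); lra.
Qed.

(** Compare [y] with [2 * s * v]. The coefficient one half lets the power of [y] be absorbed by the
    moment that is being estimated. *)
Lemma young_exp (s v y : R) r : 0 <= s -> 0 <= v -> 0 <= y ->
  s * v * y ^+ r <= 2^-1 * y ^+ r.+1 + 2^-1 * (2 * s * v) ^+ r.+1.
Proof.
move=> s0 v0 y0; have sv0 : 0 <= s * v by rewrite mulr_ge0.
case: (leP (2 * s * v) y) => h.
  apply: (@le_trans _ _ (2^-1 * y ^+ r.+1)).
    rewrite exprS mulrA ler_wpM2r ?exprn_ge0 //; lra.
  by rewrite lerDl mulr_ge0 ?invr_ge0 // exprn_ge0 // -mulrA mulr_ge0.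
apply: (@le_trans _ _ (2^-1 * (2 * s * v) ^+ r.+1)).
  have -> : 2^-1 * (2 * s * v) ^+ r.+1 = s * v * (2 * s * v) ^+ r.
    by rewrite exprS; field.
  by rewrite ler_wpM2l // lerXn2r ?nnegrE // -?mulrA ?mulr_ge0 // mulrA ltW.
by rewrite lerDr mulr_ge0 ?invr_ge0 // exprn_ge0.
Qed.

(** Induction by Chebyshev's sum inequality, as [v i ^+ q.+1] and [v i] are ordered alike. *)
Lemma power_mean (I : finType) (v : I -> R) q : (forall i, 0 <= v i) ->
  (\sum_i v i) ^+ q.+1 <= #|I|%:R ^+ q * \sum_i v i ^+ q.+1.
Proof.
move=> v0; elim: q => [|q IH]; first by rewrite expr0 mul1r.
have S0 : 0 <= \sum_i v i by apply: sumr_ge0.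
rewrite exprSr; apply: le_trans (ler_wpM2r S0 IH) _.
rewrite exprSr -!mulrA ler_wpM2l ?exprn_ge0 ?ler0n //.
have : 0 <= \sum_i \sum_j (v i ^+ q.+1 - v j ^+ q.+1) * (v i - v j).
  by apply: sumr_ge0 => i _; apply: sumr_ge0 => j _; exact: chebyshev_exp.
have E i j : (v i ^+ q.+1 - v j ^+ q.+1) * (v i - v j) =
    (v i ^+ q.+2 + v j ^+ q.+2) - (v i ^+ q.+1 * v j + v i * v j ^+ q.+1).
  by rewrite (exprS _ q.+1) (exprS _ q.+1); ring.
have -> : \sum_i \sum_j (v i ^+ q.+1 - v j ^+ q.+1) * (v i - v j) =
    2 * (#|I|%:R * \sum_i v i ^+ q.+2) - 2 * ((\sum_i v i ^+ q.+1) * \sum_i v i).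
  have E1 i : \sum_j (v i ^+ q.+1 - v j ^+ q.+1) * (v i - v j) =
     (#|I|%:R * v i ^+ q.+2 + \sum_j v j ^+ q.+2) -
     (v i ^+ q.+1 * \sum_j v j + v i * \sum_j v j ^+ q.+1).
    under eq_bigr do rewrite E.
    by rewrite sumrB !big_split /= sumr_const -!mulr_sumr -[v i ^+ _ *+ _]mulr_natl.
  under eq_bigr do rewrite E1.
  rewrite sumrB !big_split /= sumr_const -!mulr_suml -mulr_sumr -[_ *+ #|I|]mulr_natl.
  by ring.
by rewrite subr_ge0 ler_pM2l.
Qed.

End Inequalities.

(** * A Khintchine inequality for one block of points *)

Section Khintchine.

Variables (R : realFieldType) (n b : nat) (E : finType).
Variables (p : 'I_b.+1 -> 'I_n) (w : E -> 'I_b.+1 -> 'I_n -> 'S_n -> R).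

Hypothesis p_inj : injective p.
(** The weights may depend on [x], but not on how [x] matches the block [p] with its set of images;
    only this matching is resampled. *)
Hypothesis w_inv : forall e a j (s x : 'S_n),
  (forall i, (forall a, i != p a) -> s i = i) -> w e a j (s * x)%g = w e a j x.
Hypothesis w0 : forall e j x, \sum_a w e a j x = 0.

Let Y (x : 'S_n) e := \sum_a w e a (x (p a)) x.
Let W (x : 'S_n) := \sum_e Y x e ^+ 2.
Let V (x : 'S_n) := \sum_e \sum_a w e a (x (p a)) x ^+ 2.
Let V' (x : 'S_n) := b.+1%:R^-1 * \sum_e \sum_a \sum_c w e a (x (p c)) x ^+ 2.
Let sw a c (x : 'S_n) := (tperm (p a) (p c) * x)%g.

Let sw_inv e a c d j x : w e d j (sw a c x) = w e d j x.
Proof. by apply: w_inv => i ip; rewrite tpermD // eq_sym. Qed.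

Let swK a c : involutive (sw a c).
Proof. by move=> x; rewrite /sw mulgA tperm2 mul1g. Qed.

Let Y_sw x e a c : Y x e - Y (sw a c x) e =
  w e a (x (p a)) x + w e c (x (p c)) x - w e a (x (p c)) x - w e c (x (p a)) x.
Proof.
case: (eqVneq a c) => [<-|ac].
  have -> : sw a a x = x by rewrite /sw tperm1 mul1g.
  by rewrite subrr addrK subrr.
rewrite /Y; under [X in _ - X]eq_bigr do rewrite sw_inv permM.
rewrite (bigD1 a) //= (bigD1 c) 1?eq_sym //= [X in _ - X](bigD1 a) //=.
rewrite [X in _ - (_ + X)](bigD1 c) 1?eq_sym //= tpermL tpermR.
have -> : \sum_(i | (i != a) && (i != c)) w e i (x (tperm (p a) (p c) (p i))) x =
          \sum_(i | (i != a) && (i != c)) w e i (x (p i)) x.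
  apply: eq_bigr => i /andP[ia ic].
  by rewrite tpermD // (inj_eq p_inj) eq_sym.
by ring.
Qed.

(* Only the column sums of [w] vanish, yet the exchange operator has the exact
   eigenvalue [2 (b + 1)] on [Y]. *)
Let Y_total x e : \sum_a \sum_c (Y x e - Y (sw a c x) e) = 2 * b.+1%:R * Y x e.
Proof.
under eq_bigr do under eq_bigr do rewrite Y_sw.
under eq_bigr do rewrite !sumrB big_split /= sumr_const card_ord -/(Y x e).
rewrite !sumrB big_split /= sumr_const card_ord sumrMnl -/(Y x e).
rewrite [X in _ - X - _]exchange_big /= [X in _ - X - _]big1; last by move=> c _; exact: w0.
rewrite [X in _ - X]big1; last by move=> a _; exact: w0.
by rewrite !subr0 -mulr_natr; ring.
Qed.

(* Exchangeable pairs: [x] and [sw a c x] have the same law, which symmetrises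
   the identity [Y_total] into a bound by the squared gaps. *)
Let gap a c x := \sum_e (Y x e - Y (sw a c x) e) ^+ 2.

Let gap_total x : \sum_a \sum_c gap a c x <= 8 * b.+1%:R * (V x + V' x).
Proof.
have sq4 (t1 t2 t3 t4 : R) : (t1 + t2 - t3 - t4) ^+ 2 <=
    4 * (t1 ^+ 2 + t2 ^+ 2 + t3 ^+ 2 + t4 ^+ 2).
  rewrite -subr_ge0.
  have -> : 4 * (t1 ^+ 2 + t2 ^+ 2 + t3 ^+ 2 + t4 ^+ 2) - (t1 + t2 - t3 - t4) ^+ 2 =
    (t1 - t2) ^+ 2 + (t3 - t4) ^+ 2 + (t1 + t3) ^+ 2 + (t1 + t4) ^+ 2 +
    (t2 + t3) ^+ 2 + (t2 + t4) ^+ 2 by ring.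
  by rewrite !addr_ge0 ?sqr_ge0.
pose g e a c := w e a (x (p c)) x ^+ 2.
have -> : V x + V' x = \sum_e (\sum_a g e a a + b.+1%:R^-1 * \sum_a \sum_c g e a c).
  by rewrite /V /V' mulr_sumr -big_split.
have -> : \sum_a \sum_c gap a c x =
    \sum_e \sum_a \sum_c (Y x e - Y (sw a c x) e) ^+ 2.
  under eq_bigr do rewrite exchange_big.
  by rewrite exchange_big.
rewrite mulr_sumr; apply: ler_sum => e _.
apply: (@le_trans _ _ (\sum_a \sum_c 4 * (g e a a + g e c c + g e a c + g e c a))).
  by apply: ler_sum => a _; apply: ler_sum => c _; rewrite Y_sw; exact: sq4.
under eq_bigr do rewrite -mulr_sumr !big_split /= sumr_const card_ord.
rewrite -mulr_sumr !big_split /= sumr_const card_ord sumrMnl.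
rewrite [X in _ + X]exchange_big /= le_eqVlt; apply/orP; left; apply/eqP.
by rewrite -mulr_natr; field; rewrite nat1r pnatr_eq0.
Qed.

Let W_ge0 x : 0 <= W x.
Proof. by apply: sumr_ge0 => e _; exact: sqr_ge0. Qed.

Let V_ge0 x : 0 <= V x.
Proof. by apply: sumr_ge0 => e _; apply: sumr_ge0 => a _; exact: sqr_ge0. Qed.

Let V'_ge0 x : 0 <= V' x.
Proof.
rewrite mulr_ge0 ?invr_ge0 ?ler0n //.
by do 3![apply: sumr_ge0 => ? _]; exact: sqr_ge0.
Qed.

Let sum_sw a c (F : 'S_n -> R) : \sum_x F (sw a c x) = \sum_x F x.
Proof. by rewrite [RHS](reindex_inj (inv_inj (swK a c))). Qed.

(** Pair [Y_total] with [Y x e * W x ^+ r] and sum over [x]. Symmetrising under each [sw a c] turns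
    the sum into gaps of [Y] against gaps of [Y * W ^+ r], to which [vector_exp_lip] applies;
    [gap_total] then sums over [a] and [c], and the factors [b.+1] cancel. *)
Let exchange r :
  \sum_x W x ^+ r.+1 <= 8 * r.+1%:R * \sum_x (V x + V' x) * W x ^+ r.
Proof.
have b0 : (0 : R) < b.+1%:R by rewrite ltr0n.
have half (a c : 'I_b.+1) :
    2 * \sum_x \sum_e (Y x e - Y (sw a c x) e) * (Y x e * W x ^+ r) =
    \sum_x \sum_e (Y x e - Y (sw a c x) e) *
                  (Y x e * W x ^+ r - Y (sw a c x) e * W (sw a c x) ^+ r).
  rewrite mulr_natl mulr2n -{1}(sum_sw a c) addrC -big_split /=; apply: eq_bigr => x _.
  rewrite swK -big_split /=; apply: eq_bigr => e _; ring.
have lip (a c : 'I_b.+1) :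
    2 * \sum_x \sum_e (Y x e - Y (sw a c x) e) * (Y x e * W x ^+ r) <=
    2 * (2 * r%:R + 1) * \sum_x gap a c x * W x ^+ r.
  rewrite half.
  apply: (@le_trans _ _ (\sum_x (2 * r%:R + 1) * gap a c x * (W x ^+ r + W (sw a c x) ^+ r))).
    by apply: ler_sum => x _; exact: vector_exp_lip.
  under eq_bigr do rewrite -mulrA mulrDr.
  rewrite -mulr_sumr big_split /=.
  have -> : \sum_x gap a c x * W x ^+ r =
      \sum_x gap a c x * W (sw a c x) ^+ r.
    rewrite -(sum_sw a c (fun x => gap a c x * W x ^+ r)).
    apply: eq_bigr => x _; congr (_ * _); apply: eq_bigr => e _.
    by rewrite swK -sqrrN opprB.
  by rewrite le_eqVlt; apply/orP; left; apply/eqP; ring.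
have total : \sum_a \sum_c (2 * \sum_x \sum_e (Y x e - Y (sw a c x) e) * (Y x e * W x ^+ r)) =
    4 * b.+1%:R * \sum_x W x ^+ r.+1.
  under eq_bigr do rewrite -mulr_sumr exchange_big /=.
  rewrite -mulr_sumr exchange_big /= -mulrA [RHS](_ : _ = 2 * (2 * b.+1%:R * \sum_x W x ^+ r.+1));
    last by ring.
  congr (_ * _); rewrite mulr_sumr; apply: eq_bigr => x _.
  under eq_bigr do rewrite exchange_big /=.
  rewrite exchange_big /= exprS {1}/W !mulr_suml mulr_sumr; apply: eq_bigr => e _.
  under eq_bigr do rewrite -mulr_suml.
  by rewrite -mulr_suml Y_total; ring.
have : 4 * b.+1%:R * \sum_x W x ^+ r.+1 <=
    2 * (2 * r%:R + 1) * (8 * b.+1%:R * \sum_x (V x + V' x) * W x ^+ r).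
  rewrite -total.
  apply: (@le_trans _ _ (\sum_a \sum_c 2 * (2 * r%:R + 1) * \sum_x gap a c x * W x ^+ r)).
    by apply: ler_sum => a _; apply: ler_sum => c _; exact: lip.
  under eq_bigr do rewrite -mulr_sumr exchange_big /=.
  rewrite -mulr_sumr exchange_big /=.
  rewrite ler_wpM2l ?mulr_ge0 ?addr_ge0 ?mulr_ge0 ?ler0n //.
  rewrite mulr_sumr; apply: ler_sum => x _.
  under eq_bigr do rewrite -mulr_suml.
  by rewrite -mulr_suml mulrA ler_wpM2r ?exprn_ge0.
set M := \sum_x _; set M' := \sum_x _ => H.
have M'0 : 0 <= M'.
  by apply: sumr_ge0 => x _; rewrite mulr_ge0 ?exprn_ge0 ?addr_ge0.
have {H} : M <= 4 * (2 * r%:R + 1) * M'.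
  rewrite -(ler_pM2l (_ : 0 < 4 * b.+1%:R)); last by rewrite mulr_gt0.
  by apply: le_trans H _; rewrite le_eqVlt; apply/orP; left; apply/eqP; ring.
move/le_trans; apply; rewrite ler_wpM2r // -[r.+1]addn1 natrD; lra.
Qed.

Let rot r (i : 'I_n) : 'I_n :=
  if [pick a | i == p a] is Some a then p (a + r) else i.

Let rot_p r a : rot r (p a) = p (a + r).
Proof.
rewrite /rot; case: pickP => [c /eqP /p_inj <- //|/(_ a)]; by rewrite eqxx.
Qed.

Let rot_out r i : (forall a, i != p a) -> rot r i = i.
Proof.
by move=> ip; rewrite /rot; case: pickP => // a ia; move: (ip a); rewrite ia.
Qed.

Let rot_inj r : injective (rot r).
Proof.
apply: (can_inj (g := rot (- r))) => i.
case: (pickP (fun a => i == p a)) => [a /eqP ->|H]; first by rewrite !rot_p addrK.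
have ip a : i != p a by rewrite H.
by rewrite !rot_out // => a; rewrite rot_out.
Qed.

(* Cyclic shifts of the [b + 1] columns exhibit [V'] as an average of translates of [V]. *)
Let V'_mean q : \sum_x V' x ^+ q.+1 <= \sum_x V x ^+ q.+1.
Proof.
have b0 : (0 : R) < b.+1%:R by rewrite ltr0n.
have VE x : V' x = b.+1%:R^-1 * \sum_r V (perm (@rot_inj r) * x)%g.
  congr (_ * _); rewrite [RHS]exchange_big /=; apply: eq_bigr => e _.
  rewrite [RHS]exchange_big /=; apply: eq_bigr => a _.
  rewrite (reindex_inj (addrI a)) /=; apply: eq_bigr => r _.
  rewrite w_inv ?permM ?permE ?rot_p // => i ip; by rewrite permE rot_out.
apply: (@le_trans _ _ (\sum_x \sum_r b.+1%:R^-1 * V (perm (@rot_inj r) * x)%g ^+ q.+1)).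
  apply: ler_sum => x _; rewrite VE exprMn -mulr_sumr.
  have B0 : 0 <= b.+1%:R^-1 ^+ q.+1 :> R by rewrite exprn_ge0 ?invr_ge0 ?ler0n.
  have := ler_wpM2l B0 (@power_mean R _ (fun r => V (perm (@rot_inj r) * x)%g) q
    (fun r => V_ge0 _)).
  rewrite card_ord (mulrA _ (_ ^+ q) (\sum_r _)).
  have -> : b.+1%:R^-1 ^+ q.+1 * b.+1%:R ^+ q = b.+1%:R^-1 :> R.
    by rewrite (exprS b.+1%:R^-1) -mulrA -exprMn mulVf ?lt0r_neq0 // expr1n mulr1.
  by [].
rewrite exchange_big /=.
have E1 r : \sum_x b.+1%:R^-1 * V (perm (@rot_inj r) * x)%g ^+ q.+1 =
    b.+1%:R^-1 * \sum_x V x ^+ q.+1.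
  by rewrite -mulr_sumr [in RHS](reindex_inj (mulgI (perm (@rot_inj r)))).
under eq_bigr do rewrite E1.
by rewrite sumr_const card_ord -[leLHS]mulr_natl mulrA mulfV ?mul1r ?lt0r_neq0.
Qed.

(** By [young_exp], half of the moment in [exchange] is absorbed on the left, which leaves the power
    of [16 * q * (V + V')]. The power mean splits [V + V'] at the cost of another factor 2, and
    [V'_mean] replaces [V'] by [V]. *)
Lemma khintchine q : (0 < q)%N ->
  \sum_(x : 'S_n) (\sum_e (\sum_a w e a (x (p a)) x) ^+ 2) ^+ q <=
  (32 * q%:R) ^+ q * \sum_(x : 'S_n) (\sum_e \sum_a w e a (x (p a)) x ^+ 2) ^+ q.
Proof.
case: q => // r _.
rewrite -[leLHS]/(\sum_x W x ^+ r.+1) -[X in _ <= _ * X]/(\sum_x V x ^+ r.+1).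
have H : \sum_x W x ^+ r.+1 <= \sum_x (16 * r.+1%:R * (V x + V' x)) ^+ r.+1.
  have := exchange r; rewrite mulr_sumr => H.
  have H2 : \sum_x 8 * r.+1%:R * ((V x + V' x) * W x ^+ r) <=
      2^-1 * (\sum_x W x ^+ r.+1) +
      2^-1 * \sum_x (16 * r.+1%:R * (V x + V' x)) ^+ r.+1.
    rewrite !mulr_sumr -big_split; apply: ler_sum => x _ /=.
    have := @young_exp _ (8 * r.+1%:R) (V x + V' x) (W x) r.
    rewrite mulr_ge0 ?ler0n // addr_ge0 // W_ge0 => /(_ isT isT isT).
    have -> : 2 * (8 * r.+1%:R) = 16 * r.+1%:R :> R by ring.
    by rewrite -[leLHS](mulrA (8 * r.+1%:R)).
  lra.
apply: le_trans H _.
apply: (@le_trans _ _ (\sum_x (16 * r.+1%:R) ^+ r.+1 * (2 ^+ r * (V x ^+ r.+1 + V' x ^+ r.+1)))).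
  apply: ler_sum => x _; rewrite exprMn ler_wpM2l ?exprn_ge0 ?mulr_ge0 ?ler0n //.
  have := @power_mean R bool (fun i => if i then V x else V' x) r.
  by rewrite !big_bool card_bool /= addrC [_ + V x]addrC; apply; case.
rewrite -!mulr_sumr big_split /= (_ : 32 = 16 * 2); last by rewrite -natrM.
have -> : (16 * 2 * r.+1%:R) ^+ r.+1 = (16 * r.+1%:R) ^+ r.+1 * (2 ^+ r * 2) :> R.
  by rewrite -exprSr -exprMn; congr (_ ^+ _); ring.
rewrite -!mulrA ler_wpM2l ?exprn_ge0 ?mulr_ge0 ?ler0n //.
rewrite ler_wpM2l ?exprn_ge0 //; have := V'_mean r; lra.
Qed.

End Khintchine.

(** * Moments of non-negative statistics *)

Section Positive.

Variables (R : realFieldType) (n : nat).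

Lemma card_agree_le (D : finType) (A : {set D}) (f g : D -> 'I_n) :
  {in A &, injective f} ->
  (#|[set s : 'S_n | [forall i in A, s (f i) == g i]]| <= (n - #|A|)`!)%N.
Proof.
move=> fI; have [->|[s]] := set_0Vmem [set s : 'S_n | [forall i in A, s (f i) == g i]].
  by rewrite cards0.
rewrite inE => /'forall_implyP sP; rewrite card_agree // => i j iA jA gE.
by apply: fI => //; apply: (@perm_inj _ s); rewrite (eqP (sP _ iA)) (eqP (sP _ jA)).
Qed.

(** Each of the [m] factors dropped from the factorial is at least [n / 2]. *)
Lemma fact_drop_le N m : (0 < n)%N -> (n + 2 * m <= 2 * N)%N ->
  (N - m)`!%:R <= (2 / n%:R) ^+ m * N`!%:R :> R.
Proof.
move=> n0; elim: m => [|m IH] h; first by rewrite subn0 expr0 mul1r.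
have {}IH : (N - m)`!%:R <= (2 / n%:R) ^+ m * N`!%:R :> R by apply: IH; lia.
have mN : (m < N)%N by lia.
have E : (N - m)`!%:R = (N - m)%:R * (N - m.+1)`!%:R :> R.
  by rewrite -natrM -{1 2}(subnSK mN) factS.
have np : (0 : R) < n%:R by rewrite ltr0n.
have Np : n%:R <= 2 * (N - m)%:R :> R by rewrite -natrM ler_nat; lia.
rewrite exprS -mulrA; apply: le_trans (ler_wpM2l _ IH).
  by rewrite E mulrA -[leLHS]mul1r ler_wpM2r ?ler0n // mulrAC ler_pdivlMr ?mul1r.
by rewrite divr_ge0 ?ler0n.
Qed.

(* The [theta l] enumerate pairwise disjoint blocks of points, one block for each
   coordinate; [pt k] is the tuple that takes the point [k l] of the block [l]. *)
Variables (D B : finType) (theta : D -> B -> 'I_n).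
Hypothesis theta_inj : forall l m j k, theta l j = theta m k -> l = m /\ j = k.

Definition pt (k : {ffun D -> B}) : {ffun D -> 'I_n} := [ffun l => theta l (k l)].

Lemma ptE k l : pt k l = theta l (k l).
Proof. by rewrite ffunE. Qed.

Lemma pt_injective k : injective (pt k).
Proof. by move=> l m; rewrite !ptE => /theta_inj[]. Qed.

Lemma pt_upd k l a : pt (upd k l a) = upd (pt k) l (theta l a).
Proof. by apply/ffunP => m; rewrite !ffunE; case: eqP => // ->. Qed.

Lemma pt_mix S j k : pt (mix S j k) = mix S (pt j) (pt k).
Proof. by apply/ffunP => m; rewrite !ffunE; case: ifP. Qed.

Definition agree (T : Type) (S : {set D}) (f g : {ffun D -> T}) :=
  forall l, l \in S -> f l = g l.

Definition agreeb (T : eqType) (S : {set D}) (f g : {ffun D -> T}) :=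
  [forall l in S, f l == g l].

Lemma agreebP (T : eqType) S (f g : {ffun D -> T}) :
  reflect (agree S f g) (agreeb S f g).
Proof.
by apply: (iffP 'forall_implyP) => H l /H; [move/eqP | move->].
Qed.

Variable u : {ffun D -> B} -> {ffun D -> 'I_n} -> R.
Hypothesis u0 : forall k J, 0 <= u k J.

Let d := #|D|.

Definition pstat (x : 'S_n) := \sum_k u k (act x (pt k)).

Variable M : R.
Hypothesis n_gt0 : (0 < n)%N.
Hypothesis slices : forall (T : {set D}) k0 J0,
  \sum_(k | agreeb T k k0) \sum_(J | agreeb T J J0) u k J <= n%:R ^+ (d - #|T|) * M.

Hypothesis M0 : 0 <= M.

(* Left multiplication by a uniform [h] that fixes [X] pointwise resamples [x]
   outside [X]: this is a conditional expectation given the values of [x] on [X]. *)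
Lemma pstat_fix (x : 'S_n) (X : {set 'I_n}) : (2 * (#|X| + d) <= n)%N ->
  \sum_(h in Sym (~: X)) pstat (h * x)%g <=
  (n - #|X|)`!%:R * ((2 * (#|X| + 2)%:R) ^+ d * M).
Proof.
set t := #|X| => tn.
pose fresh k := [set l | pt k l \notin X].
(* Once the values of [x] on [X] are known, the entries of [pt k] in [X] have fixed images, and
   every fresh entry hits its target with conditional probability at most [2 / n]. *)
have count k J : #|[set h in Sym (~: X) | act (h * x)%g (pt k) == J]|%:R <=
    (agreeb (~: fresh k) J (act x (pt k)))%:R *
      ((2 / n%:R) ^+ #|fresh k| * (n - t)`!%:R) :> R.
  have Sfix h i : h \in Sym (~: X) -> i \in X -> h i = i.
    by rewrite inE => hP iX; apply: (out_perm hP); rewrite inE negbK.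
  case: agreebP => [aJ|naJ]; last first.
    rewrite mul0r (_ : [set h in _ | _] = set0) ?cards0 //.
    apply/setP => h; rewrite !inE; apply/negP => /andP[hS /eqP hJ]; apply: naJ.
    move=> l; rewrite !inE negbK => lX; rewrite -hJ !actE permM (Sfix h) //.
    by rewrite inE.
  rewrite mul1r.
  pose f (s : 'I_n + D) := match s with inl i => i | inr l => pt k l end.
  pose g (s : 'I_n + D) := match s with inl i => i | inr l => x^-1%g (J l) end.
  pose A : {set 'I_n + D} := [set s | match s with inl i => i \in X | inr l => l \in fresh k end].
  have cA : #|A| = (t + #|fresh k|)%N.
    have -> : A = (inl @: X) :|: (inr @: fresh k).
      apply/setP => -[i|l]; rewrite !inE.
        rewrite mem_imset; last by move=> ? ? [].
        by case: imsetP => [[? _ //]|]; rewrite orbF.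
      rewrite orbC mem_imset ?inE; last by move=> ? ? [].
      by case: imsetP => [[? _ //]|]; rewrite orbF.
    rewrite cardsU !card_imset; try by move=> ? ? [].
    rewrite (_ : _ :&: _ = set0) ?cards0 ?subn0 //.
    by apply/setP => s; rewrite !inE; apply/negP => /andP[/imsetP[? _ ->] /imsetP[]].
  have fA : {in A &, injective f}.
    move=> [i|l] [j|m]; rewrite !inE /f => iA jA E.
    - by rewrite E.
    - by rewrite -E iA in jA.
    - by rewrite E jA in iA.
    - by rewrite (pt_injective E).
  apply: (@le_trans _ _ ((n - #|A|)`!%:R)); last first.
    rewrite cA subnDA; apply: fact_drop_le => //.
    have fd : (#|fresh k| <= d)%N by exact: max_card.
    by lia.
  rewrite ler_nat; apply: leq_trans (card_agree_le g fA).
  apply: subset_leq_card; apply/subsetP => h; rewrite !inE => /andP[hS /eqP hJ].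
  apply/'forall_implyP => -[i|l]; rewrite !inE /f /g => H.
    by rewrite (Sfix h) // inE.
  by rewrite -hJ actE permM permK.
have E1 : \sum_(h in Sym (~: X)) pstat (h * x)%g =
    \sum_k \sum_J #|[set h in Sym (~: X) | act (h * x)%g (pt k) == J]|%:R * u k J.
  rewrite exchange_big; apply: eq_bigr => k _ /=.
  rewrite (partition_big (fun h => act (h * x)%g (pt k)) xpredT) //=.
  apply: eq_bigr => J _.
  under eq_bigr => h /andP[_ /eqP ->] do rewrite -[u k J]mul1r.
  rewrite -mulr_suml sumr_const; congr (_%:R * _); apply: eq_card => h.
  by rewrite unfold_in !inE.
rewrite E1.
apply: (@le_trans _ _ (\sum_k \sum_J (agreeb (~: fresh k) J (act x (pt k)))%:R *
      ((2 / n%:R) ^+ #|fresh k| * (n - t)`!%:R) * u k J)).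
  by apply: ler_sum => k _; apply: ler_sum => J _; rewrite ler_wpM2r.
rewrite (partition_big (fun k => ~: fresh k) xpredT) //=.
have twon : 0 <= 2 / n%:R :> R by rewrite divr_ge0 ?ler0n.
(* There are [2 ^ d] choices of the set [T] of old coordinates, and [t ^ #|T|] ways to place them in
   [X]. The powers of [n] in [count] and in [slices] cancel, and [t ^ #|T| * 2 ^ (d - #|T|)] is at
   most [(t + 2) ^ d]. *)
apply: (@le_trans _ _ (\sum_(T : {set D}) (n - t)`!%:R * ((t + 2)%:R ^+ d * M))); last first.
  rewrite sumr_const -cardsT -powersetT card_powerset cardsT -/d.
  by rewrite -[leLHS]mulr_natl natrX exprMn mulrCA !mulrA lexx.
apply: ler_sum => T _.
(* [i0] fills the coordinates off [T], so that each partial tuple from [T] to [X] is counted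
   once. *)
pose i0 : 'I_n := Ordinal n_gt0.
pose fam := pffun_on i0 (mem T) (mem X).
have cfam : #|fam| = (t ^ #|T|)%N by rewrite card_pffun_on.
apply: (@le_trans _ _ (\sum_(f in fam)
   \sum_(k | agreeb T (pt k) f) \sum_(J | agreeb T J (act x f))
     ((2 / n%:R) ^+ (d - #|T|) * (n - t)`!%:R) * u k J)).
  rewrite [leRHS](exchange_big_dep xpredT) //= [leLHS]big_mkcond.
  apply: ler_sum => k _; case: eqP => [kT|_]; last first.
    apply: sumr_ge0 => f _; apply: sumr_ge0 => J _.
    by rewrite mulr_ge0 // mulr_ge0 ?exprn_ge0 ?ler0n.
  pose f : {ffun D -> 'I_n} := [ffun l => if l \in T then pt k l else i0].
  have fE : agree T (pt k) f by move=> l lT; rewrite [RHS]ffunE lT.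
  have ffam : f \in fam.
    apply/pffun_onP; split.
      apply/supportP => l lT; have {}lT : l \notin T by [].
      by rewrite ffunE (negbTE lT).
    move=> y /imageP[l lT ->]; have {}lT : l \in T by [].
    by rewrite ffunE lT; move: lT; rewrite -kT !inE negbK.
  have fP : (f \in fam) && agreeb T (pt k) f by rewrite ffam; apply/agreebP.
  rewrite (bigD1 f fP) /=.
  rewrite -[leLHS]addr0 lerD //; last first.
    apply: sumr_ge0 => g _; apply: sumr_ge0 => J _.
    by rewrite mulr_ge0 // mulr_ge0 ?exprn_ge0 ?ler0n.
  have -> : #|fresh k| = (d - #|T|)%N by rewrite cardsCs kT.
  rewrite kT [leRHS]big_mkcond; apply: ler_sum => J _.
  have -> : agreeb T J (act x f) = agreeb T J (act x (pt k)).
    by apply/agreebP/agreebP => H l lT; rewrite H // !actE fE.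
  by case: agreeb; rewrite ?mul1r ?mul0r.
apply: (@le_trans _ _ (\sum_(f in fam)
    ((2 / n%:R) ^+ (d - #|T|) * (n - t)`!%:R) * (n%:R ^+ (d - #|T|) * M))).
  apply: ler_sum => f _.
  under eq_bigr do rewrite -mulr_sumr.
  rewrite -mulr_sumr ler_wpM2l ?mulr_ge0 ?exprn_ge0 ?ler0n //.
  case: (pickP (fun k => agreeb T (pt k) f)) => [k0 /agreebP k0f|none]; last first.
    by rewrite big_pred0 ?mulr_ge0 ?exprn_ge0 ?ler0n.
  apply: le_trans (slices T k0 (act x f)).
  rewrite le_eqVlt; apply/orP; left; apply/eqP; apply: eq_bigl => k.
  apply/agreebP/agreebP => H l lT.
    by have := H l lT; rewrite -(k0f l lT) !ptE => /theta_inj[].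
  by rewrite -(k0f l lT) !ptE H.
have np : (0 : R) < n%:R by rewrite ltr0n.
rewrite sumr_const cfam -[leLHS]mulr_natl natrX.
have -> : t%:R ^+ #|T| * ((2 / n%:R) ^+ (d - #|T|) * (n - t)`!%:R *
    (n%:R ^+ (d - #|T|) * M)) = (n - t)`!%:R *
    ((t%:R ^+ #|T| * 2 ^+ (d - #|T|)) * M) * ((2 / n%:R) ^+ (d - #|T|) *
     (n%:R / 2) ^+ (d - #|T|)).
  rewrite !exprMn !exprVn; field.
  by rewrite !expf_neq0 ?lt0r_neq0 ?ltr0n.
rewrite -exprMn (_ : 2 / n%:R * (n%:R / 2) = 1); last first.
  by field; rewrite lt0r_neq0.
rewrite expr1n mulr1 ler_wpM2l ?ler0n // ler_wpM2r //.
have Td : (#|T| <= d)%N by exact: max_card.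
rewrite -[in leRHS](subnKC Td) exprD ler_pM ?exprn_ge0 ?ler0n //.
  by rewrite lerXn2r ?nnegrE ?ler0n // ler_nat leq_addr.
by rewrite lerXn2r ?nnegrE ?ler0n // ler_nat leq_addl.
Qed.

Variable tm : nat.
Hypothesis tm_le : (2 * (tm + d) <= n)%N.

Let G := (2 * (tm + 2)%:R) ^+ d * M.

Let G_ge0 : 0 <= G.
Proof. by rewrite mulr_ge0 ?exprn_ge0 ?mulr_ge0 ?ler0n. Qed.

(** Expand one factor of the power. The points of its tuple join the fixed set, and the conditional
    average of the remaining power is bounded by the assumption, which is uniform in the fixed set
    and in the values on it. *)
Lemma pstat_step q (X : {set 'I_n}) (x : 'S_n) : (#|X| + q.+1 * d <= tm)%N ->
  (forall (X' : {set 'I_n}) (x' : 'S_n), (#|X'| + q * d <= tm)%N ->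
     \sum_(h in Sym (~: X')) pstat (h * x')%g ^+ q <= (n - #|X'|)`!%:R * G ^+ q) ->
  \sum_(h in Sym (~: X)) pstat (h * x)%g ^+ q.+1 <=
  G ^+ q * \sum_(h in Sym (~: X)) pstat (h * x)%g.
Proof.
move=> Xt IH.
under eq_bigr do rewrite exprS {1}/pstat mulr_suml.
rewrite exchange_big [X in _ <= _ * X]exchange_big /= mulr_sumr.
apply: ler_sum => k _.
pose X' := X :|: [set pt k l | l in [set: D]].
have cX' : (#|X'| <= #|X| + d)%N.
  rewrite cardsU; apply: leq_trans (leq_subr _ _) _; rewrite leq_add2l.
  by apply: leq_trans (leq_imset_card _ _) _; rewrite cardsT.
have sub h' : h' \in Sym (~: X') -> h' \in Sym (~: X).
  rewrite !inE => /subset_trans; apply; rewrite setCS; exact: subsetUl.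
have fix_pt h' l : h' \in Sym (~: X') -> h' (pt k l) = pt k l.
  rewrite inE => hP; apply: (out_perm hP); rewrite inE negbK inE; apply/orP; right.
  exact: imset_f.
have mp : (0 : R) < (n - #|X'|)`!%:R by rewrite ltr0n fact_gt0.
rewrite -(ler_pM2l mp).
(* Resampling by [h'] fixes [X] and the points of [pt k], so it changes only the second factor. *)
have -> : (n - #|X'|)`!%:R * (\sum_(h in Sym (~: X)) u k (act (h * x)%g (pt k)) * pstat (h * x)%g ^+ q) =
  \sum_(h in Sym (~: X)) u k (act (h * x)%g (pt k)) *
     \sum_(h' in Sym (~: X')) pstat (h' * (h * x))%g ^+ q.
  have <- : #|Sym (~: X')| = (n - #|X'|)`!%N.
    by rewrite card_Sym cardsCs setCK card_ord.
  rewrite mulr_natl -sumr_const.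
  under [RHS]eq_bigr do rewrite mulr_sumr.
  rewrite [RHS]exchange_big /=; apply: eq_bigr => h' h'P.
  rewrite (reindex_inj (mulgI h')) /=; apply: eq_big => h.
    by rewrite (groupMl _ (sub _ h'P)).
  move=> _; rewrite -mulgA; congr (u k _ * _); apply/ffunP => l.
  by rewrite !actE permM fix_pt.
rewrite mulr_sumr mulr_sumr; apply: ler_sum => h _.
rewrite mulrC [leRHS](_ : _ = (n - #|X'|)`!%:R * G ^+ q * u k (act (h * x)%g (pt k)));
  last by ring.
by rewrite ler_wpM2r // IH //; lia.
Qed.

Lemma pstat_exp q (X : {set 'I_n}) (x : 'S_n) : (#|X| + q * d <= tm)%N ->
  \sum_(h in Sym (~: X)) pstat (h * x)%g ^+ q <= (n - #|X|)`!%:R * G ^+ q.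
Proof.
elim: q X x => [|q IH] X x Xt.
  by rewrite sumr_const card_Sym cardsCs setCK card_ord !expr0 mulr1.
apply: le_trans (pstat_step x Xt IH) _.
rewrite [leRHS](_ : _ = G ^+ q * ((n - #|X|)`!%:R * G)); last by rewrite exprS; ring.
rewrite ler_wpM2l ?exprn_ge0 //; apply: le_trans (pstat_fix _ _) _; first lia.
rewrite ler_wpM2l ?ler0n // ler_wpM2r // lerXn2r ?nnegrE ?mulr_ge0 ?ler0n //.
by rewrite ler_wpM2l ?ler0n // ler_nat; lia.
Qed.

(** One factor is averaged exactly and the other [q] are bounded by [G]. The exact total of [u] is
    what later yields the factor [n ^- #|S|] on a slice. *)
Lemma pstat_moment q : (q.+1 * d <= tm)%N ->
  \sum_(x : 'S_n) pstat x ^+ q.+1 <= G ^+ q * ((n - d)`!%:R * \sum_k \sum_J u k J).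
Proof.
move=> qt.
have all : Sym (~: set0) = [set: 'S_n].
  by apply/setP => h; rewrite !inE setC0; apply/subsetP => i; rewrite inE.
have step := @pstat_step q set0 1%g; rewrite cards0 all in step.
have E (F : 'S_n -> R) : \sum_(h in [set: 'S_n]) F (h * 1)%g = \sum_h F h.
  by apply: eq_big => h; rewrite ?inE ?mulg1.
have {}step := step qt (pstat_exp (q := q)).
rewrite (E (fun h => pstat h ^+ q.+1)) (E pstat) in step.
apply: le_trans step _; rewrite ler_wpM2l ?exprn_ge0 //.
rewrite exchange_big mulr_sumr; apply: ler_sum => k _ /=.
rewrite sum_act; last by apply/injectiveP; exact: pt_injective.
rewrite ler_wpM2l ?ler0n // [leRHS](bigID (fun J : {ffun D -> 'I_n} => injectiveb J)) /= lerDl.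
exact: sumr_ge0.
Qed.

End Positive.

(** * From a statistic to its square function *)

Section Decoupling.

Variables (R : realFieldType) (n b : nat) (D : finType).
Variable theta : D -> 'I_b.+1 -> 'I_n.
Hypothesis theta_inj : forall l m j k, theta l j = theta m k -> l = m /\ j = k.

Variables (S : {set D}) (k1 : {ffun D -> 'I_b.+1}).
Variable Z : {ffun D -> 'I_b.+1} -> {ffun D -> 'I_n} -> R.
Hypothesis Z_supp : forall k J, ~~ agreeb S k k1 -> Z k J = 0.
Hypothesis Z_line : forall l k J, l \notin S -> \sum_a Z (upd k l a) J = 0.

Let d := #|D|.

(* The partial square functions, interpolating between [T = set0] (the square of
   the statistic, up to a power of [b + 1]) and [T = setT] (the sum of squares). *)
Let psq (T : {set D}) (x : 'S_n) :=
  \sum_e (\sum_(k | agreeb T k e) Z k (act x (pt theta k))) ^+ 2.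

Let agreebU1 (T : {set D}) l (k e : {ffun D -> 'I_b.+1}) a :
  l \notin T -> agreeb (l |: T) k (upd e l a) = agreeb T k e && (k l == a).
Proof.
move=> lT; apply/agreebP/andP => [H|[/agreebP H /eqP kl] m].
  split; last by rewrite (H l) ?updE ?eqxx // !inE eqxx.
  apply/agreebP => m mT; rewrite H ?inE ?mT ?orbT // updE.
  by case: eqP => // ml; rewrite -ml mT in lT.
by rewrite !inE updE; case: eqP => [-> //|_] /= /H.
Qed.

(** With the images of the other coordinates frozen, the sum is a linear statistic of the block of
    [l], the situation of [khintchine]. The factor [b.+1] appears because [psq] also sums over the
    entries of [e] that are not compared. *)
Let psq_step (T : {set D}) (l : D) q : l \notin T -> (0 < q)%N ->
  \sum_(x : 'S_n) psq T x ^+ q <=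
  (32 * q%:R) ^+ q * b.+1%:R ^+ q * \sum_(x : 'S_n) psq (l |: T) x ^+ q.
Proof.
move=> lT q0.
(* The image at [l] is overwritten by the variable [j], so [w] no longer sees [x] on the block of
   [l]. *)
pose w e a j (x : 'S_n) :=
  \sum_(k | agreeb T k e && (k l == a)) Z k (upd (act x (pt theta k)) l j).
have wE e (a : 'I_b.+1) (x : 'S_n) : w e a (x (theta l a)) x =
    \sum_(k | agreeb T k e && (k l == a)) Z k (act x (pt theta k)).
  apply: eq_bigr => k /andP[_ /eqP kl]; congr (Z k _); apply/ffunP => m.
  by rewrite updE !actE; case: eqP => // ->; rewrite ptE kl.
have YE (x : 'S_n) e : \sum_(k | agreeb T k e) Z k (act x (pt theta k)) =
    \sum_a w e a (x (theta l a)) x.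
  rewrite (partition_big (fun k : {ffun D -> 'I_b.+1} => k l) xpredT) //=.
  by apply: eq_bigr => a _; rewrite wE.
have VE (x : 'S_n) : \sum_e \sum_a w e a (x (theta l a)) x ^+ 2 = b.+1%:R * psq (l |: T) x.
  pose G (e : {ffun D -> 'I_b.+1}) (a : 'I_b.+1) :=
    (\sum_(k | agreeb (l |: T) k e) Z k (act x (pt theta k))) ^+ 2.
  have := sum_upd l G; rewrite /G /psq.
  under [X in _ = X -> _]eq_bigr do rewrite sumr_const card_ord.
  rewrite sumrMnl -[X in _ = X -> _]mulr_natl => <-.
  apply: eq_bigr => e _; apply: eq_bigr => a _; rewrite wE; congr (_ ^+ 2).
  by apply: eq_bigl => k; rewrite agreebU1.
rewrite -mulrA; have -> : b.+1%:R ^+ q * \sum_(x : 'S_n) psq (l |: T) x ^+ q =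
    \sum_(x : 'S_n) (\sum_e \sum_a w e a (x (theta l a)) x ^+ 2) ^+ q.
  by rewrite mulr_sumr; apply: eq_bigr => x _; rewrite VE exprMn.
have -> : \sum_(x : 'S_n) psq T x ^+ q =
    \sum_(x : 'S_n) (\sum_e (\sum_a w e a (x (theta l a)) x) ^+ 2) ^+ q.
  by apply: eq_bigr => x _; congr (_ ^+ q); apply: eq_bigr => e _; rewrite YE.
(* On [S] only the value [k1 l] occurs, so the square of the sum over [a] equals the sum of squares
   without any cancellation. *)
have [lS|lS] := boolP (l \in S).
  have q1 : 1 <= (32 * q%:R) ^+ q :> R.
    by rewrite exprn_ege1 // -natrM ler1n; lia.
  rewrite -[leLHS]mul1r ler_pM ?ler01 //.
    by apply: sumr_ge0 => x _; rewrite exprn_ge0 // sumr_ge0 // => e _; exact: sqr_ge0.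
  rewrite le_eqVlt; apply/orP; left; apply/eqP; apply: eq_bigr => x _.
  congr (_ ^+ q); apply: eq_bigr => e _.
  have w0 a j : a != k1 l -> w e a j x = 0.
    move=> akl; apply: big1 => k /andP[_ /eqP kl]; apply: Z_supp.
    by apply: contra akl => /agreebP /(_ l lS) <-; rewrite kl.
  rewrite (bigD1 (k1 l)) //= big1 ?addr0; last by move=> a; exact: w0.
  by rewrite (bigD1 (k1 l)) //= big1 ?addr0 // => a /w0 ->; rewrite expr0n.
apply: khintchine => //.
- by move=> j k /theta_inj[].
- move=> e a j s x sfix; apply: eq_bigr => k _; congr (Z k _); apply/ffunP => m.
  rewrite !updE !actE permM; case: eqP => // ml; rewrite sfix // => c.
  by apply/eqP; rewrite ptE => /theta_inj[].
move=> e j x.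
have -> : \sum_a w e a j x =
    \sum_(k | agreeb T k e) Z k (upd (act x (pt theta k)) l j).
  by rewrite [RHS](partition_big (fun k : {ffun D -> 'I_b.+1} => k l) xpredT).
rewrite big_mkcond /=; apply: (@sum_line0 _ _ _ l) => k.
have agr a : agreeb T (upd k l a) e = agreeb T k e.
  apply/agreebP/agreebP => H m mT; have := H m mT; rewrite updE;
    by case: eqP => // ml; rewrite -ml mT in lT.
under eq_bigr do rewrite agr.
case: (agreeb T k e); last by rewrite big1.
have Ea a : upd (act x (pt theta (upd k l a))) l j = upd (act x (pt theta k)) l j.
  by rewrite pt_upd act_upd upd_upd.
under eq_bigr do rewrite Ea.
exact: Z_line.
Qed.

(** Run [psq_step] through all coordinates. The powers of [b.+1] cancel, since [psq set0] repeats
    the same square once for every index. *)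
Lemma decoupling q : (0 < q)%N ->
  \sum_(x : 'S_n) (\sum_k Z k (act x (pt theta k))) ^+ (2 * q) <=
  (32 * q%:R) ^+ (q * d) *
  \sum_(x : 'S_n) (\sum_k Z k (act x (pt theta k)) ^+ 2) ^+ q.
Proof.
move=> q0.
have bq : (0 : R) < b.+1%:R ^+ q by rewrite exprn_gt0 ?ltr0n.
have H (s : seq D) (T : {set D}) : uniq s -> {in s, forall l, l \notin T} ->
    \sum_(x : 'S_n) psq T x ^+ q <= ((32 * q%:R) ^+ q * b.+1%:R ^+ q) ^+ size s *
      \sum_(x : 'S_n) psq (T :|: [set l in s]) x ^+ q.
  elim: s T => [|l s IH] T /=.
    by move=> _ _; rewrite expr0 mul1r (_ : [set l in [::]] = set0) ?setU0 //; apply/setP => i; rewrite !inE.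
  move=> /andP[ls us] sT.
  apply: le_trans (psq_step (sT l (mem_head _ _)) q0) _.
  rewrite (exprS _ (size s)) -[leRHS]mulrA ler_wpM2l ?mulr_ge0 ?exprn_ge0 ?mulr_ge0 ?ler0n //.
  apply: le_trans (IH (l |: T) us _) _.
    move=> m ms; rewrite !inE negb_or sT ?inE ?ms ?orbT // andbT.
    by apply: contraNneq ls => <-.
  rewrite (_ : l |: T :|: [set m in s] = T :|: [set m in l :: s]) //.
  by apply/setP => m; rewrite !inE; case: (m == l); case: (m \in T).
have := H (enum D) set0 (enum_uniq _); rewrite -cardE -/d => {}H.
have {}H := H (fun l _ => _); rewrite set0U in H.
have full : [set l in enum D] = [set: D] by apply/setP => l; rewrite !inE mem_enum.
rewrite full in H.
have q0E x : psq set0 x ^+ q = b.+1%:R ^+ (q * d) * (\sum_k Z k (act x (pt theta k))) ^+ (2 * q).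
  rewrite /psq (eq_bigr (fun=> (\sum_k Z k (act x (pt theta k))) ^+ 2)); last first.
    move=> e _; congr (_ ^+ 2); apply: eq_bigl => k; apply/agreebP => l.
    by rewrite inE.
  rewrite sumr_const card_ffun card_ord -[_ *+ _]mulr_natl exprMn -exprM.
  by rewrite natrX -exprM mulnC.
have qTE x : psq setT x ^+ q = (\sum_k Z k (act x (pt theta k)) ^+ 2) ^+ q.
  congr (_ ^+ q); apply: eq_bigr => e _; congr (_ ^+ 2).
  rewrite (big_pred1 e) // => k; apply/agreebP/eqP => [E|-> //].
  by apply/ffunP => l; apply: E; rewrite inE.
have bqd : (0 : R) < b.+1%:R ^+ (q * d) by rewrite exprn_gt0 ?ltr0n.
rewrite -(ler_pM2l bqd).
rewrite mulr_sumr; under eq_bigr do rewrite -q0E.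
apply: le_trans (H _) _ => [l|]; first by rewrite inE.
under eq_bigr do rewrite qTE.
by rewrite exprMn -!exprM [leRHS]mulrCA -[leLHS]mulrA.
Qed.

Variables (M : R) (tm : nat).
Hypothesis n_gt0 : (0 < n)%N.
Hypothesis M0 : 0 <= M.
Hypothesis slices : forall (T : {set D}) k0 J0,
  \sum_(k | agreeb T k k0) \sum_(J | agreeb T J J0) Z k J ^+ 2 <=
  n%:R ^+ (d - #|T|) * M.
Hypothesis tm_le : (2 * (tm + d) <= n)%N.

Lemma statistic_moment q : (q.+1 * d <= tm)%N ->
  \sum_(x : 'S_n) (\sum_k Z k (act x (pt theta k))) ^+ (2 * q.+1) <=
  (32 * q.+1%:R) ^+ (q.+1 * d) * (((2 * (tm + 2)%:R) ^+ d * M) ^+ q *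
    ((n - d)`!%:R * \sum_k \sum_J Z k J ^+ 2)).
Proof.
move=> qt; apply: le_trans (decoupling (ltn0Sn q)) _.
rewrite ler_wpM2l ?exprn_ge0 ?mulr_ge0 ?ler0n //.
apply: (@pstat_moment _ _ _ _ theta theta_inj (fun k J => Z k J ^+ 2)) => //.
by move=> k J; exact: sqr_ge0.
Qed.

End Decoupling.

(** * The level inequality *)

Lemma sum_inj_le (R : numDomainType) (I J : finType) (P : pred I) (Q : pred J)
    (f : I -> J) (F : J -> R) :
  {in P &, injective f} -> (forall i, P i -> Q (f i)) -> (forall j, 0 <= F j) ->
  \sum_(i | P i) F (f i) <= \sum_(j | Q j) F j.
Proof.
move=> fI PQ F0; have -> : \sum_(i | P i) F (f i) = \sum_(j in f @: P) F j.
  by rewrite big_imset.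
rewrite big_mkcond [leRHS]big_mkcond; apply: ler_sum => j _.
by case: imsetP => [[i /PQ Qi ->]|_]; [rewrite Qi | case: ifP].
Qed.

(** The terms of [T] and [l |: T] cancel. *)
Lemma alternating_sum0 (R : pzRingType) (D : finType) l (g : {set D} -> R) :
  (forall T : {set D}, l \notin T -> g (l |: T) = g T) ->
  \sum_(T : {set D}) (-1) ^+ #|T| * g T = 0.
Proof.
move=> gl; rewrite (bigID (fun T : {set D} => l \in T)) /=.
rewrite (reindex_onto (fun T : {set D} => l |: T) (fun T => T :\ l)) /=; last first.
  by move=> T lT; rewrite setD1K.
apply/eqP; rewrite addr_eq0 -sumrN; apply/eqP; apply: eq_big => T.
  rewrite setU11 /= ; apply/eqP/idP => [<-|lT]; first by rewrite !inE eqxx.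
  by rewrite setU1K.
rewrite setU11 /= => /eqP E.
have lT : l \notin T by rewrite -E !inE eqxx.
by rewrite gl // cardsU1 lT exprS mulN1r mulNr.
Qed.

(** * The projection onto zero line sums *)

Section DiffOperator.

Variables (R : realFieldType) (b : nat) (D : finType).
Local Notation idx := {ffun D -> 'I_b.+1}.
Let d := #|D|.

(* The projection onto functions all of whose line sums vanish: the product over
   the coordinates of the operators (identity - average). *)
Definition dop (F : idx -> R) (k : idx) : R :=
  b.+1%:R ^- d * \sum_(k' : idx) \sum_(T : {set D}) (-1) ^+ #|T| * F (mix T k k').

(** After summation over the line and over [k'], the entry at [l] is a free variable whether or not
    [l] lies in [T], so the signs cancel. *)
Lemma dop_line0 F l k : \sum_a dop F (upd k l a) = 0.
Proof.
rewrite -mulr_sumr; apply/eqP; rewrite mulf_eq0; apply/orP; right; apply/eqP.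
under eq_bigr do rewrite exchange_big /=.
rewrite exchange_big /=; under eq_bigr do under eq_bigr do rewrite -mulr_sumr.
under eq_bigr do rewrite -mulr_sumr.
apply: (@alternating_sum0 _ _ l) => T lT.
have E1 a k' : mix (l |: T) (upd k l a) k' = mix (l |: T) k k'.
  by apply/ffunP => m; rewrite !mixE updE !inE; case: eqP.
under eq_bigr do under eq_bigr do rewrite E1.
rewrite exchange_big /=.
rewrite -(sum_upd l (fun k' (_ : 'I_b.+1) => F (mix (l |: T) k k'))) exchange_big.
apply: eq_bigr => a _; apply: eq_bigr => k' _; congr F; apply/ffunP => m.
rewrite !mixE !updE !inE; case: eqP => // ->; by rewrite (negbTE lT).
Qed.

(** Exchanging [k] and [k'] on [T] turns the pair of [k] and [mix T k k'] into the same pair in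
    reverse order. *)
Lemma dop_adj F G : \sum_k G k * dop F k = \sum_k dop G k * F k.
Proof.
under eq_bigr do rewrite mulrCA.
under [RHS]eq_bigr do rewrite -mulrA.
rewrite -!mulr_sumr; congr (_ * _).
under eq_bigr do rewrite exchange_big mulr_sumr /=.
under [RHS]eq_bigr do rewrite exchange_big mulr_suml /=.
rewrite exchange_big [RHS]exchange_big /=; apply: eq_bigr => T _.
under eq_bigr do rewrite -mulr_sumr mulrCA mulr_sumr.
under [RHS]eq_bigr do rewrite -mulr_sumr -mulrA mulr_suml.
rewrite -!mulr_sumr; congr (_ * _).
rewrite -(sum_mix T); apply: eq_bigr => k _; apply: eq_bigr => k' _.
congr (_ * F _); apply/ffunP => m; rewrite !mixE; by case: (m \in T).
Qed.

(* [F - dop F] is a sum of functions that ignore some coordinate, and those are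
   killed by alternating sums over cubes. *)
Lemma dop_cube F k0 k1 :
  \sum_(T : {set D}) (-1) ^+ #|T| * dop F (mix T k0 k1) =
  \sum_(T : {set D}) (-1) ^+ #|T| * F (mix T k0 k1).
Proof.
have bd : (b.+1%:R : R) ^+ d != 0 by rewrite expf_neq0 // pnatr_eq0.
under eq_bigr do rewrite mulrCA mulr_sumr.
rewrite -mulr_sumr exchange_big /=.
have E k' : \sum_(T : {set D}) (-1) ^+ #|T| * (\sum_(T' : {set D})
      (-1) ^+ #|T'| * F (mix T' (mix T k0 k1) k')) =
    \sum_(T : {set D}) (-1) ^+ #|T| * F (mix T k0 k1).
  under eq_bigr do rewrite mulr_sumr.
  rewrite exchange_big (bigD1 set0) //= [X in _ + X]big1 ?addr0.
    by apply: eq_bigr => T _; rewrite mix_set0 cards0 expr0 mul1r.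
  move=> T' /set0Pn[l lT'].
  under eq_bigr do rewrite mulrCA.
  rewrite -mulr_sumr; apply/eqP; rewrite mulf_eq0; apply/orP; right; apply/eqP.
  apply: (@alternating_sum0 _ _ l) => T lT; congr F; apply/ffunP => m.
  rewrite !mixE !inE; case: eqP => [->|//]; by rewrite lT'.
under eq_bigr do rewrite E.
by rewrite sumr_const card_ffun card_ord -[X in _ * X = _]mulr_natl natrX mulrA mulVf ?mul1r.
Qed.

End DiffOperator.

(** * The Hilbert-Schmidt bound for the projected transition matrix *)

Section Level.

Variables (R : rcfType) (n b : nat) (D : finType).
Local Notation idx := {ffun D -> 'I_b.+1}.
Local Notation tup := {ffun D -> 'I_n}.
Let d := #|D|.

Variable A : {set 'S_n}.
Hypothesis A0 : (0 < #|A|)%N.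

Definition avgA (F : 'S_n -> R) := (\sum_(a in A) F a) / #|A|%:R.

Definition trans (I J : tup) : R := avgA (fun a => (act a I == J)%:R).

Lemma sum_trans (I : tup) (F : tup -> R) :
  \sum_J trans I J * F J = avgA (fun a => F (act a I)).
Proof.
rewrite /trans /avgA; under eq_bigr do rewrite mulrAC mulr_suml.
rewrite -mulr_suml exchange_big /=; congr (_ / _); apply: eq_bigr => a _.
rewrite (bigD1 (act a I)) //= eqxx mul1r big1 ?addr0 // => J.
by rewrite eq_sym => /negbTE ->; rewrite mul0r.
Qed.

Lemma sum_avgA (I : finType) (P : pred I) (F : I -> 'S_n -> R) :
  \sum_(i | P i) avgA (F i) = avgA (fun a => \sum_(i | P i) F i a).
Proof. by rewrite -mulr_suml exchange_big. Qed.

Lemma ler_avgA (F G : 'S_n -> R) : (forall a, a \in A -> F a <= G a) ->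
  avgA F <= avgA G.
Proof. by move=> FG; rewrite ler_wpM2r ?invr_ge0 ?ler0n // ler_sum. Qed.

Lemma avgA_norm (F : 'S_n -> R) : `|avgA F| <= avgA (fun a => `|F a|).
Proof.
rewrite normrM [X in _ * X]ger0_norm ?invr_ge0 ?ler0n //.
by rewrite ler_wpM2r ?invr_ge0 ?ler0n // ler_norm_sum.
Qed.

Variable theta : D -> 'I_b.+1 -> 'I_n.
Hypothesis theta_inj : forall l m j k, theta l j = theta m k -> l = m /\ j = k.

Variable Kg : R.
Hypothesis Kg1 : 1 <= Kg.
Hypothesis glob : forall (S : {set D}) k (J : tup),
  avgA (fun a => (agreeb S (act a (pt theta k)) J)%:R) <= Kg / n%:R ^+ #|S|.

Variable q : nat.
Hypothesis q0 : (0 < q)%N.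
Hypothesis A_dense : n`!%:R <= 9 ^+ q * #|A|%:R :> R.
Hypothesis n_large : (2 * (q * d + d) <= n)%N.
Hypothesis n_gt0 : (0 < n)%N.

Definition coef (k : idx) (J : tup) : R := dop (fun k => trans (pt theta k) J) k.

(** A uniform transition has probability about [n ^- d], so [X] is on the scale of relative
    densities. *)
Let X k J := n%:R ^+ d * coef k J.

(** Per coordinate: [32 * q] from [decoupling], [2 * (q * d + 2)] from [pstat_moment] with
    [tm = q * d], and 2 for comparing [(n - d)!] with [n! / n ^ d]. *)
Let lam : R := (128 * (q * (q * d + 2))%N%:R) ^+ d.

Let slice (S : {set D}) k0 J0 :=
  \sum_(k | agreeb S k k0) \sum_(J | agreeb S J J0) X k J ^+ 2.

Let np : (0 : R) < n%:R. Proof. by rewrite ltr0n. Qed.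

Let lam_ge0 : 0 <= lam.
Proof. by rewrite exprn_ge0 // mulr_ge0 ?ler0n. Qed.

Section OneSlice.

Variable M : R.
Hypothesis M0 : 0 < M.
Hypothesis sliceM : forall S k0 J0, slice S k0 J0 <= n%:R ^+ (d - #|S|) * M.

Variables (S : {set D}) (k0 : idx) (J0 : tup).

Let Y k J := (agreeb S k k0 && agreeb S J J0)%:R * X k J.

Let Y_line l k J : l \notin S -> \sum_a Y (upd k l a) J = 0.
Proof.
move=> lS; have agr a : agreeb S (upd k l a) k0 = agreeb S k k0.
  apply/agreebP/agreebP => H m mS; have := H m mS; rewrite updE;
    by case: eqP => // ml; rewrite -ml mS in lS.
rewrite /Y; under eq_bigr do rewrite agr.
by rewrite -mulr_sumr /X -mulr_sumr dop_line0 !mulr0.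
Qed.

Variable k1 : idx.

(** The slice at [k0] transplanted to [k1]: on [S] the weights are read at [k0], while the
    permutation moves the points of [k1]. Such shifted slices arise when [dop] is expanded by
    adjointness. *)
Let Z k J := (agreeb S k k1)%:R * Y (mix S k k0) J.

Let Z_sq k J : Z k J ^+ 2 = if agreeb S k k1 then Y (mix S k k0) J ^+ 2 else 0.
Proof. by rewrite /Z; case: agreeb; rewrite ?mul1r // mul0r expr0n. Qed.

Let Y_le k J : Y k J ^+ 2 <= X k J ^+ 2.
Proof. by rewrite /Y; case: (_ && _); rewrite ?mul1r // mul0r expr0n sqr_ge0. Qed.

Let mix_injS : {in [pred k | agreeb S k k1] &, injective (mix S ^~ k0)}.
Proof.
move=> j k; rewrite !inE => /agreebP jE /agreebP kE /ffunP E; apply/ffunP => m.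
have := E m; rewrite !mixE; case: ifP => // mS _; by rewrite jE // kE.
Qed.

Let Z_slices (T : {set D}) k' J' :
  \sum_(k | agreeb T k k') \sum_(J | agreeb T J J') Z k J ^+ 2 <=
  n%:R ^+ (d - #|T|) * M.
Proof.
apply: le_trans (sliceM T (mix S k' k0) J').
have -> : \sum_(k | agreeb T k k') \sum_(J | agreeb T J J') Z k J ^+ 2 =
    \sum_(k | agreeb T k k' && agreeb S k k1)
       \sum_(J | agreeb T J J') Y (mix S k k0) J ^+ 2.
  rewrite [RHS]big_mkcondr; apply: eq_bigr => k _.
  under eq_bigr do rewrite Z_sq.
  by case: agreeb => //; rewrite big1.
apply: (@le_trans _ _ (\sum_(k | agreeb T k (mix S k' k0))
    \sum_(J | agreeb T J J') Y k J ^+ 2)); last first.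
  by apply: ler_sum => k _; apply: ler_sum => J _; exact: Y_le.
apply: (@sum_inj_le _ _ _ _ _ (mix S ^~ k0)
   (fun k => \sum_(J | agreeb T J J') Y k J ^+ 2)).
- by move=> j k /andP[_ jP] /andP[_ kP]; exact: mix_injS jP kP.
- move=> k /andP[/agreebP kT _]; apply/agreebP => m mT; rewrite !mixE.
  by case: ifP => // _; rewrite kT.
- by move=> k; apply: sumr_ge0 => J _; exact: sqr_ge0.
Qed.

Let Z_total : \sum_k \sum_J Z k J ^+ 2 <= n%:R ^+ (d - #|S|) * M.
Proof.
apply: le_trans (sliceM S k0 J0).
have -> : \sum_k \sum_J Z k J ^+ 2 =
    \sum_(k | agreeb S k k1) \sum_(J | agreeb S J J0) Y (mix S k k0) J ^+ 2.
  rewrite [RHS]big_mkcond; apply: eq_bigr => k _.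
  under eq_bigr do rewrite Z_sq.
  case: agreeb; last by rewrite big1.
  rewrite [RHS]big_mkcond; apply: eq_bigr => J _.
  by rewrite /Y; case: (agreeb S J J0); rewrite // andbF mul0r expr0n.
apply: (@le_trans _ _ (\sum_(k | agreeb S k k0)
    \sum_(J | agreeb S J J0) Y k J ^+ 2)); last first.
  by apply: ler_sum => k _; apply: ler_sum => J _; exact: Y_le.
apply: (@sum_inj_le _ _ _ _ _ (mix S ^~ k0)
   (fun k => \sum_(J | agreeb S J J0) Y k J ^+ 2)).
- exact: mix_injS.
- by move=> k _; apply/agreebP => m mS; rewrite !mixE mS.
- by move=> k; apply: sumr_ge0 => J _; exact: sqr_ge0.
Qed.

Let stat x := \sum_k Z k (act x (pt theta k)).

(** As [tau ^+ 2] is [9 * (lam * M)], the moment divided by [tau ^+ (2 * q)] gains [9 ^- q], which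
    pays for the density of [A]. *)
Let tau := 3 * Num.sqrt (lam * M).

Let tau_sq : tau ^+ 2 = 9 * (lam * M).
Proof. by rewrite exprMn sqr_sqrtr ?mulr_ge0 ?(ltW M0) // -natrX. Qed.

Let stat_moment : \sum_(x : 'S_n) stat x ^+ (2 * q) <=
  n`!%:R / n%:R ^+ #|S| * (lam * M) ^+ q.
Proof.
have [q' qE] : exists q', q = q'.+1 by case: (q) q0 => // q' _; exists q'.
have Zs k J : ~~ agreeb S k k1 -> Z k J = 0.
  by rewrite /Z => /negbTE ->; rewrite mul0r.
have Zl l k J : l \notin S -> \sum_a Z (upd k l a) J = 0.
  move=> lS; have agr a : agreeb S (upd k l a) k1 = agreeb S k k1.
    apply/agreebP/agreebP => H m mS; have := H m mS; rewrite updE;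
      by case: eqP => // ml; rewrite -ml mS in lS.
  have mx a : mix S (upd k l a) k0 = upd (mix S k k0) l a.
    apply/ffunP => m; rewrite !mixE !updE mixE; case: eqP => // ->.
    by rewrite (negbTE lS).
  rewrite /Z; under eq_bigr do rewrite agr mx.
  by rewrite -mulr_sumr Y_line // mulr0.
have qt : (q'.+1 * #|D| <= q * d)%N by rewrite -qE.
have := statistic_moment theta_inj Zs Zl n_gt0 (ltW M0) Z_slices n_large qt.
rewrite -qE => /le_trans; apply.
have dn : (n - d)`!%:R <= (2 / n%:R) ^+ d * n`!%:R :> R.
  by apply: fact_drop_le => //; lia.
have G0 : 0 <= (2 * (q * d + 2)%:R) ^+ d * M :> R.
  by rewrite mulr_ge0 ?(ltW M0) // exprn_ge0 // mulr_ge0 ?ler0n.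
have sd : (#|S| <= d)%N by exact: max_card.
apply: (@le_trans _ _ ((32 * q%:R) ^+ (q * d) * (((2 * (q * d + 2)%:R) ^+ d * M) ^+ q' *
    ((2 / n%:R) ^+ d * n`!%:R * (n%:R ^+ (d - #|S|) * M))))).
  rewrite ler_wpM2l ?exprn_ge0 ?mulr_ge0 ?ler0n //.
  rewrite ler_wpM2l ?exprn_ge0 //.
  rewrite ler_pM ?ler0n //.
  by apply: sumr_ge0 => k _; apply: sumr_ge0 => J _; exact: sqr_ge0.
have nd : n%:R ^+ (d - #|S|) = n%:R ^+ d / n%:R ^+ #|S| :> R.
  by rewrite -{2}(subnK sd) exprD mulfK // expf_neq0 // lt0r_neq0.
have dq : 2 ^+ d <= (2 ^+ d) ^+ q :> R.
  by rewrite -[leLHS]expr1 ler_weXn2l // exprn_ege1 // ler1n.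
have E : (32 * q%:R) ^+ (q * d) * (((2 * (q * d + 2)%:R) ^+ d * M) ^+ q' *
    ((2 / n%:R) ^+ d * n`!%:R * (n%:R ^+ (d - #|S|) * M))) =
    2 ^+ d * (n`!%:R / n%:R ^+ #|S| *
     ((32 * q%:R) ^+ d * ((2 * (q * d + 2)%:R) ^+ d * M)) ^+ q' *
      ((32 * q%:R) ^+ d * M)) :> R.
  have -> : (32 * q%:R) ^+ (q * d) = ((32 * q%:R) ^+ d) ^+ q' * (32 * q%:R) ^+ d :> R.
    by rewrite mulnC exprM -exprSr -qE.
  rewrite nd expr_div_n [((32 * q%:R) ^+ d * (_ * M)) ^+ q']exprMn.
  move: ((32 * q%:R) ^+ d) (((2 * (q * d + 2)%:R) ^+ d * M) ^+ q') => a c.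
  field; by rewrite !expf_neq0 // lt0r_neq0.
rewrite E.
have lamE : lam * M = 2 ^+ d * ((32 * q%:R) ^+ d * ((2 * (q * d + 2)%:R) ^+ d * M)).
  rewrite /lam !mulrA -!exprMn natrM; congr (_ ^+ _ * _); ring.
rewrite lamE [leRHS](_ : _ = (2 ^+ d) ^+ q * (n`!%:R / n%:R ^+ #|S| *
   ((32 * q%:R) ^+ d * ((2 * (q * d + 2)%:R) ^+ d * M)) ^+ q)); last by rewrite [in LHS]exprMn mulrCA.
have p0 : 0 <= (32 * q%:R) ^+ d :> R by rewrite exprn_ge0 // mulr_ge0 ?ler0n.
have pM : 0 <= (32 * q%:R) ^+ d * M by rewrite mulr_ge0 // ltW.
have pP : 0 <= (32 * q%:R) ^+ d * ((2 * (q * d + 2)%:R) ^+ d * M) by rewrite mulr_ge0.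
have pa : 0 <= n`!%:R / n%:R ^+ #|S| :> R by rewrite divr_ge0 ?exprn_ge0 ?ler0n.
have pQ : 0 <= n`!%:R / n%:R ^+ #|S| *
    ((32 * q%:R) ^+ d * ((2 * (q * d + 2)%:R) ^+ d * M)) ^+ q'.
  by rewrite mulr_ge0 // exprn_ge0.
apply: ler_pM; [by rewrite exprn_ge0|by rewrite mulr_ge0|exact: dq|].
have qx (z : R) : z ^+ q = z ^+ q' * z by rewrite qE exprSr.
rewrite qx [leRHS]mulrA ler_wpM2l //.
rewrite ler_wpM2l // -[leLHS]mul1r ler_wpM2r ?(ltW M0) //.
by rewrite exprn_ege1 // -natrM ler1n muln_gt0 addn2.
Qed.

(* Off the event of the first average [stat] vanishes, and on it [stat] is at most [tau]
   plus its [2 q]-th power over [tau ^+ (2 * q - 1)]; the density of [A] turns the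
   average of the power over [A] into the uniform moment. *)
Lemma stat_avg : `|avgA stat| <= tau *
   (avgA (fun a => (agreeb S (act a (pt theta k1)) J0)%:R) + (n%:R ^+ #|S|)^-1).
Proof.
have tau0 : 0 <= tau by rewrite mulr_ge0 // sqrtr_ge0.
have Ap : (0 : R) < #|A|%:R by rewrite ltr0n.
have lam_gt0 : 0 < lam by rewrite exprn_gt0 // mulr_gt0 // ltr0n muln_gt0 q0 addn2.
have tau_gt0 : 0 < tau by rewrite mulr_gt0 // sqrtr_gt0 mulr_gt0.
pose ind a : R := (agreeb S (act a (pt theta k1)) J0)%:R.
have young a : `|stat a| <= tau * ind a + tau / tau ^+ (2 * q) * stat a ^+ (2 * q).
  have [y0|y0] := eqVneq (stat a) 0.
    by rewrite y0 normr0 expr0n muln_eq0 /= -leqn0 leqNgt q0 /= mulr0 addr0 mulr_ge0 ?ler0n.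
  have -> : ind a = 1.
    rewrite /ind; case: agreebP => // na; case/eqP: y0; apply: big1 => k _.
    rewrite /Z; case: agreebP => kk; rewrite ?mul0r // mul1r /Y.
    rewrite [agreeb S (act _ _) _](_ : _ = false) ?andbF ?mul0r //.
    by apply/agreebP => H; apply: na => m mS; rewrite -(H m mS) !actE !ptE kk.
  have ev : stat a ^+ (2 * q) = `|stat a| ^+ (2 * q).
    by rewrite -normrX ger0_norm // exprM exprn_ge0 ?sqr_ge0.
  rewrite ev mulr1; case: (leP `|stat a| tau) => h.
    by rewrite -[leLHS]addr0 lerD // mulr_ge0 ?divr_ge0 ?exprn_ge0.
  apply: (@le_trans _ _ (tau / tau ^+ (2 * q) * `|stat a| ^+ (2 * q))); last by rewrite lerDr.
  have [r rE] : exists r, (2 * q)%N = r.+1 by exists (2 * q).-1; rewrite prednK // muln_gt0.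
  rewrite rE [X in tau / X]exprS invfM mulrA mulfV ?lt0r_neq0 // mul1r.
  rewrite mulrC ler_pdivlMr ?exprn_gt0 // exprS ler_wpM2l //.
  by rewrite lerXn2r ?nnegrE // ltW.
apply: le_trans (avgA_norm _) _; apply: le_trans (ler_avgA (fun a _ => young a)) _.
have -> : avgA (fun a => tau * ind a + tau / tau ^+ (2 * q) * stat a ^+ (2 * q)) =
    tau * (avgA ind + (tau ^+ (2 * q))^-1 * avgA (fun a => stat a ^+ (2 * q))).
  rewrite /avgA big_split /= -!mulr_sumr; ring.
rewrite ler_wpM2l // lerD2l exprM tau_sq.
have lM : 0 < (9 * (lam * M)) ^+ q by rewrite exprn_gt0 // !mulr_gt0.
rewrite mulrC ler_pdivrMr // ler_pdivrMr //.
apply: (@le_trans _ _ (\sum_(x : 'S_n) stat x ^+ (2 * q))).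
  rewrite [leRHS](bigID (fun a => a \in A)) /= lerDl.
  by apply: sumr_ge0 => a _; rewrite exprM exprn_ge0 // sqr_ge0.
apply: le_trans stat_moment _.
have -> : (n%:R ^+ #|S|)^-1 * (9 * (lam * M)) ^+ q * #|A|%:R =
    (9 ^+ q * #|A|%:R) / n%:R ^+ #|S| * (lam * M) ^+ q.
  by rewrite (exprMn q 9); ring.
by rewrite !ler_wpM2r ?invr_ge0 ?exprn_ge0 ?ler0n // mulr_ge0 ?(ltW M0).
Qed.

End OneSlice.

(** The empty slice imposes no condition, so its average is bounded by [1]; this keeps the final
    bound linear in [Kg]. *)
Let Kof (S : {set D}) : R := if S == set0 then 1 else Kg.

(** Write the slice as the pairing of [Y] with [X] and expand [dop] as an alternating sum over [T].
    Each [T] inside [S] gives the average over [A] of a statistic built from the transplanted slice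
    at [mix T k0 k'], which [stat_avg] bounds; there are at most [2 ^ d] of them. *)
Let slice_step M : 0 < M ->
  (forall S k0 J0, slice S k0 J0 <= n%:R ^+ (d - #|S|) * M) ->
  forall S k0 J0, slice S k0 J0 <=
     n%:R ^+ (d - #|S|) * (2 ^+ d * (3 * Num.sqrt (lam * M)) * (Kof S + 1)).
Proof.
move=> M0 sliceM S k0 J0; set tau := 3 * _.
have tau0 : 0 <= tau by rewrite mulr_ge0 // sqrtr_ge0.
pose Y k J := (agreeb S k k0 && agreeb S J J0)%:R * X k J.
pose Z k1 k J := (agreeb S k k1)%:R * Y (mix S k k0) J.
pose st k1 x := \sum_k Z k1 k (act x (pt theta k)).
have bound k1 : `|avgA (st k1)| <= tau * ((Kof S + 1) / n%:R ^+ #|S|).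
  apply: le_trans (stat_avg M0 sliceM _ _ _ k1) _.
  rewrite ler_wpM2l // mulrDl mul1r lerD2r /Kof; case: eqP => [->|_]; last exact: glob.
  rewrite cards0 expr0 divr1 /avgA ler_pdivrMr ?ltr0n // mul1r.
  rewrite -sum1_card natr_sum; apply: ler_sum => a _; rewrite ler_nat leq_b1 //.
have sliceE : slice S k0 J0 = n%:R ^+ d * (b.+1%:R ^- d *
    \sum_k' \sum_(T : {set D} | T \subset S) (-1) ^+ #|T| * avgA (st (mix T k0 k'))).
  have -> : slice S k0 J0 = \sum_J \sum_k Y k J * X k J.
    rewrite exchange_big /slice big_mkcond; apply: eq_bigr => k _ /=.
    case: agreebP => kk0; last first.
      rewrite big1 // => J _; rewrite /Y [agreeb S k k0](_ : _ = false) ?mul0r //.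
      exact/agreebP.
    rewrite big_mkcond; apply: eq_bigr => J _.
    rewrite /Y [agreeb S k k0](_ : _ = true); last exact/agreebP.
    by case: agreeb; rewrite ?mul1r ?mul0r // expr2.
  under eq_bigr do under eq_bigr do rewrite /X mulrCA.
  under eq_bigr do rewrite -mulr_sumr dop_adj.
  rewrite -mulr_sumr; congr (_ * _).
  under eq_bigr do under eq_bigr do rewrite /dop -mulrA.
  under eq_bigr do rewrite -mulr_sumr.
  rewrite -mulr_sumr; congr (_ * _).
  under eq_bigr do under eq_bigr do rewrite mulr_suml.
  under eq_bigr do under eq_bigr do under eq_bigr do rewrite mulr_suml.
  under eq_bigr do under eq_bigr do rewrite exchange_big /=.
  under eq_bigr do rewrite exchange_big /=.
  rewrite exchange_big [RHS]exchange_big /= [RHS]big_mkcond; apply: eq_bigr => T _.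
  (* If [T] has a coordinate outside [S], its term vanishes, because [Y] has zero line sums
     there. *)
  case: ifP => TS; last first.
    have [l lT lS] : exists2 l, l \in T & l \notin S.
      by move/subsetPn: TS => [l]; exists l.
    apply: big1 => J _; apply: big1 => k _.
    rewrite -mulr_suml -mulr_sumr (@sum_line0 _ _ _ l) ?mulr0 ?mul0r // => k'.
    have E a : mix T k (upd k' l a) = upd (mix T k k') l a.
      by apply/ffunP => m; rewrite !mixE !updE mixE; case: eqP => // ->; rewrite lT.
    under eq_bigr do rewrite E.
    have agr a : agreeb S (upd (mix T k k') l a) k0 = agreeb S (mix T k k') k0.
      apply/agreebP/agreebP => H m mS; have := H m mS; rewrite updE;
        by case: eqP => // ml; rewrite -ml mS in lS.
    rewrite /Y; under eq_bigr do rewrite agr.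
    by rewrite -mulr_sumr /X -mulr_sumr dop_line0 !mulr0.
  transitivity ((-1) ^+ #|T| * \sum_J \sum_k \sum_k' Y k J * trans (pt theta (mix T k k')) J).
    rewrite mulr_sumr; apply: eq_bigr => J _.
    rewrite -[in RHS](sum_mix T) mulr_sumr; apply: eq_bigr => k _.
    rewrite mulr_sumr; apply: eq_bigr => k' _; rewrite -mulrA.
    congr (_ * (Y _ J * trans (pt theta _) J)).
    by apply/ffunP => m; rewrite !mixE; case: (m \in T).
  rewrite -[RHS]mulr_sumr; congr (_ * _); rewrite exchange_big /=.
  under eq_bigr do rewrite exchange_big /=.
  rewrite [LHS]exchange_big /=; apply: eq_bigr => k' _.
  under eq_bigr do under eq_bigr do rewrite mulrC.
  under eq_bigr do rewrite sum_trans.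
  rewrite sum_avgA; congr (_ / _); apply: eq_bigr => a _.
  set k1 := mix T k0 k'.
  have -> : st k1 a = \sum_(k | agreeb S k k1) Y (mix S k k0) (act a (pt theta k)).
    rewrite /st [RHS]big_mkcond; apply: eq_bigr => k _; rewrite /Z.
    by case: agreeb; rewrite ?mul1r ?mul0r.
  rewrite [RHS](reindex_onto (mix S ^~ k1) (mix S ^~ k0)); last first.
    move=> k /agreebP kk1; apply/ffunP => m; rewrite !mixE.
    by case E : (m \in S) => //; rewrite (kk1 m E) mixE.
  rewrite (bigID (fun k => agreeb S k k0)) /= [X in _ + X]big1 ?addr0; last first.
    by move=> k /negbTE nk; rewrite /Y nk mul0r.
  have idS k : agreeb S k k0 -> mix S (mix S k k1) k0 = k.
    move=> /agreebP kk; apply/ffunP => m; rewrite !mixE.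
    by case E : (m \in S) => //; rewrite kk.
  apply: eq_big => k.
    apply/idP/andP => [H|[_ /eqP <-]]; last by apply/agreebP => m mS; rewrite mixE mS.
    by split; [apply/agreebP => m mS; rewrite mixE mS | rewrite idS].
  move=> kk; rewrite (idS _ kk); congr (Y k (act a (pt theta _))).
  apply/ffunP => m; rewrite !mixE; case mT : (m \in T); first by rewrite (subsetP TS).
  by case mS : (m \in S) => //; rewrite (agreebP _ _ _ kk).
set B := tau * _ in bound.
apply: (@le_trans _ _ (n%:R ^+ d * (b.+1%:R ^- d * \sum_(k' : idx) \sum_(T : {set D}) B))).
  rewrite sliceE ler_wpM2l ?exprn_ge0 // ?ler0n // ler_wpM2l ?invr_ge0 ?exprn_ge0 ?ler0n //.
  apply: ler_sum => k' _; rewrite big_mkcond; apply: ler_sum => T _.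
  apply: le_trans (bound (mix T k0 k')).
  case: ifP => _; last exact: normr_ge0.
  by apply: le_trans (ler_norm _) _; rewrite normrM normrX normrN1 expr1n mul1r.
have bd : (b.+1%:R : R) ^+ d != 0 by rewrite expf_neq0 // pnatr_eq0.
have cT : #|{set D}| = (2 ^ d)%N by rewrite -cardsT -powersetT card_powerset cardsT.
rewrite !sumr_const card_ffun card_ord cT -[B *+ _]mulr_natl -[_ *+ _ ^ _]mulr_natl.
rewrite !natrX [b.+1%:R ^- d * _]mulKf // /B.
have sd : (#|S| <= d)%N by exact: max_card.
have -> : n%:R ^+ (d - #|S|) = n%:R ^+ d / n%:R ^+ #|S| :> R.
  by rewrite -{2}(subnK sd) exprD mulfK // expf_neq0 // lt0r_neq0.
by rewrite le_eqVlt; apply/orP; left; apply/eqP; ring.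
Qed.

(* The normalised slice norms [sl] attain a maximum [M], and [slice_step] bounds
   it by a multiple of [Num.sqrt M]; solve for [M], then apply the step once more
   with the empty slice, where globalness enters with constant [1]. *)
Lemma level_inequality :
  \sum_k \sum_J coef k J ^+ 2 <=
  18 * 4 ^+ d * (128 * (q * (q * d + 2))%N%:R) ^+ d * (Kg + 1) / n%:R ^+ d.
Proof.
have Kg_ge0 : 0 <= Kg by apply: le_trans Kg1.
pose i0 : 'I_n := Ordinal n_gt0.
pose p0 : {set D} * idx * tup := (set0, [ffun=> ord0], [ffun=> i0]).
pose sl (p : {set D} * idx * tup) : R :=
  slice p.1.1 p.1.2 p.2 / n%:R ^+ (d - #|p.1.1|).
have npd m : (0 : R) < n%:R ^+ m by rewrite exprn_gt0.
pose pm := [arg max_(p > p0) sl p]%O.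
have pmP p : sl p <= sl pm.
  by rewrite /pm; case: Order.TotalTheory.arg_maxP => // i _ H; exact: H.
have slM S k0 J0 : slice S k0 J0 <= n%:R ^+ (d - #|S|) * sl pm.
  by rewrite mulrC -ler_pdivrMr //; exact: (pmP (S, k0, J0)).
have tot : \sum_k \sum_J coef k J ^+ 2 = slice set0 p0.1.2 p0.2 / n%:R ^+ d / n%:R ^+ d.
  rewrite /slice; apply: (canRL (mulfK _)); first by rewrite lt0r_neq0.
  apply: (canRL (mulfK _)); first by rewrite lt0r_neq0.
  rewrite -mulrA mulr_suml; apply: eq_big => k.
    by apply/esym/agreebP => m; rewrite inE.
  rewrite mulr_suml => _; apply: eq_big => J.
    by apply/esym/agreebP => m; rewrite inE.
  by move=> _; rewrite /X; ring.
rewrite tot ler_wpM2r ?invr_ge0 ?exprn_ge0 ?ler0n // -/lam ler_pdivrMr //.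
have [M0|M0] := lerP (sl pm) 0.
  apply: (@le_trans _ _ 0).
    apply: le_trans (slM _ _ _) _; rewrite cards0 subn0.
    by rewrite mulr_ge0_le0 // ltW.
  by rewrite mulr_ge0 ?(ltW (npd _)) // mulr_ge0 ?addr_ge0 // mulr_ge0 // mulr_ge0 ?exprn_ge0.
have step := slice_step M0 slM.
have Kof_le S : Kof S <= Kg by rewrite /Kof; case: ifP.
set s := Num.sqrt (lam * sl pm) in step.
have s_ge0 : 0 <= s by exact: sqrtr_ge0.
have s2 : s ^+ 2 = lam * sl pm by rewrite sqr_sqrtr // mulr_ge0 // ltW.
have lam_gt0 : 0 < lam by rewrite exprn_gt0 // mulr_gt0 // ltr0n muln_gt0 q0 addn2.
have s_gt0 : 0 < s by rewrite sqrtr_gt0 mulr_gt0.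
have H1 : sl pm <= 2 ^+ d * (3 * s) * (Kg + 1).
  rewrite {1}/sl ler_pdivrMr // mulrC; apply: le_trans (step _ _ _) _.
  rewrite ler_wpM2l ?(ltW (npd _)) // ler_wpM2l ?lerD2r //.
  by rewrite mulr_ge0 ?exprn_ge0 // mulr_ge0.
have H2 : s <= lam * (2 ^+ d * 3 * (Kg + 1)).
  rewrite -(ler_pM2l s_gt0) -expr2 s2 [leRHS]mulrCA.
  rewrite ler_pM2l //; apply: le_trans H1 _.
  by rewrite le_eqVlt; apply/orP; left; apply/eqP; ring.
apply: le_trans (step _ _ _) _; rewrite cards0 subn0 /Kof eqxx mulrC.
rewrite ler_wpM2r ?(ltW (npd _)) //.
apply: (@le_trans _ _ (2 ^+ d * 6 * (lam * (2 ^+ d * 3 * (Kg + 1))))).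
  rewrite (_ : _ * _ * (1 + 1) = 2 ^+ d * 6 * s); last by ring.
  by rewrite ler_wpM2l // mulr_ge0 ?exprn_ge0.
have -> : (4 : R) ^+ d = 2 ^+ d * 2 ^+ d by rewrite -exprMn -natrM.
by rewrite le_eqVlt; apply/orP; left; apply/eqP; ring.
Qed.

End Level.

(** * Averaging over the set on pure functions *)

Section Swap.

Variables (R : numDomainType) (D T : finType) (X : {set T}).

(* As line sums vanish, each coordinate in [S] can be moved from outside [X] to
   inside [X] at the cost of a sign. *)
Lemma sum_avoid (S : {set D}) (H : {ffun D -> T} -> R) :
  (forall l I, l \in S -> \sum_k H (upd I l k) = 0) ->
  \sum_(I : {ffun D -> T} | [forall l in S, I l \notin X]) H I =
  (-1) ^+ #|S| * \sum_(I : {ffun D -> T} | [forall l in S, I l \in X]) H I.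
Proof.
have [m] := ubnP #|S|; elim: m S H => // m IH S H; rewrite ltnS => Sm H0.
have [S0|[l lS]] := set_0Vmem S.
  rewrite S0 cards0 expr0 mul1r; apply: eq_bigl => I.
  by apply/'forall_implyP/'forall_implyP => _ i; rewrite inE.
pose S1 := S :\ l.
have cS : #|S| = #|S1|.+1 by rewrite (cardsD1 l S) lS.
have split (P : pred T) (I : {ffun D -> T}) :
    [forall i in S, P (I i)] = P (I l) && [forall i in S1, P (I i)].
  apply/'forall_implyP/andP => [E|[Pl /'forall_implyP E] i iS].
    by split; [exact: E | apply/'forall_implyP => i; rewrite !inE => /andP[_]; exact: E].
  by have [->//|il] := eqVneq i l; apply: E; rewrite !inE il.
have -> : \sum_(I : {ffun D -> T} | [forall i in S, I i \notin X]) H I =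
    \sum_(I : {ffun D -> T} | [forall i in S1, I i \notin X]) (I l \notin X)%:R * H I.
  under eq_bigl => I do rewrite (split (fun t => t \notin X)) andbC.
  rewrite big_mkcondr; apply: eq_bigr => I _.
  by case: (_ \notin _); rewrite ?mul1r ?mul0r.
have line1 i I : i \in S1 -> \sum_k (upd I i k l \notin X)%:R * H (upd I i k) = 0.
  rewrite !inE => /andP[il iS].
  under eq_bigr => k _ do rewrite updE eq_sym (negbTE il).
  by rewrite -mulr_sumr H0 // mulr0.
rewrite (IH S1 (fun I => (I l \notin X)%:R * H I) _ line1); last by rewrite -cS.
rewrite cS exprS mulN1r mulNr -mulrN; congr (_ * _).
under [in RHS]eq_bigl => I do rewrite (split (fun t => t \in X)) andbC.
rewrite big_mkcondr /= -sumrN.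
(* The entry at [l] is unrestricted here, so its parts inside and outside [X] are opposite. *)
have Z : \sum_(I : {ffun D -> T} | [forall i in S1, I i \in X]) H I = 0.
  rewrite big_mkcond /=; apply: (@sum_line0 _ _ _ l) => I.
  have E k : [forall i in S1, upd I l k i \in X] = [forall i in S1, I i \in X].
    apply/'forall_implyP/'forall_implyP => E i iS1; have := E i iS1; rewrite updE;
      by move: iS1; rewrite !inE; case: eqP.
  under eq_bigr do rewrite E.
  by case: [forall i in _, _]; [exact: H0 | rewrite big1].
apply/eqP; rewrite -subr_eq0 -sumrB -[X in _ == X]Z; apply/eqP; apply: eq_bigr => I _.
by case: (I l \in X); rewrite /= ?addr0 ?mul0r ?mul1r ?sub0r ?opprK ?oppr0 ?addr0.
Qed.

End Swap.

(** * From the block bound to the operator norm on pure functions *)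

Section Pure.

Variables (R : rcfType) (n b : nat) (D : finType).
Local Notation idx := {ffun D -> 'I_b.+1}.
Local Notation tup := {ffun D -> 'I_n}.
Let d := #|D|.

Definition pure (phi : tup -> R) :=
  (forall J : tup, ~~ injectiveb J -> phi J = 0) /\
  (forall l (J : tup), \sum_k phi (upd J l k) = 0).

Lemma sum_act_pure (psi : tup -> R) (K : tup) : pure psi -> injectiveb K ->
  \sum_(s : 'S_n) psi (act s K) ^+ 2 = (n - d)`!%:R * \sum_J psi J ^+ 2.
Proof.
move=> [p0 _] KI; rewrite (sum_act (fun J => psi J ^+ 2)) //; congr (_ * _).
by rewrite big_mkcond; apply: eq_bigr => J _; case: ifP => // /negbT /p0 ->; rewrite expr0n.
Qed.

(** Let the point [L l] vary over all [z]: the correlations sum to zero by purity. All [z] outside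
    the at most [2 * d] other points of [K] and [L] give the same value by symmetry, so at least
    [n - 2 * d] copies of it are balanced by at most [2 * d] terms, each bounded by the mass. *)
Lemma pure_correlation (psi : tup -> R) (K L : tup) l : pure psi ->
  injectiveb K -> injectiveb L -> (forall m, L l != K m) ->
  (n%:R - 2 * d%:R) * `|\sum_(s : 'S_n) psi (act s K) * psi (act s L)| <=
  2 * d%:R * ((n - d)`!%:R * \sum_J psi J ^+ 2).
Proof.
move=> psiP KI LI LK; set C := \sum_s _; set B := (n - d)`!%:R * _.
have B0 : 0 <= B by rewrite mulr_ge0 ?ler0n // sumr_ge0 // => J _; exact: sqr_ge0.
pose X := [set K m | m in [set: D]] :|: [set L m | m in [set~ l]].
have cX : (#|X| <= 2 * d)%N.
  rewrite cardsU mul2n -addnn; apply: leq_trans (leq_subr _ _) _.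
  apply: leq_add; apply: leq_trans (leq_imset_card _ _) _; first by rewrite cardsT.
  exact: max_card.
have KX m : K m \in X by rewrite inE imset_f.
have LX m : m != l -> L m \in X.
  by move=> ml; rewrite inE [X in _ || X]imset_f ?orbT // !inE.
have LlX : L l \notin X.
  rewrite inE negb_or; apply/andP; split.
    by apply/imsetP => -[m _ E]; move: (LK m); rewrite E eqxx.
  apply/imsetP => -[m]; rewrite !inE => ml /(injectiveP _ LI) E.
  by rewrite E eqxx in ml.
pose c z := \sum_(s : 'S_n) psi (act s K) * psi (act s (upd L l z)).
have cout z : z \notin X -> c z = C.
  move=> zX; rewrite /C (reindex_inj (mulgI (tperm (L l) z))) /=.
  have tpX i : i \in X -> tperm (L l) z i = i.
    by move=> iX; apply: tpermD; [apply: contraNneq LlX | apply: contraNneq zX] => ->.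
  apply: eq_bigr => s _; congr (psi _ * psi _); apply/ffunP => m.
    by rewrite !actE permM tpX.
  rewrite !actE updE permM; case: eqP => [->|/eqP ml]; first by rewrite tpermL.
  by rewrite tpX // LX.
have cB z : `|c z| <= B.
  apply: le_trans (ler_norm_sum _ _ _) _.
  apply: (@le_trans _ _ (\sum_(s : 'S_n) (2^-1 * psi (act s K) ^+ 2 +
      2^-1 * psi (act s (upd L l z)) ^+ 2))).
    apply: ler_sum => s _; set u := psi _; set v := psi _.
    rewrite normrM -(real_normK (num_real u)) -(real_normK (num_real v)); move: `|u| `|v| => x y.
    have := sqr_ge0 (x - y); rewrite sqrrB; lra.
  rewrite big_split /= -!mulr_sumr sum_act_pure // -/B.
  have : \sum_(s : 'S_n) psi (act s (upd L l z)) ^+ 2 <= B.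
    have [LzI|LzI] := boolP (injectiveb (upd L l z)); first by rewrite sum_act_pure.
    rewrite big1 // => s _.
    by rewrite (proj1 psiP) ?expr0n // injectiveb_act.
  lra.
have c0 : \sum_z c z = 0.
  rewrite exchange_big /= big1 // => s _; rewrite -mulr_sumr.
  under eq_bigr do rewrite act_upd.
  have -> : \sum_z psi (upd (act s L) l (s z)) = \sum_z psi (upd (act s L) l z).
    by rewrite [RHS](reindex_inj (@perm_inj _ s)).
  by rewrite (proj2 psiP) mulr0.
have E : (n - #|X|)%:R * C = - \sum_(z in X) c z.
  move: c0; rewrite (bigID (fun z => z \in X)) /=.
  under [X in _ + X = _]eq_bigr => z zX do rewrite (cout z zX).
  move=> /eqP; rewrite addrC addr_eq0 => /eqP <-.
  rewrite sumr_const -[RHS]mulr_natl; congr (_%:R * _).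
  have <- : #|~: X| = (n - #|X|)%N by rewrite cardsCs setCK card_ord.
  by apply: eq_card => z; rewrite inE unfold_in.
have nX : n%:R - 2 * d%:R <= (n - #|X|)%:R :> R.
  rewrite natrB; last by have := max_card (mem X); rewrite card_ord.
  by rewrite lerD2l lerN2 -natrM ler_nat.
apply: (@le_trans _ _ ((n - #|X|)%:R * `|C|)).
  by rewrite ler_wpM2r.
rewrite -[X in X * `|_|](ger0_norm (ler0n R _)) -normrM E normrN.
apply: le_trans (ler_norm_sum _ _ _) _.
apply: (@le_trans _ _ (\sum_(z in X) B)); first by apply: ler_sum.
by rewrite sumr_const -[leLHS]mulr_natl ler_wpM2r // -natrM ler_nat.
Qed.

Lemma dop_id (F : idx -> R) : (forall l k, \sum_a F (upd k l a) = 0) ->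
  dop F =1 F.
Proof.
move=> F0 k; rewrite /dop exchange_big (bigD1 set0) //= [X in _ + X]big1 ?addr0.
  under eq_bigr do rewrite cards0 expr0 mul1r mix_set0.
  rewrite sumr_const card_ffun card_ord -[X in _ * X = _]mulr_natl natrX mulrA.
  by rewrite mulVf ?mul1r // expf_neq0 // pnatr_eq0.
move=> T /set0Pn[l lT]; rewrite -mulr_sumr (@sum_line0 _ _ _ l) ?mulr0 // => k'.
have E a : mix T k (upd k' l a) = upd (mix T k k') l a.
  by apply/ffunP => m; rewrite !mixE !updE mixE; case: eqP => // ->; rewrite lT.
by under eq_bigr do rewrite E; exact: F0.
Qed.

Lemma card_fix_coord l (c : 'I_b.+1) :
  \sum_(k : idx) (k l == c)%:R = b.+1%:R ^+ d / b.+1%:R :> R.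
Proof.
have b0 : (b.+1%:R : R) != 0 by rewrite pnatr_eq0.
apply: (canRL (mulfK b0)).
have := sum_upd l (fun (k : idx) (_ : 'I_b.+1) => (k l == c)%:R : R).
under [X in _ = X -> _]eq_bigr do rewrite sumr_const card_ord.
rewrite sumrMnl -[X in _ = X -> _]mulr_natr => <-.
under eq_bigr => k _ do under eq_bigr => a _ do rewrite upd_eq.
rewrite (eq_bigr (fun=> 1)); last first.
  by move=> k _; rewrite (bigD1 c) //= eqxx big1 ?addr0 // => a /negbTE ->.
by rewrite sumr_const card_ffun card_ord natrX.
Qed.

Variable theta : D -> 'I_b.+1 -> 'I_n.
Hypothesis theta_inj : forall l m j k, theta l j = theta m k -> l = m /\ j = k.

Hypothesis n_gt2d : (2 * d < n)%N.
Hypothesis n_large :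
  2 ^+ d * (2 * d%:R / (n%:R - 2 * d%:R) + b.+1%:R^-1) <= 2^-1 :> R.

(** In the expansion of [dop] the set [T = set0] gives the full mass. Every other [T] correlates
    [pt k] with [mix T k k']: distinct tuples are nearly uncorrelated, and equality forces
    [k' l = k l], which holds for a fraction [1 / b.+1] of the [k']. [n_large] keeps these errors
    below half of the mass. *)
Lemma pure_block_mass (psi : tup -> R) : pure psi ->
  2^-1 * b.+1%:R ^+ d * ((n - d)`!%:R * \sum_J psi J ^+ 2) <=
  \sum_(s : 'S_n) \sum_k dop (fun k => psi (act s (pt theta k))) k ^+ 2.
Proof.
move=> psiP; set B := _%:R * \sum_J _.
have B0 : 0 <= B by rewrite mulr_ge0 ?ler0n // sumr_ge0 // => J _; exact: sqr_ge0.
have bp : (0 : R) < b.+1%:R by rewrite ltr0n.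
have bd : (0 : R) < b.+1%:R ^+ d by rewrite exprn_gt0.
have np : 0 < n%:R - 2 * d%:R :> R by rewrite subr_gt0 -natrM ltr_nat.
pose eps : R := 2 * d%:R / (n%:R - 2 * d%:R).
have eps0 : 0 <= eps by rewrite divr_ge0 ?mulr_ge0 ?ler0n // ltW.
have sqE s : \sum_k dop (fun k => psi (act s (pt theta k))) k ^+ 2 =
    \sum_k psi (act s (pt theta k)) * dop (fun k => psi (act s (pt theta k))) k.
  under eq_bigr do rewrite expr2.
  rewrite dop_adj; apply: eq_bigr => k _.
  by rewrite (dop_id (dop_line0 _)) mulrC.
pose cor k k' := \sum_(s : 'S_n) psi (act s (pt theta k)) * psi (act s (pt theta k')).
have cor_diag k : cor k k = B.
  rewrite /B /cor -(@sum_act_pure psi (pt theta k)) //.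
  by apply/injectiveP; exact: pt_injective.
have E : \sum_(s : 'S_n) \sum_k dop (fun k => psi (act s (pt theta k))) k ^+ 2 =
    b.+1%:R ^- d * \sum_(k : idx) \sum_(k' : idx) \sum_(T : {set D}) (-1) ^+ #|T| * cor k (mix T k k').
  under eq_bigr do rewrite sqE.
  rewrite exchange_big mulr_sumr /=; apply: eq_bigr => k _.
  under eq_bigr do rewrite mulrCA mulr_sumr.
  rewrite -mulr_sumr; congr (_ * _); rewrite exchange_big; apply: eq_bigr => k' _ /=.
  under eq_bigr do rewrite mulr_sumr.
  rewrite exchange_big; apply: eq_bigr => T _ /=; rewrite mulr_sumr.
  by apply: eq_bigr => s _; rewrite mulrCA.
have off k k' (T : {set D}) l : l \in T ->
    `|cor k (mix T k k')| <= (eps + (k' l == k l)%:R) * B.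
  move=> lT; have [E1|] := eqVneq (mix T k k') k.
    have -> : k' l = k l by rewrite -[in RHS]E1 mixE lT.
    by rewrite E1 cor_diag eqxx ger0_norm // mulrDl mul1r lerDr mulr_ge0.
  move=> ne; have [m mne] : exists m, mix T k k' m != k m.
    apply/existsP; apply: contraR ne; rewrite negb_exists => /forallP H.
    by apply/eqP/ffunP => m; apply/eqP; move: (H m); rewrite negbK.
  have := @pure_correlation psi (pt theta k) (pt theta (mix T k k')) m psiP.
  have inj j : injectiveb (pt theta j) by apply/injectiveP; exact: pt_injective.
  rewrite !inj => /(_ isT isT).
  have dif m' : pt theta (mix T k k') m != pt theta k m'.
    by apply/eqP; rewrite !ptE => /theta_inj[<- e]; rewrite e eqxx in mne.
  move=> /(_ dif); rewrite -/B -/(cor k _) => H.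
  apply: (@le_trans _ _ (eps * B)); last by rewrite mulrDl lerDl mulr_ge0 ?ler0n.
  by rewrite /eps mulrAC ler_pdivlMr // mulrC.
rewrite E; have rowk (k : idx) :
    2^-1 * b.+1%:R ^+ d * B <=
    \sum_(k' : idx) \sum_(T : {set D}) (-1) ^+ #|T| * cor k (mix T k k').
  rewrite exchange_big (bigD1 set0) //=.
  have -> : \sum_(k' : idx) (-1) ^+ #|@set0 D| * cor k (mix set0 k k') = b.+1%:R ^+ d * B.
    under eq_bigr do rewrite cards0 expr0 mul1r mix_set0 cor_diag.
    by rewrite sumr_const card_ffun card_ord -[LHS]mulr_natl natrX.
  have low : - (2 ^+ d * ((eps + b.+1%:R^-1) * (b.+1%:R ^+ d * B))) <=
      \sum_(T : {set D} | T != set0) \sum_(k' : idx) (-1) ^+ #|T| * cor k (mix T k k').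
    have t0 : 0 <= (eps + b.+1%:R^-1) * (b.+1%:R ^+ d * B).
      by rewrite mulr_ge0 ?addr_ge0 ?invr_ge0 ?ler0n // mulr_ge0 // ltW.
    apply: (@le_trans _ _ (\sum_(T : {set D} | T != set0)
        - ((eps + b.+1%:R^-1) * (b.+1%:R ^+ d * B)))).
      rewrite sumr_const mulNrn lerN2 -[leLHS]mulr_natl ler_wpM2r // -natrX ler_nat.
      apply: leq_trans (max_card _) _.
      by rewrite -cardsT -powersetT card_powerset cardsT.
    apply: ler_sum => T /set0Pn[l lT].
    apply: (@le_trans _ _ (\sum_(k' : idx) - ((eps + (k' l == k l)%:R) * B))).
      rewrite sumrN lerN2 -mulr_suml big_split /= card_fix_coord sumr_const.
      rewrite card_ffun card_ord -[_ *+ _]mulr_natl natrX.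
      by rewrite le_eqVlt; apply/orP; left; apply/eqP; ring.
    apply: ler_sum => k' _; rewrite lerNl; apply: le_trans (off k k' T l lT).
    apply: le_trans (ler_norm _) _.
    by rewrite normrN normrM normrX normrN1 expr1n mul1r.
  have pB : 0 <= b.+1%:R ^+ d * B by rewrite mulr_ge0 // ltW.
  have := ler_wpM2r pB n_large; rewrite -/eps; move: low.
  set t := \sum_(T | _) _ ; rewrite -!mulrA; move: (_ * (_ * (_ * B))) => u.
  by move=> *; lra.
rewrite [leRHS]mulrC ler_pdivlMr //.
apply: (@le_trans _ _ (\sum_(k : idx) 2^-1 * b.+1%:R ^+ d * B)); last exact: ler_sum.
by rewrite sumr_const card_ffun card_ord -[leRHS]mulr_natl natrX mulrC.
Qed.

Variable A : {set 'S_n}.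

Lemma avgA_pure (phi : tup -> R) : pure phi ->
  pure (fun J => avgA A (fun a => phi (act a J))).
Proof.
move=> [p0 p1]; split=> [J JI|l J].
  by rewrite /avgA big1 ?mul0r // => a _; rewrite p0 // injectiveb_act.
rewrite sum_avgA /avgA big1 ?mul0r // => a _.
under eq_bigr do rewrite act_upd.
by rewrite -[RHS](p1 l (act a J)) [RHS](reindex_inj (@perm_inj _ a)).
Qed.

Variable H : R.

(** On each translated block, [dop] of the averaged function is the row of [coef] paired with [phi],
    so Cauchy-Schwarz applies row by row. The loss is the ratio of the number of injective tuples to
    the number of tuples in a block. *)
Lemma trans_pure_norm (phi : tup -> R) :
  (forall s : 'S_n, \sum_k \sum_J coef R A (fun l k => s (theta l k)) k J ^+ 2 <= H) ->
  pure phi ->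
  \sum_J avgA A (fun a => phi (act a J)) ^+ 2 <=
  2 * (n`!%:R / (n - d)`!%:R) / b.+1%:R ^+ d * H * \sum_J phi J ^+ 2.
Proof.
move=> HH phiP; have psiP := avgA_pure phiP.
have := pure_block_mass psiP; set N := \sum_J _ => low.
have up : \sum_(s : 'S_n) \sum_k dop (fun k => avgA A (fun a => phi (act a (act s (pt theta k))))) k ^+ 2
    <= \sum_(s : 'S_n) H * \sum_J phi J ^+ 2.
  apply: ler_sum => s _; apply: le_trans (ler_wpM2r _ (HH s)); last first.
    by apply: sumr_ge0 => J _; exact: sqr_ge0.
  rewrite mulr_suml; apply: ler_sum => k _.
  apply: le_trans (cauchy_schwarz _ _ _); rewrite le_eqVlt; apply/orP; left; apply/eqP.
  congr (_ ^+ 2); rewrite /coef /dop.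
  under [RHS]eq_bigr do rewrite -mulrA mulr_suml.
  rewrite -[RHS]mulr_sumr; congr (_ * _); rewrite [RHS]exchange_big /=.
  apply: eq_bigr => k' _; under [RHS]eq_bigr do rewrite mulr_suml.
  rewrite [RHS]exchange_big /=; apply: eq_bigr => T _.
  rewrite -sum_trans mulr_sumr; apply: eq_bigr => J _.
  have -> : act s (pt theta (mix T k k')) = pt (fun l k => s (theta l k)) (mix T k k').
    by apply/ffunP => l; rewrite actE !ptE.
  by ring.
have := le_trans low up; rewrite sumr_const card_Sn.
have fp : (0 : R) < (n - d)`!%:R by rewrite ltr0n fact_gt0.
have bd : (0 : R) < b.+1%:R ^+ d by rewrite exprn_gt0 ?ltr0n.
rewrite -[X in _ <= X -> _]mulr_natl => hh.
rewrite -(ler_pM2l (_ : 0 < 2^-1 * b.+1%:R ^+ d * (n - d)`!%:R)); last first.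
  by rewrite !mulr_gt0 // invr_gt0.
rewrite -[leLHS]mulrA; apply: le_trans hh _; rewrite le_eqVlt; apply/orP; left; apply/eqP.
by field; rewrite !lt0r_neq0.
Qed.

End Pure.

(** * The gain for sets closed under conjugation *)

Section Conjugation.

Variables (R : rcfType) (n b : nat) (D : finType).
Local Notation idx := {ffun D -> 'I_b.+1}.
Local Notation tup := {ffun D -> 'I_n}.
Let d := #|D|.

Variable theta : D -> 'I_b.+1 -> 'I_n.
Hypothesis theta_inj : forall l m j k, theta l j = theta m k -> l = m /\ j = k.
Hypothesis b_gt0 : (0 < b)%N.
Hypothesis n_ge2d : (2 * d <= n)%N.

Variable A : {set 'S_n}.
Local Notation tr := (trans R A).
Hypothesis conjA : forall (s : 'S_n) (I J : tup), tr (act s I) (act s J) = tr I J.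

Lemma exists_fresh (J : tup) :
  exists z : tup, injectiveb z /\ forall l m, z l != J m.
Proof.
pose X := ~: [set J m | m in [set: D]].
have cX : (d <= #|X|)%N.
  have h : (#|[set J m | m in [set: D]]| <= d)%N.
    by apply: leq_trans (leq_imset_card _ _) _; rewrite cardsT.
  by rewrite cardsCs setCK card_ord; lia.
exists [ffun l => enum_val (widen_ord cX (enum_rank l))]; split.
  apply/injectiveP => l m; rewrite !ffunE => /enum_val_inj E.
  by apply: enum_rank_inj; apply: val_inj; have := congr1 val E.
move=> l m; rewrite ffunE; have := enum_valP (widen_ord cX (enum_rank l)).
rewrite /X inE; apply: contraNneq => ->; exact: imset_f.
Qed.

Variable H : R.
Hypothesis HS_le : \sum_k \sum_J coef R A theta k J ^+ 2 <= H.

Let cD : #|{set D}| = (2 ^ d)%N.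
Proof. by rewrite -cardsT -powersetT card_powerset cardsT. Qed.

(* Conjugation invariance makes this alternating sum constant over the
   [b.+1 ^ d] cubes of the block, hence the gain over the Hilbert-Schmidt bound. *)
Lemma alternating_trans_le (I z J : tup) (p : D -> D) :
  injectiveb I -> injectiveb z -> (forall l m, z l != I m) ->
  (forall m, J m = I (p m)) ->
  (\sum_(T : {set D}) (-1) ^+ #|T| * tr (mix T I z) J) ^+ 2 <=
  4 ^+ d / b.+1%:R ^+ d * H.
Proof.
move=> /injectiveP II /injectiveP zI zJ Jp; set beta := \sum_T _.
(* A non-zero shift makes [k] and [sh k] differ in every coordinate, so the points of the two tuples
   are all distinct. *)
pose c : 'I_b.+1 := ord_max.
have c0 : c != 0 by apply/eqP => /(congr1 val) /= b0; move: b_gt0; rewrite b0.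
pose sh (k : idx) : idx := [ffun l => k l + c].
pose Jk (k : idx) : tup := [ffun m => pt theta k (p m)].
have betaE k : beta = \sum_(T : {set D}) (-1) ^+ #|T| * coef R A theta (mix T k (sh k)) (Jk k).
  pose f (s : D + D) := match s with inl l => pt theta k l | inr l => pt theta (sh k) l end.
  pose g (s : D + D) := match s with inl l => I l | inr l => z l end.
  have [s sP] : exists s : 'S_n, {in [set: D + D], forall i, s (f i) = g i}.
    apply: perm_extends.
      move=> [l|l] [m|m] _ _; rewrite /f !ptE => /theta_inj[-> //].
        by rewrite ffunE => /eqP; rewrite eq_sym addrC -subr_eq0 addrK (negbTE c0).
      by rewrite ffunE => /eqP; rewrite addrC -subr_eq0 addrK (negbTE c0).
    move=> [l|l] [m|m] _ _; rewrite /g => E.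
    - by rewrite (II _ _ E).
    - by have := zJ m l; rewrite E eqxx.
    - by have := zJ l m; rewrite E eqxx.
    - by rewrite (zI _ _ E).
  have sI : act s (pt theta k) = I.
    by apply/ffunP => l; rewrite actE; exact: (sP (inl l) (in_setT _)).
  have sz : act s (pt theta (sh k)) = z.
    by apply/ffunP => l; rewrite actE; exact: (sP (inr l) (in_setT _)).
  have sJ : act s (Jk k) = J.
    by apply/ffunP => m; rewrite actE ffunE Jp -sI actE.
  rewrite /coef (dop_cube (fun k' => tr (pt theta k') (Jk k))).
  apply: eq_bigr => T _; rewrite -sI -sz -sJ -act_mix conjA.
  by rewrite pt_mix.
have bd : (0 : R) < b.+1%:R ^+ d by rewrite exprn_gt0 ?ltr0n.
rewrite mulrAC ler_pdivlMr //.
have -> : beta ^+ 2 * b.+1%:R ^+ d = \sum_(k : idx) beta ^+ 2.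
  by rewrite sumr_const card_ffun card_ord -[RHS]mulr_natl natrX mulrC.
(* Cauchy-Schwarz over [T] costs [2 ^+ d]; the later sum over [T] of full Hilbert-Schmidt norms
   costs another [2 ^+ d]. *)
have one k : beta ^+ 2 <= 2 ^+ d *
    \sum_(T : {set D}) \sum_J coef R A theta (mix T k (sh k)) J ^+ 2.
  rewrite (betaE k); apply: le_trans (cauchy_schwarz _ _ _) _.
  have -> : \sum_(T : {set D}) ((-1) ^+ #|T|) ^+ 2 = 2 ^+ d :> R.
    under eq_bigr do rewrite sqrr_sign.
    by rewrite sumr_const cD natrX.
  rewrite ler_wpM2l ?exprn_ge0 //; apply: ler_sum => T _.
  rewrite (bigD1 (Jk k)) //= lerDl; apply: sumr_ge0 => J' _; exact: sqr_ge0.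
apply: le_trans (ler_sum _ (fun k _ => one k)) _.
rewrite -mulr_sumr exchange_big /=.
have -> : 4 ^+ d * H = 2 ^+ d * \sum_(T : {set D}) H.
  by rewrite sumr_const cD -[H *+ _]mulr_natl natrX mulrA -exprMn -natrM.
rewrite ler_wpM2l ?exprn_ge0 //; apply: ler_sum => T _.
apply: le_trans HS_le.
apply: (@sum_inj_le _ _ _ xpredT xpredT (fun k => mix T k (sh k))
  (fun k => \sum_J coef R A theta k J ^+ 2)) => //.
  move=> j k _ _ /ffunP E; apply/ffunP => l; move: (E l); rewrite !mixE !ffunE.
  by case: ifP => // _; exact: addIr.
by move=> k; apply: sumr_ge0 => J' _; exact: sqr_ge0.
Qed.

(* By conjugation invariance, [tr I J] depends only on the pattern of coincidences
   between [I] and [J], so the entries of [I] off the range of [J] may be replaced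
   by fixed fresh ones. *)
Lemma trans_act_stable (I J : tup) (z : tup) :
  injectiveb I -> injectiveb J -> injectiveb z -> (forall l m, z l != J m) ->
  let T := [set l | I l \notin [set J m | m in [set: D]]] in
  tr (mix T I z) J = tr I J.
Proof.
move=> /injectiveP II /injectiveP JI /injectiveP zI zJ T.
pose f (s : D + D) := match s with inl l => J l | inr l => I l end.
pose g (s : D + D) := match s with inl l => J l | inr l => z l end.
pose B : {set D + D} := [set s | if s is inr l then l \in T else true].
have TJ l m : l \in T -> I l != J m.
  by rewrite inE; apply: contraNneq => ->; exact: imset_f.
have [s sP] : exists s : 'S_n, {in B, forall i, s (f i) = g i}.
  apply: perm_extends => -[l|l] [m|m]; rewrite !inE /f /g => lB mB E.
  - by rewrite (JI _ _ E).
  - by have := TJ m l; rewrite inE mB E eqxx => /(_ isT).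
  - by have := TJ l m; rewrite inE lB E eqxx => /(_ isT).
  - by rewrite (II _ _ E).
  - by rewrite (JI _ _ E).
  - by have := zJ m l; rewrite E eqxx.
  - by have := zJ l m; rewrite E eqxx.
  - by rewrite (zI _ _ E).
have sJ l : s (J l) = J l by apply: (sP (inl l)); rewrite inE.
rewrite -(conjA s I J); congr (tr _ _); apply/ffunP => l; last by rewrite actE sJ.
rewrite mixE actE; case: ifP => [lT|]; first by rewrite (sP (inr l)) // inE.
by rewrite inE => /negbT; rewrite negbK => /imsetP[m _ ->]; rewrite sJ.
Qed.

(** Sort [I] by the set [T] of its entries off the range of [J]. There the matrix entry depends only
    on [mix T I z], so [sum_avoid] moves these entries into the range with the sign [(-1) ^+ #|T|].
    What remains is indexed by tuples with entries from [J], weighted by the alternating sums of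
    [alternating_trans_le]. *)
Lemma transpose_bound (psi : tup -> R) (eps : R) (J : tup) :
  pure psi -> injectiveb J -> 0 <= eps -> 4 ^+ d / b.+1%:R ^+ d * H <= eps ^+ 2 ->
  `|\sum_I tr I J * psi I| <=
  eps * \sum_(p : {ffun D -> D}) `|psi [ffun m => J (p m)]|.
Proof.
move=> [psi0 psi1] JI eps0 epsH.
have [z [zI zJ]] := exists_fresh J.
have /injectiveP JI' := JI.
pose X := [set J m | m in [set: D]].
pose fr (I : tup) := [set l | I l \notin X].
pose beta (I : tup) := \sum_(T : {set D}) (-1) ^+ #|T| * tr (mix T I z) J.
have E1 : \sum_I tr I J * psi I =
    \sum_(T : {set D}) \sum_(I : tup | fr I == T) tr (mix T I z) J * psi I.
  rewrite (partition_big fr xpredT) //=; apply: eq_bigr => T _.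
  apply: eq_bigr => I /eqP IT.
  have [II|/psi0 ->] := boolP (injectiveb I); last by rewrite !mulr0.
  by rewrite -IT trans_act_stable.
have E2 (T : {set D}) : \sum_(I : tup | fr I == T) tr (mix T I z) J * psi I =
    (-1) ^+ #|T| * \sum_(I : tup | [forall l, I l \in X]) tr (mix T I z) J * psi I.
  pose G (I : tup) := [forall l in ~: T, I l \in X]%:R * (tr (mix T I z) J * psi I).
  have -> : \sum_(I : tup | fr I == T) tr (mix T I z) J * psi I =
      \sum_(I : tup | [forall l in T, I l \notin X]) G I.
    rewrite big_mkcond [RHS]big_mkcond; apply: eq_bigr => I _; rewrite /G.
    have -> : (fr I == T) = [forall l in T, I l \notin X] && [forall l in ~: T, I l \in X].
      apply/eqP/andP => [<-|[/'forall_implyP H1 /'forall_implyP H2]].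
        split; apply/'forall_implyP => l; rewrite !inE //; by rewrite negbK.
      apply/setP => l; rewrite inE; have [lT|lT] := boolP (l \in T); first by rewrite H1.
      by rewrite H2 // inE.
    move: [forall l in T, I l \notin X] [forall l in ~: T, I l \in X] => [] [] /=;
      by rewrite ?mul1r ?mul0r.
  rewrite sum_avoid; last first.
    move=> l I lT; rewrite /G.
    have e1 k : [forall m in ~: T, upd I l k m \in X] = [forall m in ~: T, I m \in X].
      apply/'forall_implyP/'forall_implyP => E m mT; have := E m mT; rewrite updE;
        by case: eqP => // ml; rewrite ml inE lT in mT.
    have e2 k : mix T (upd I l k) z = mix T I z.
      by apply/ffunP => m; rewrite !mixE updE; case: ifP => // mT; case: eqP => // ml; rewrite ml lT in mT.
    under eq_bigr do rewrite e1 e2.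
    by rewrite -mulr_sumr -mulr_sumr psi1 !mulr0.
  congr (_ * _); rewrite big_mkcond [RHS]big_mkcond; apply: eq_bigr => I _; rewrite /G.
  have -> : [forall l, I l \in X] = [forall l in T, I l \in X] && [forall l in ~: T, I l \in X].
    apply/forallP/andP => [H1|[/'forall_implyP H1 /'forall_implyP H2] l].
      by split; apply/'forall_implyP => l _.
    by have [lT|lT] := boolP (l \in T); [exact: H1 | apply: H2; rewrite inE].
  move: [forall l in T, I l \in X] [forall l in ~: T, I l \in X] => [] [] /=;
    by rewrite ?mul1r ?mul0r.
have E3 : \sum_I tr I J * psi I = \sum_(I : tup | [forall l, I l \in X]) beta I * psi I.
  rewrite E1; under eq_bigr do rewrite E2.
  under eq_bigr do rewrite mulr_sumr.
  rewrite exchange_big /=; apply: eq_bigr => I _.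
  by rewrite /beta mulr_suml; apply: eq_bigr => T _; rewrite mulrA.
rewrite E3; apply: le_trans (ler_norm_sum _ _ _) _.
apply: (@le_trans _ _ (\sum_(I : tup | [forall l, I l \in X]) eps * `|psi I|)).
  apply: ler_sum => I /forallP IX; rewrite normrM.
  have [II|/psi0 ->] := boolP (injectiveb I); last by rewrite normr0 !mulr0.
  rewrite ler_wpM2r // -(ler_pXn2r (n := 2)) ?nnegrE // real_normK ?num_real //.
  apply: le_trans epsH.
  have /fin_all_exists[r rP] : forall l, exists m, I l = J m.
    by move=> l; have /imsetP[m _ ->] := IX l; exists m.
  have rI : injective r.
    by move=> l m E; apply: (injectiveP _ II); rewrite !rP E.
  apply: (@alternating_trans_le I z J (invF rI)) => //.
    by move=> l m; rewrite rP.
  by move=> m; rewrite rP f_invF.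
rewrite -mulr_sumr ler_wpM2l //.
pose h (I : tup) : {ffun D -> D} := [ffun l => odflt l [pick m | I l == J m]].
have hK (I : tup) : [forall l, I l \in X] -> [ffun m => J (h I m)] = I.
  move=> /forallP IX; apply/ffunP => l; rewrite !ffunE; case: pickP => [m /eqP -> //|nJ].
  by have /imsetP[m _ E] := IX l; move: (nJ m); rewrite E eqxx.
rewrite (eq_bigr (fun I => `|psi [ffun m => J (h I m)]|)); last first.
  by move=> I IX; rewrite hK.
apply: (@sum_inj_le _ _ _ _ xpredT h (fun p : {ffun D -> D} => `|psi [ffun m => J (p m)]|)) => //.
by move=> I I' IX IX' E; rewrite -(hK I) // E hK.
Qed.

(** [transpose_bound] controls the transposed matrix on the pure function [psi]. With [chi] its
    image, the squared norm of [psi] is the pairing of [phi] with [chi], and Cauchy-Schwarz returns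
    the bound to [phi]. *)
Lemma trans_pure_norm_conj (phi : tup -> R) : pure phi ->
  \sum_J avgA A (fun a => phi (act a J)) ^+ 2 <=
  4 ^+ d / b.+1%:R ^+ d * H * (#|{ffun D -> D}|%:R ^+ 2) * \sum_J phi J ^+ 2.
Proof.
move=> phiP; set e2 := 4 ^+ d / _ * H; set N := #|_|%:R.
pose psi J := avgA A (fun a => phi (act a J)).
have psiP : pure psi by exact: avgA_pure.
have H0 : 0 <= H.
  apply: le_trans HS_le; apply: sumr_ge0 => k _; apply: sumr_ge0 => J _; exact: sqr_ge0.
have e20 : 0 <= e2 by rewrite mulr_ge0 // divr_ge0 // exprn_ge0 // ler0n.
pose eps := Num.sqrt e2.
have epsE : eps ^+ 2 = e2 by rewrite sqr_sqrtr.
pose chi J := \sum_I tr I J * psi I.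
have chi0 (J : tup) : ~~ injectiveb J -> chi J = 0.
  move=> JI; apply: big1 => I _.
  have [II|/(proj1 psiP) ->] := boolP (injectiveb I); last by rewrite mulr0.
  rewrite /trans /avgA big1 ?mul0r // => a _; case: eqP => // E.
  by rewrite -E injectiveb_act II in JI.
have psi_chi : \sum_J psi J ^+ 2 = \sum_J phi J * chi J.
  under [RHS]eq_bigr do rewrite mulr_sumr.
  rewrite exchange_big /=; apply: eq_bigr => I _.
  rewrite expr2 {1}/psi -sum_trans mulr_suml; apply: eq_bigr => J _; ring.
have chi_le : \sum_J chi J ^+ 2 <= e2 * N ^+ 2 * \sum_J psi J ^+ 2.
  apply: (@le_trans _ _ (\sum_(J : tup | injectiveb J) e2 * (N * \sum_(p : {ffun D -> D}) psi [ffun m => J (p m)] ^+ 2))).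
    rewrite [leRHS]big_mkcond; apply: ler_sum => J _.
    case: ifP => [JI|/negbT /chi0 ->]; last by rewrite expr0n.
    have := transpose_bound psiP JI (sqrtr_ge0 e2) (_ : e2 <= _).
    rewrite -/eps epsE lexx => /(_ isT) le1.
    rewrite -(real_normK (num_real (chi J))) -epsE.
    apply: (@le_trans _ _ ((eps * \sum_(p : {ffun D -> D}) `|psi [ffun m => J (p m)]|) ^+ 2)).
      by rewrite lerXn2r ?nnegrE // mulr_ge0 ?sqrtr_ge0 // sumr_ge0.
    rewrite exprMn ler_wpM2l ?sqr_ge0 //.
    apply: le_trans (power_mean 1 (fun p => normr_ge0 _)) _.
    rewrite expr1 ler_wpM2l ?ler0n // le_eqVlt; apply/orP; left; apply/eqP.
    by apply: eq_bigr => p _; rewrite real_normK ?num_real.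
  rewrite -mulr_sumr -mulrA ler_wpM2l // -mulr_sumr expr2 -mulrA ler_wpM2l ?ler0n //.
  rewrite exchange_big /=.
  apply: (@le_trans _ _ (\sum_(p : {ffun D -> D}) \sum_J psi J ^+ 2)); last first.
    by rewrite sumr_const -[leLHS]mulr_natl.
  apply: ler_sum => p _.
  have [pI|pI] := boolP (injectiveb p); last first.
    rewrite big1; first by apply: sumr_ge0 => J _; exact: sqr_ge0.
    move=> J _; rewrite (proj1 psiP) ?expr0n //; apply: contra pI => /injectiveP E.
    by apply/injectiveP => l m plm; apply: E; rewrite !ffunE plm.
  apply: (@sum_inj_le _ _ _ _ xpredT (fun J : tup => [ffun m => J (p m)] : tup) (fun J => psi J ^+ 2)) => //.
    move=> J J' _ _ /ffunP E; apply/ffunP => l.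
    by have := E (invF (injectiveP _ pI) l); rewrite !ffunE f_invF.
  by move=> J; exact: sqr_ge0.
have [N0|] := eqVneq (\sum_J psi J ^+ 2) 0.
  rewrite -/psi N0 mulr_ge0 ?sumr_ge0 // => [|J _]; last exact: sqr_ge0.
  by rewrite mulr_ge0 // exprn_ge0 // ler0n.
have psi_ge0 : 0 <= \sum_J psi J ^+ 2 by apply: sumr_ge0 => J _; exact: sqr_ge0.
move=> psi_ne; have psi_gt0 : 0 < \sum_J psi J ^+ 2 by rewrite lt_def psi_ne.
rewrite -(ler_pM2r psi_gt0).
have := cauchy_schwarz xpredT phi chi; rewrite -psi_chi expr2 => /le_trans; apply.
have -> : e2 * N ^+ 2 * (\sum_J phi J ^+ 2) * (\sum_J psi J ^+ 2) =
  (\sum_J phi J ^+ 2) * (e2 * N ^+ 2 * (\sum_J psi J ^+ 2)) by ring.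
by rewrite ler_wpM2l // sumr_ge0 // => J _; exact: sqr_ge0.
Qed.

End Conjugation.

(** * Synthesis from pure coefficients *)

Section Synthesis.

Variables (R : rcfType) (n : nat) (D : finType).
Local Notation tup := {ffun D -> 'I_n}.
Let d := #|D|.

Definition bipure (c : tup -> tup -> R) :=
  (forall I, pure (c I)) /\ (forall J, pure (fun I => c I J)).

Definition synth (c : tup -> tup -> R) (x : 'S_n) := \sum_I c I (act x I).

Lemma sum_synth (c : tup -> tup -> R) (h : 'S_n -> R) :
  \sum_x synth c x * h x = \sum_I \sum_J c I J * \sum_(x | act x I == J) h x.
Proof.
under eq_bigr do rewrite mulr_suml.
rewrite exchange_big; apply: eq_bigr => I _ /=.
rewrite (partition_big (fun x => act x I) xpredT) //=; apply: eq_bigr => J _.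
by rewrite mulr_sumr; apply: eq_bigr => x /eqP ->.
Qed.

Section Umvirate.

Variables (E : finType) (I J : {ffun E -> 'I_n}).
Hypotheses (II : injectiveb I) (JI : injectiveb J).
Let e := #|E|.
Let X := [set I r | r in [set: E]].
Let Y := [set J r | r in [set: E]].

Let IX r : I r \in X. Proof. exact: imset_f. Qed.
Let JY r : J r \in Y. Proof. exact: imset_f. Qed.

(** The coordinates off [T] repeat conditions already imposed by the umvirate from [I] to [J]. *)
Definition matched (T : {set D}) (I' J' : tup) :=
  [forall l in ~: T, [exists r, (I' l == I r) && (J' l == J r)]].

Definition in_range (T : {set D}) (I' J' : tup) :=
  [forall l in T, I' l \in X] && [forall l in T, J' l \in Y].

Let fresh (I' : tup) := [set l | I' l \notin X].

Let card_two (I' J' : tup) : injectiveb I' -> injectiveb J' ->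
  #|[set x : 'S_n | (act x I == J) && (act x I' == J')]| =
  if [forall l in fresh I', J' l \notin Y] && matched (fresh I') I' J'
  then (n - (e + #|fresh I'|))`! else 0%N.
Proof.
move=> /injectiveP I'I /injectiveP J'I; have /injectiveP II' := II; have /injectiveP JI' := JI.
case: ifP => [/andP[/'forall_implyP fY /'forall_implyP mt]|no]; last first.
  apply/eqP; rewrite cards_eq0; apply/eqP/setP => x; rewrite !inE.
  apply/negP => /andP[/eqP xI /eqP xI']; move/negP: no; apply; apply/andP; split.
    apply/'forall_implyP => l; rewrite inE; apply: contra => /imsetP[r _ E1].
    have -> : I' l = I r by apply: (@perm_inj _ x); rewrite -(actE x I') xI' E1 -xI actE.
    exact: IX.
  apply/'forall_implyP => l; rewrite !inE negbK => /imsetP[r _ E1].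
  by apply/existsP; exists r; rewrite E1 -xI' -xI !actE E1 !eqxx.
pose f (s : E + D) := match s with inl r => I r | inr l => I' l end.
pose g (s : E + D) := match s with inl r => J r | inr l => J' l end.
pose A : {set E + D} := [set s | if s is inr l then l \in fresh I' else true].
have cA : #|A| = (e + #|fresh I'|)%N.
  have -> : A = (inl @: [set: E]) :|: (inr @: fresh I').
    apply/setP => -[r|l]; rewrite !inE.
      by rewrite mem_imset ?inE // => ? ? [].
    case: imsetP => [[? _ //]|_] /=.
    by rewrite mem_imset ?inE // => ? ? [].
  rewrite cardsU !card_imset => [|? ? []|? ? []] //.
  rewrite (_ : _ :&: _ = set0) ?cards0 ?subn0 ?cardsT //.
  by apply/setP => s; rewrite !inE; apply/negP => /andP[/imsetP[? _ ->] /imsetP[]].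
have fI : {in A &, injective f}.
  move=> [r|l] [s|m]; rewrite !inE /f => lA mA E1.
  - by rewrite (II' _ _ E1).
  - by rewrite -E1 IX in mA.
  - by rewrite E1 IX in lA.
  - by rewrite (I'I _ _ E1).
have gI : {in A &, injective g}.
  move=> [r|l] [s|m] lA mA; rewrite /g => E1.
  - by rewrite (JI' _ _ E1).
  - by have := fY m; rewrite inE in mA; rewrite mA -E1 JY => /(_ isT).
  - by have := fY l; rewrite inE in lA; rewrite lA E1 JY => /(_ isT).
  - by rewrite (J'I _ _ E1).
rewrite -cA -(card_agree fI gI); apply: eq_card => x; rewrite !inE.
apply/andP/'forall_implyP => [[/eqP xI /eqP xI'] [r|l] _|H].
- by rewrite /f /g -xI actE.
- by rewrite /f /g -xI' actE.
have xI r : x (I r) = J r by apply/eqP; apply: (H (inl r)); rewrite inE.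
split; apply/eqP/ffunP => l; rewrite actE //.
have [lf|lf] := boolP (l \in fresh I'); first by apply/eqP; apply: (H (inr l)); rewrite inE.
have lf' : l \in ~: fresh I' by rewrite inE.
by have /existsP[r /andP[/eqP -> /eqP ->]] := mt l lf'; rewrite xI.
Qed.

(** For tuples [I'] whose entries off the range of [I] are those in [T], the number of permutations
    depends only on [#|T|]. Applying [sum_avoid] to [I'] and then to [J'] brings these entries into
    the ranges of [I] and [J], and the two signs cancel. *)
Lemma sum_synth_umvirate (c : tup -> tup -> R) : bipure c ->
  \sum_(x | act x I == J) synth c x =
  \sum_(T : {set D}) (n - (e + #|T|))`!%:R *
    \sum_(I' : tup) \sum_(J' : tup | in_range T I' J' && matched T I' J') c I' J'.
Proof.
move=> [c1 c2].
have step1 : \sum_(x | act x I == J) synth c x = \sum_(I' : tup) \sum_(J' : tup)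
    #|[set x : 'S_n | (act x I == J) && (act x I' == J')]|%:R * c I' J'.
  rewrite exchange_big; apply: eq_bigr => I' _ /=.
  rewrite (partition_big (fun x => act x I') xpredT) //=; apply: eq_bigr => J' _.
  under eq_bigr => x /andP[_ /eqP ->] do rewrite -[c I' J']mul1r.
  rewrite -mulr_suml sumr_const; congr (_%:R * _); apply: eq_card => x.
  by rewrite inE unfold_in.
have step2 : \sum_(x | act x I == J) synth c x =
    \sum_(T : {set D}) (n - (e + #|T|))`!%:R * \sum_(I' : tup) \sum_(J' : tup)
      ([forall l in T, I' l \notin X] && [forall l in T, J' l \notin Y] &&
       matched T I' J')%:R * c I' J'.
  rewrite step1; under [RHS]eq_bigr do rewrite mulr_sumr.
  rewrite [RHS]exchange_big; apply: eq_bigr => I' _ /=.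
  under [RHS]eq_bigr do rewrite mulr_sumr.
  rewrite [RHS]exchange_big; apply: eq_bigr => J' _ /=.
  have [I'I|/(proj1 (c2 J')) ->] := boolP (injectiveb I'); last first.
    by rewrite mulr0 big1 // => T _; rewrite !mulr0.
  have [J'I|/(proj1 (c1 I')) ->] := boolP (injectiveb J'); last first.
    by rewrite mulr0 big1 // => T _; rewrite !mulr0.
  rewrite card_two // (bigD1 (fresh I')) //= [X in _ + X]big1 ?addr0.
    have -> : [forall l in fresh I', I' l \notin X].
      by apply/'forall_implyP => l; rewrite inE.
    by case: ifP => // _; rewrite /= ?mul1r // !mul0r mulr0.
  move=> T neT; rewrite [_ && _ && _](_ : _ = false) ?mul0r ?mulr0 //.
  apply/negP => /andP[/andP[/'forall_implyP h1 _] /'forall_implyP h2].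
  case/eqP: neT; apply/setP => l; rewrite inE.
  have [lT|lT] := boolP (l \in T); first by rewrite h1.
  have := h2 l; rewrite inE lT => /(_ isT) /existsP[r /andP[/eqP -> _]].
  by rewrite IX.
rewrite step2; apply: eq_bigr => T _; congr (_ * _).
have mI l (I' J' : tup) k : l \in T -> matched T (upd I' l k) J' = matched T I' J'.
  move=> lT; apply/'forall_implyP/'forall_implyP => H m mT; have := H m mT;
    rewrite updE; by case: eqP => // ml; rewrite ml inE lT in mT.
have mJ l (I' J' : tup) k : l \in T -> matched T I' (upd J' l k) = matched T I' J'.
  move=> lT; apply/'forall_implyP/'forall_implyP => H m mT; have := H m mT;
    rewrite updE; by case: eqP => // ml; rewrite ml inE lT in mT.
transitivity (\sum_(J' : tup) \sum_(I' : tup | [forall l in T, I' l \notin X])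
    ([forall l in T, J' l \notin Y] && matched T I' J')%:R * c I' J').
  rewrite exchange_big; apply: eq_bigr => J' _ /=.
  rewrite [RHS]big_mkcond; apply: eq_bigr => I' _.
  by case: [forall l in T, I' l \notin X]; rewrite //= mul0r.
have avI (J' : tup) : \sum_(I' : tup | [forall l in T, I' l \notin X])
      ([forall l in T, J' l \notin Y] && matched T I' J')%:R * c I' J' =
    (-1) ^+ #|T| * \sum_(I' : tup | [forall l in T, I' l \in X])
      ([forall l in T, J' l \notin Y] && matched T I' J')%:R * c I' J'.
  apply: (@sum_avoid _ _ _ X T (fun I' : tup => ([forall l in T, J' l \notin Y] &&
     matched T I' J')%:R * c I' J')) => l I' lT.
  under eq_bigr => k _ do rewrite (mI l I' J' k lT).
  by rewrite -mulr_sumr (proj2 (c2 J')) mulr0.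
rewrite (eq_bigr _ (fun J' _ => avI J')).
rewrite -mulr_sumr exchange_big /=.
transitivity ((-1) ^+ #|T| * \sum_(I' : tup | [forall l in T, I' l \in X])
   \sum_(J' : tup | [forall l in T, J' l \notin Y]) (matched T I' J')%:R * c I' J').
  congr (_ * _); apply: eq_bigr => I' _; rewrite [RHS]big_mkcond; apply: eq_bigr => J' _.
  by case: [forall l in T, J' l \notin Y]; rewrite //= mul0r.
have avJ (I' : tup) : \sum_(J' : tup | [forall l in T, J' l \notin Y])
      (matched T I' J')%:R * c I' J' =
    (-1) ^+ #|T| * \sum_(J' : tup | [forall l in T, J' l \in Y])
      (matched T I' J')%:R * c I' J'.
  apply: (@sum_avoid _ _ _ Y T (fun J' : tup => (matched T I' J')%:R * c I' J')) => l J' lT.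
  under eq_bigr => k _ do rewrite (mJ l I' J' k lT).
  by rewrite -mulr_sumr (proj2 (c1 I')) mulr0.
rewrite (eq_bigr _ (fun I' _ => avJ I')).
rewrite -mulr_sumr mulrA -expr2 sqrr_sign mul1r.
rewrite big_mkcond; apply: eq_bigr => I' _ /=.
rewrite [RHS]big_mkcond /in_range /=; case: ifP => _; last by rewrite big1.
rewrite big_mkcond; apply: eq_bigr => J' _ /=.
by case: [forall l in T, J' l \in Y]; case: matched; rewrite ?mul1r ?mul0r.
Qed.

Lemma in_range_matched (T : {set D}) (I' J' : tup) :
  in_range T I' J' -> matched T I' J' ->
  exists p p' : {ffun D -> E}, I' = [ffun l => I (p l)] /\ J' = [ffun l => J (p' l)].
Proof.
move=> /andP[/'forall_implyP h1 /'forall_implyP h2] /'forall_implyP h3.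
have H l : exists q : E * E, I' l = I q.1 /\ J' l = J q.2.
  have [lT|lT] := boolP (l \in T).
    have /imsetP[r _ ->] := h1 l lT; have /imsetP[s _ ->] := h2 l lT.
    by exists (r, s).
  have := h3 l; rewrite inE lT => /(_ isT) /existsP[r /andP[/eqP -> /eqP ->]].
  by exists (r, r).
have [q qP] := fin_all_exists H.
exists [ffun l => (q l).1], [ffun l => (q l).2].
by split; apply/ffunP => l; rewrite !ffunE; have [] := qP l.
Qed.

(** Every surviving [I'] takes its [d] entries from the [e] entries of [I], so it repeats one and
    its coefficient is zero. *)
Lemma synth_low (c : tup -> tup -> R) : bipure c -> (e < d)%N ->
  \sum_(x | act x I == J) synth c x = 0.
Proof.
move=> cP ed; rewrite sum_synth_umvirate //; apply: big1 => T _.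
rewrite big1 ?mulr0 // => I' _; apply: big1 => J' /andP[h1 h2].
have [p [p' [EI _]]] := in_range_matched h1 h2.
apply: (proj1 (proj2 cP J')); apply/negP => /injectiveP I'I.
have pI : injective p.
  by move=> l m lm; apply: I'I; rewrite EI !ffunE lm.
by have := leq_card p pI; rewrite leqNgt ed.
Qed.

End Umvirate.

End Synthesis.

(** * Comparison of a synthesised function with its coefficients *)

Section Energy.

Variables (R : rcfType) (n : nat) (D : finType).
Local Notation tup := {ffun D -> 'I_n}.
Let d := #|D|.
Let N := #|{ffun D -> D}|.

Definition reord (I : tup) (p : {ffun D -> D}) : tup := [ffun l => I (p l)].

Lemma reord_injective (I : tup) (p : {ffun D -> D}) : injectiveb (reord I p) -> injectiveb p.
Proof.
move=> /injectiveP H; apply/injectiveP => l m plm; apply: H.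
by rewrite !ffunE plm.
Qed.

Lemma reord_injl (p : {ffun D -> D}) : injectiveb p -> injective (reord ^~ p).
Proof.
move=> /injectiveP pI I J /ffunP E; apply/ffunP => l.
by have := E (invF pI l); rewrite !ffunE f_invF.
Qed.

Lemma reord_injr (I : tup) : injectiveb I -> injective (reord I).
Proof.
move=> /injectiveP II p p' /ffunP E; apply/ffunP => l.
by have := E l; rewrite !ffunE => /II.
Qed.

Variable c : tup -> tup -> R.
Hypothesis cP : bipure c.
Hypothesis c_sym : forall I J (p : {ffun D -> D}), injectiveb p -> c (reord I p) (reord J p) = c I J.
Hypothesis n_large : (2 * 2 ^ d * N ^ 2 + d <= n)%N.

Let S := \sum_I \sum_J c I J ^+ 2.

Let c0l (I J : tup) : ~~ injectiveb I -> c I J = 0. Proof. exact: (proj1 (proj2 cP J)). Qed.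
Let c0r (I J : tup) : ~~ injectiveb J -> c I J = 0. Proof. exact: (proj1 (proj1 cP I)). Qed.

Let S_ge0 : 0 <= S.
Proof. by do 2![apply: sumr_ge0 => ? _]; exact: sqr_ge0. Qed.

Let cross (p p' : {ffun D -> D}) :
  \sum_I \sum_J `|c I J| * `|c (reord I p) (reord J p')| <= S.
Proof.
have [pI|pI] := boolP (injectiveb p); last first.
  rewrite big1 // => I _; apply: big1 => J _; rewrite (c0l (I := reord I p)) ?normr0 ?mulr0 //.
  by apply: contra pI; exact: reord_injective.
have [p'I|p'I] := boolP (injectiveb p'); last first.
  rewrite big1 // => I _; apply: big1 => J _; rewrite (c0r _ (J := reord J p')) ?normr0 ?mulr0 //.
  by apply: contra p'I; exact: reord_injective.
have le2 : \sum_I \sum_J c (reord I p) (reord J p') ^+ 2 <= S.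
  rewrite /S !pair_big /=.
  apply: (@sum_inj_le _ _ _ xpredT xpredT
    (fun q : tup * tup => (reord q.1 p, reord q.2 p')) (fun q => c q.1 q.2 ^+ 2)) => //.
    by move=> [I J] [I' J'] _ _ [/(reord_injl pI) -> /(reord_injl p'I) ->].
  by move=> q; exact: sqr_ge0.
apply: (@le_trans _ _ (\sum_I \sum_J (2^-1 * c I J ^+ 2 +
    2^-1 * c (reord I p) (reord J p') ^+ 2))).
  apply: ler_sum => I _; apply: ler_sum => J _.
  move: (c I J) (c (reord I p) (reord J p')) => u v.
  rewrite -(real_normK (num_real u)) -(real_normK (num_real v)); move: `|u| `|v| => x y.
  have := sqr_ge0 (x - y); rewrite sqrrB; lra.
under eq_bigr do rewrite big_split /= -!mulr_sumr.
rewrite big_split /= -!mulr_sumr -/S; lra.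
Qed.

Let Ninj := #|[set p : {ffun D -> D} | injectiveb p]|.

Let Ninj_gt0 : (0 < Ninj)%N.
Proof.
apply/card_gt0P; exists [ffun l => l]; rewrite inE; apply/injectiveP => l m.
by rewrite !ffunE.
Qed.

Let main_term (I J : tup) : injectiveb I -> injectiveb J ->
  \sum_I' \sum_(J' | matched I J set0 I' J') c I' J' = Ninj%:R * c I J.
Proof.
move=> II JI.
have -> : \sum_I' \sum_(J' | matched I J set0 I' J') c I' J' =
    \sum_(p : {ffun D -> D}) c (reord I p) (reord J p).
  rewrite pair_big_dep /=.
  pose f p := (reord I p, reord J p).
  transitivity (\sum_(q in f @: [set: {ffun D -> D}]) c q.1 q.2).
    apply: eq_bigl => -[I' J'] /=; apply/'forall_implyP/imsetP => [H|[p _ [-> ->]] l _].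
      have H' l : exists r, I' l = I r /\ J' l = J r.
        have lT : l \in ~: (set0 : {set D}) by rewrite !inE.
        by have /existsP[r /andP[/eqP -> /eqP ->]] := H l lT; exists r.
      have [p pP] := fin_all_exists H'; exists [ffun l => p l]; first by rewrite inE.
      by rewrite /f; congr (_, _); apply/ffunP => l; rewrite !ffunE; have [] := pP l.
    by apply/existsP; exists (p l); rewrite !ffunE !eqxx.
  rewrite big_imset /=; first by apply: eq_bigl => p; rewrite inE.
  by move=> p p' _ _ [/(reord_injr II)].
rewrite (bigID (fun p : {ffun D -> D} => injectiveb p)) /= [X in _ + X]big1 ?addr0.
  rewrite (eq_bigr (fun=> c I J)) => [|p]; last exact: c_sym.
  rewrite sumr_const -[LHS]mulr_natl; congr (_%:R * _).
  by apply: eq_card => p; rewrite inE.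
by move=> p pI; apply: c0l; apply: contra pI; exact: reord_injective.
Qed.

Let error_term (I J : tup) (T : {set D}) : injectiveb I -> injectiveb J ->
  `|\sum_I' \sum_(J' | in_range I J T I' J' && matched I J T I' J') c I' J'| <=
  \sum_p \sum_p' `|c (reord I p) (reord J p')|.
Proof.
move=> II JI; apply: le_trans (ler_norm_sum _ _ _) _.
apply: (@le_trans _ _ (\sum_I' \sum_(J' | in_range I J T I' J' && matched I J T I' J') `|c I' J'|)).
  by apply: ler_sum => I' _; exact: ler_norm_sum.
rewrite pair_big_dep [leRHS]pair_big /=.
pose f (q : {ffun D -> D} * {ffun D -> D}) := (reord I q.1, reord J q.2).
have -> : \sum_(q : {ffun D -> D} * {ffun D -> D}) `|c (reord I q.1) (reord J q.2)| =
    \sum_(q in f @: [set: {ffun D -> D} * {ffun D -> D}]) `|c q.1 q.2|.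
  rewrite big_imset /=; first by apply: eq_bigl => q; rewrite inE.
  by move=> [p p'] [r r'] _ _ [/(reord_injr II) -> /(reord_injr JI) ->].
rewrite big_mkcond [leRHS]big_mkcond; apply: ler_sum => -[I' J'] _ /=.
case: ifP => [/andP[h1 h2]|_]; last by case: ifP.
have [p [p' [-> ->]]] := in_range_matched h1 h2.
by rewrite (imset_f f (in_setT (p, p'))).
Qed.

(* The term [T = set0] of [sum_synth_umvirate] dominates: the others carry
   factorials smaller by a factor [n - d]. *)
Lemma synth_energy_gap :
  `|\sum_(x : 'S_n) synth c x ^+ 2 - (n - d)`!%:R * (Ninj%:R * S)| <=
  2^-1 * (n - d)`!%:R * S.
Proof.
have E1 : \sum_(x : 'S_n) synth c x ^+ 2 - (n - d)`!%:R * (Ninj%:R * S) =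
    \sum_I \sum_J c I J * (\sum_(x | act x I == J) synth c x - (n - d)`!%:R * (Ninj%:R * c I J)).
  under eq_bigr do rewrite expr2.
  rewrite sum_synth /S !mulr_sumr -sumrB; apply: eq_bigr => I _.
  rewrite !mulr_sumr -sumrB; apply: eq_bigr => J _; ring.
rewrite E1; apply: le_trans (ler_norm_sum _ _ _) _.
pose F := (n - d).-1`!%:R : R.
have dn : (0 < n - d)%N.
  rewrite subn_gt0; apply: leq_trans n_large; rewrite -[X in (X < _)%N]add0n ltn_add2r.
  have N0 : (0 < N)%N by apply/card_gt0P; exists [ffun l => l].
  by rewrite !muln_gt0 !expn_gt0 N0.
have F0 : 0 <= F by rewrite ler0n.
have fE : (n - d)`!%:R = (n - d)%:R * F :> R by rewrite -natrM -{1 2}(prednK dn) factS.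
have point I J : `|c I J * (\sum_(x | act x I == J) synth c x - (n - d)`!%:R * (Ninj%:R * c I J))| <=
    \sum_(T : {set D}) F * \sum_p \sum_p' `|c I J| * `|c (reord I p) (reord J p')|.
  have rhs0 : 0 <= \sum_(T : {set D}) F * \sum_p \sum_p' `|c I J| * `|c (reord I p) (reord J p')|.
    by apply: sumr_ge0 => T _; rewrite mulr_ge0 // sumr_ge0 // => p _; apply: sumr_ge0 => p' _; rewrite mulr_ge0.
  have [II|/(c0l J) cz] := boolP (injectiveb I); last by rewrite {1}cz mul0r normr0.
  have [JI|/(c0r I) cz] := boolP (injectiveb J); last by rewrite {1}cz mul0r normr0.
  rewrite sum_synth_umvirate // (bigD1 set0) //= cards0 addn0.
  have -> : \sum_I' \sum_(J' | in_range I J set0 I' J' && matched I J set0 I' J') c I' J' =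
      Ninj%:R * c I J.
    rewrite -main_term //; apply: eq_bigr => I' _; apply: eq_bigl => J'.
    rewrite /in_range (_ : [forall l in set0, _] = true) /=; last by apply/'forall_implyP => l; rewrite inE.
    by rewrite (_ : [forall l in set0, _] = true) //; apply/'forall_implyP => l; rewrite inE.
  rewrite addrAC subrr add0r normrM.
  apply: (@le_trans _ _ (`|c I J| * \sum_(T : {set D} | T != set0) F *
      \sum_p \sum_p' `|c (reord I p) (reord J p')|)).
    rewrite ler_wpM2l //; apply: le_trans (ler_norm_sum _ _ _) _.
    apply: ler_sum => T T0; rewrite normrM ger0_norm ?ler0n //.
    apply: ler_pM => //; last exact: error_term.
    rewrite ler_nat; apply: leq_fact; rewrite subnDA -subn1 leq_sub2l //.
    by rewrite card_gt0.
  rewrite mulr_sumr [leRHS](bigID (fun T : {set D} => T != set0)) /=.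
  apply: (@le_trans _ _ (\sum_(T : {set D} | T != set0) F * \sum_p \sum_p' `|c I J| * `|c (reord I p) (reord J p')|)).
    apply: ler_sum => T _; rewrite mulrCA ler_wpM2l // mulr_sumr.
    by apply: ler_sum => p _; rewrite mulr_sumr.
  rewrite lerDl; apply: sumr_ge0 => T _; rewrite mulr_ge0 // sumr_ge0 // => p _.
  by apply: sumr_ge0 => p' _; rewrite mulr_ge0.
apply: (@le_trans _ _ (\sum_I \sum_J \sum_(T : {set D}) F * \sum_p \sum_p' `|c I J| * `|c (reord I p) (reord J p')|)).
  apply: ler_sum => I _; apply: le_trans (ler_norm_sum _ _ _) _.
  by apply: ler_sum => J _; exact: point.
apply: (@le_trans _ _ (\sum_(T : {set D}) F * \sum_(p : {ffun D -> D}) \sum_(p' : {ffun D -> D}) S)).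
  under eq_bigr do rewrite exchange_big /=.
  rewrite exchange_big /=; apply: ler_sum => T _.
  under eq_bigr do rewrite -mulr_sumr exchange_big /=.
  rewrite -mulr_sumr exchange_big /= ler_wpM2l //; apply: ler_sum => p _.
  under eq_bigr do rewrite exchange_big /=.
  by rewrite exchange_big /=; apply: ler_sum => p' _; exact: cross.
have cD : #|{set D}| = (2 ^ d)%N by rewrite -cardsT -powersetT card_powerset cardsT.
have -> : \sum_(p : {ffun D -> D}) \sum_(p' : {ffun D -> D}) S = (N * N)%:R * S.
  by rewrite !sumr_const -mulrnA -[LHS]mulr_natl.
rewrite sumr_const cD -[leLHS]mulr_natl fE.
(* The error has [2 ^ d] sets [T] and [N * N] pairs of reorderings; [n_large] makes their total at
   most half of [(n - d)! * S]. *)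
have nN : 2 * (2 ^ d)%:R * (N * N)%N%:R <= (n - d)%:R :> R.
  by rewrite -!natrM ler_nat leq_subRL; [rewrite addnC mulnn | apply: leq_trans n_large; exact: leq_addl].
have := ler_wpM2r (mulr_ge0 F0 S_ge0) nN; set t := (2 ^ d)%:R; set u := (N * N)%:R; set v := (n - d)%:R.
have -> : 2 * t * u * (F * S) = 2 * (t * (F * (u * S))) by ring.
have -> : 2^-1 * (v * F) * S = 2^-1 * (v * (F * S)) by ring.
lra.
Qed.

Lemma synth_energy_ge :
  2^-1 * (n - d)`!%:R * S <= \sum_(x : 'S_n) synth c x ^+ 2.
Proof.
have := synth_energy_gap; rewrite ler_norml => /andP[h _].
have N1 : 1 <= Ninj%:R :> R by rewrite ler1n.
have f0 : 0 <= (n - d)`!%:R :> R by rewrite ler0n.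
have := ler_wpM2l f0 (ler_wpM2r S_ge0 N1); rewrite mul1r; lra.
Qed.

Lemma synth_energy_le :
  \sum_(x : 'S_n) synth c x ^+ 2 <= (N.+1)%:R * (n - d)`!%:R * S.
Proof.
have := synth_energy_gap; rewrite ler_norml => /andP[_ h].
have N1 : Ninj%:R <= N%:R :> R by rewrite ler_nat max_card.
have f0 : 0 <= (n - d)`!%:R :> R by rewrite ler0n.
have := ler_wpM2l f0 (ler_wpM2r S_ge0 N1); have := mulr_ge0 f0 S_ge0.
rewrite -[N.+1]addn1 natrD; lra.
Qed.

End Energy.

(** * Umvirate sums as coefficients *)

Section Coefficients.

Variables (R : rcfType) (n : nat) (D : finType).
Local Notation tup := {ffun D -> 'I_n}.
Let d := #|D|.

(* Orthogonality to all umvirates that prescribe the coordinates other than [l]. *)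
Definition lowfree (h : 'S_n -> R) := forall l (I J : tup), injectiveb I ->
  \sum_(x | agreeb [set~ l] (act x I) J) h x = 0.

(** By [sum_synth] this is the adjoint of [synth], cut down to injective tuples. *)
Definition ucoef (h : 'S_n -> R) (I J : tup) : R :=
  (injectiveb I)%:R * \sum_(x | act x I == J) h x.

(** Summing over a line removes one prescribed image and leaves a sum that [lowfree] kills. *)
Lemma ucoef_bipure h : lowfree h -> bipure (ucoef h).
Proof.
have zeroJ (I J : tup) : ~~ injectiveb J -> ucoef h I J = 0.
  move=> JI; rewrite /ucoef; case: (boolP (injectiveb I)) => II; last by rewrite mul0r.
  rewrite big_pred0 ?mulr0 // => x; apply: contraNF JI => /eqP <-.
  by rewrite injectiveb_act.
have line l (I J : tup) (x : 'S_n) k : (act x I == upd J l k) =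
    agreeb [set~ l] (act x I) J && (k == x (I l)).
  apply/eqP/andP => [E|[/agreebP E /eqP ->]].
    split; last by rewrite -(actE x I) E upd_eq.
    by apply/agreebP => m; rewrite !inE E updE => /negbTE ->.
  apply/ffunP => m; rewrite updE; case: eqP => [->|/eqP ml]; first by rewrite actE.
  by rewrite E // !inE.
move=> hl; split=> [I|J]; split.
- exact: zeroJ.
- move=> l J; rewrite /ucoef -mulr_sumr; have [II|II] := boolP (injectiveb I); last by rewrite mul0r.
  rewrite mul1r -[RHS](hl l I J II) [RHS]big_mkcond.
  rewrite (eq_bigr _ (fun k _ => big_mkcond _ _)).
  rewrite exchange_big; apply: eq_bigr => x _ /=.
  under eq_bigr do rewrite line.
  case: agreeb; last by rewrite big1.
  by rewrite -big_mkcond /= big_pred1_eq.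
- by move=> I /negbTE II; rewrite /ucoef II mul0r.
move=> l I; have [JI|JI] := boolP (injectiveb J); last first.
  by apply: big1 => k _; exact: zeroJ.
have lineI (x : 'S_n) k : (act x (upd I l k) == J) =
    agreeb [set~ l] (act x I) J && (k == x^-1%g (J l)).
  apply/eqP/andP => [E|[/agreebP E /eqP ->]].
    split; last by rewrite -E act_upd upd_eq permK.
    apply/agreebP => m; rewrite !inE -E !actE updE => /negbTE ->.
    by [].
  rewrite act_upd permKV; apply/ffunP => m; rewrite updE; case: eqP => [-> //|/eqP ml].
  by rewrite E // !inE.
have -> : \sum_k ucoef h (upd I l k) J = \sum_(x | agreeb [set~ l] (act x I) J) h x.
  have E k : ucoef h (upd I l k) J = \sum_(x | act x (upd I l k) == J) h x.
    rewrite /ucoef; case: (boolP (injectiveb _)) => kI; first by rewrite mul1r.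
    rewrite mul0r big_pred0 // => x; apply: contraNF kI => /eqP E.
    by rewrite -(injectiveb_act x) E.
  rewrite (eq_bigr _ (fun k _ => E k)) (eq_bigr _ (fun k _ => big_mkcond _ _)).
  rewrite exchange_big [RHS]big_mkcond; apply: eq_bigr => x _ /=.
  under eq_bigr do rewrite lineI.
  case: agreeb; last by rewrite big1.
  by rewrite -big_mkcond /= big_pred1_eq.
have [x0 /agreebP x0P|none] := pickP (fun x : 'S_n => agreeb [set~ l] (act x I) J); last first.
  by rewrite big_pred0.
(* The tuple [I] itself need not be injective, as its entry at [l] is arbitrary; [I0] agrees with it
   elsewhere and is injective because [J] is. *)
pose I0 := act x0^-1%g J.
have I0I : injectiveb I0 by rewrite injectiveb_act.
rewrite -[RHS](hl l I0 J I0I); apply: eq_bigl => x.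
have I0E m : m \in [set~ l] -> I0 m = I m.
  by move=> ml; rewrite actE -(x0P _ ml) actE permK.
by apply/agreebP/agreebP => H m ml; rewrite -(H m ml) !(actE x) I0E.
Qed.

Lemma ucoef_sym h I J (p : {ffun D -> D}) : injectiveb p ->
  ucoef h (reord I p) (reord J p) = ucoef h I J.
Proof.
move=> pI; have /injectiveP pI' := pI.
have E (K : tup) m : K m = reord K p (invF pI' m) by rewrite ffunE f_invF.
have Einj : injectiveb (reord I p) = injectiveb I.
  apply/injectiveP/injectiveP => H l m; last by rewrite !ffunE => /H /pI'.
  by rewrite (E I l) (E I m) => /H /(can_inj (f_invF pI')).
rewrite /ucoef Einj; congr (_ * _); apply: eq_bigl => x; apply/eqP/eqP => [H|<-]; last by apply/ffunP => l; rewrite !ffunE.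
by apply/ffunP => m; rewrite (E J m) -H !actE (E I m).
Qed.

Definition averaged (A : {set 'S_n}) (c : tup -> tup -> R) (I J : tup) : R :=
  avgA A (fun a => c I (act a J)).

Lemma averaged_bipure A c : bipure c -> bipure (averaged A c).
Proof.
move=> [c1 c2]; split=> [I|J]; first exact: avgA_pure.
split=> [I II|l I].
  by rewrite /averaged /avgA big1 ?mul0r // => a _; rewrite (proj1 (c2 _)).
by rewrite /averaged sum_avgA /avgA big1 ?mul0r // => a _; rewrite (proj2 (c2 _)).
Qed.

Lemma averaged_sym A c (I J : tup) (p : {ffun D -> D}) :
  (forall I J, c (reord I p) (reord J p) = c I J) ->
  averaged A c (reord I p) (reord J p) = averaged A c I J.
Proof.
move=> cs; congr (_ / _); apply: eq_bigr => a _.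
rewrite -(cs I (act a J)); congr (c _ _).
by apply/ffunP => l; rewrite !ffunE.
Qed.

Lemma synth_averaged A c x :
  synth (averaged A c) x = avgA A (fun a => synth c (x * a)%g).
Proof.
rewrite /synth /averaged sum_avgA; congr (_ / _); apply: eq_bigr => a _.
by apply: eq_bigr => I _; rewrite actM.
Qed.

Hypothesis n_large : (2 * 2 ^ d * #|{ffun D -> D}| ^ 2 + d <= n)%N.

(** Averaging acts on the second argument of [c] only, so [op] applies to each row, and the energy
    bounds carry the estimate from coefficients to functions. *)
Lemma averaging_norm (A : {set 'S_n}) (c : tup -> tup -> R) (op : R) :
  bipure c -> (forall I J (p : {ffun D -> D}), injectiveb p ->
    c (reord I p) (reord J p) = c I J) -> 0 <= op ->
  (forall phi : tup -> R, pure phi ->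
     \sum_J avgA A (fun a => phi (act a J)) ^+ 2 <= op * \sum_J phi J ^+ 2) ->
  \sum_(x : 'S_n) avgA A (fun a => synth c (x * a)%g) ^+ 2 <=
  2 * (#|{ffun D -> D}|.+1)%:R * op * \sum_(x : 'S_n) synth c x ^+ 2.
Proof.
move=> cP cs op0 opP.
have acs I J (p : {ffun D -> D}) : injectiveb p ->
    averaged A c (reord I p) (reord J p) = averaged A c I J.
  by move=> pI; apply: averaged_sym => *; exact: cs.
have up := synth_energy_le (averaged_bipure A cP) acs n_large.
have low := synth_energy_ge cP cs n_large.
under eq_bigr do rewrite -synth_averaged.
apply: le_trans up _.
have f0 : 0 <= (n - d)`!%:R :> R by rewrite ler0n.
have N0 : 0 <= (#|{ffun D -> D}|.+1)%:R :> R by rewrite ler0n.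
apply: (@le_trans _ _ ((#|{ffun D -> D}|.+1)%:R * (n - d)`!%:R *
    (op * \sum_I \sum_J c I J ^+ 2))).
  rewrite ler_wpM2l ?mulr_ge0 // mulr_sumr; apply: ler_sum => I _.
  by apply: opP; exact: (proj1 cP).
have := ler_wpM2l (mulr_ge0 N0 op0) low.
set S := \sum_I _; set Q := \sum_x _ ^+ 2; set N := _.+1%:R; set F := _`!%:R.
have -> : N * op * (2^-1 * F * S) = 2^-1 * (N * F * (op * S)) by ring.
have -> : 2 * N * op * Q = 2 * (N * op * Q) by ring.
lra.
Qed.

End Coefficients.

(** * The spaces of the theorem *)

Section Umvirates.

Variables (R : realType) (n : nat).
Local Notation tup m := {ffun 'I_m -> 'I_n}.

Definition tupf m (I : tup m) : m.-tuple 'I_n := [tuple I l | l < m].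

Lemma tupf_uniq m (I : tup m) : uniq (tupf I) = injectiveb I.
Proof. by rewrite /injectiveb /dinjectiveb /tupf /= enumT. Qed.

Lemma tupf_surj m (t : m.-tuple 'I_n) : exists I, t = tupf I.
Proof.
exists [ffun l => tnth t l]; apply: eq_from_tnth => l.
by rewrite tnth_mktuple ffunE.
Qed.

Lemma mem_umvirate m (I J : tup m) x :
  (x \in umvirate (tupf I) (tupf J)) = (act x I == J).
Proof.
rewrite inE; apply/forallP/eqP => [H|<- l].
  by apply/ffunP => l; have := H l; rewrite !tnth_mktuple actE => /eqP.
by rewrite !tnth_mktuple actE.
Qed.

Lemma W_indicator m (I J : tup m) : injectiveb I -> injectiveb J ->
  indicator R (umvirate (tupf I) (tupf J)) \in W R n m.
Proof.
move=> II JI; rewrite memvE /W (sumv_sup (tupf I)) ?tupf_uniq //.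
by rewrite (sumv_sup (tupf J)) ?tupf_uniq.
Qed.

Lemma W_orth m (g w : L2fun R n) :
  (forall I J : tup m, injectiveb I -> injectiveb J ->
     \sum_(x | act x I == J) (g x : R) = 0) ->
  w \in W R n m -> \sum_x (w x : R) * g x = 0.
Proof.
move=> g0 /memv_sumP[v vW ->].
have z (I : m.-tuple 'I_n) : uniq I -> \sum_x (v I x : R) * g x = 0.
  move=> uI; have /memv_sumP[u uW ->] := vW I uI.
  under eq_bigr do rewrite sum_ffunE mulr_suml.
  rewrite exchange_big big1 //= => J uJ.
  have /vlineP[k ->] := uW J uJ.
  have [I' IE] := tupf_surj I; have [J' JE] := tupf_surj J; subst I J.
  under eq_bigr do rewrite !ffunE mem_umvirate -mulrA.
  rewrite -mulr_sumr; have -> : \sum_x (act x I' == J')%:R * (g x : R) =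
      \sum_(x | act x I' == J') (g x : R).
    by rewrite [RHS]big_mkcond; apply: eq_bigr => x _; case: eqP; rewrite ?mul1r ?mul0r.
  by rewrite g0 ?mulr0 // -tupf_uniq.
under eq_bigr do rewrite sum_ffunE mulr_suml.
by rewrite exchange_big big1 //= => I /z.
Qed.

Lemma synth_in_W m (c : tup m -> tup m -> R) : bipure c ->
  ([ffun x => synth c x] : L2fun R n) \in W R n m.
Proof.
move=> [c1 c2].
have -> : ([ffun x => synth c x] : L2fun R n) =
    \sum_I \sum_J (c I J : R) *: indicator R (umvirate (tupf I) (tupf J)).
  apply/ffunP => x; rewrite ffunE sum_ffunE; apply: eq_bigr => I _.
  rewrite sum_ffunE (bigD1 (act x I)) //= big1 ?addr0.
    by rewrite !ffunE mem_umvirate eqxx /= [RHS]mulr1.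
  by move=> J; rewrite !ffunE mem_umvirate eq_sym => /negbTE ->; rewrite [LHS]mulr0.
apply: memv_suml => I _; apply: memv_suml => J _.
have [II|/(proj1 (c2 J)) ->] := boolP (injectiveb I); last by rewrite scale0r mem0v.
have [JI|/(proj1 (c1 I)) ->] := boolP (injectiveb J); last by rewrite scale0r mem0v.
by rewrite memvZ // W_indicator.
Qed.

(** Packaged as a linear map, so that orthogonality to lower umvirates becomes a kernel and
    dimensions can be compared. *)
Definition umvirate_sums m (h : {ffun 'S_n -> R^o}) : {ffun tup m * tup m -> R^o} :=
  [ffun p : tup m * tup m => (injectiveb p.1 && injectiveb p.2)%:R * \sum_(x | act x p.1 == p.2) (h x : R)].

Lemma umvirate_sums_linear m : linear (@umvirate_sums m).
Proof.
move=> k u v; apply/ffunP => p; rewrite !ffunE.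
under eq_bigr do rewrite !ffunE.
rewrite big_split /= -mulr_sumr mulrDr; congr (_ + _); exact: mulrCA.
Qed.

HB.instance Definition _ m := GRing.isLinear.Build R {ffun 'S_n -> R^o}
  {ffun tup m * tup m -> R^o} _ (@umvirate_sums m) (@umvirate_sums_linear m).

Definition resynth m (h : {ffun 'S_n -> R^o}) : {ffun 'S_n -> R^o} :=
  [ffun x => synth (@ucoef R n 'I_m h) x].

Lemma resynth_linear m : linear (@resynth m).
Proof.
move=> k u v; apply/ffunP => x; rewrite !ffunE /synth.
have E I J : @ucoef R n 'I_m (k *: u + v) I J = k * @ucoef R n 'I_m u I J + @ucoef R n 'I_m v I J.
  rewrite /ucoef; under eq_bigr do rewrite !ffunE.
  by rewrite big_split /= -mulr_sumr mulrDr mulrCA.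
under eq_bigr do rewrite E.
by rewrite big_split /= -mulr_sumr.
Qed.

HB.instance Definition _ m := GRing.isLinear.Build R {ffun 'S_n -> R^o}
  {ffun 'S_n -> R^o} _ (@resynth m) (@resynth_linear m).

Variable d : nat.

Definition pureW : {vspace {ffun 'S_n -> R^o}} :=
  (W R n d.+1 :&: lker (linfun (@umvirate_sums d)))%VS.

Lemma pureWP h : reflect (h \in W R n d.+1 /\
    forall I J : tup d, injectiveb I -> injectiveb J ->
      \sum_(x | act x I == J) (h x : R) = 0) (h \in pureW).
Proof.
rewrite memv_cap memv_ker lfunE /=; apply: (iffP andP) => -[hW h0]; split=> //.
  move=> I J II JI; have /eqP/ffunP/(_ (I, J)) := h0.
  by rewrite !ffunE /= II JI mul1r.
apply/eqP/ffunP => -[I J]; rewrite !ffunE /=.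
case II : (injectiveb I); last by rewrite mul0r.
by case JI : (injectiveb J); rewrite ?mul0r // h0 // mulr0.
Qed.

Lemma pureW_lowfree h : h \in pureW -> @lowfree R n 'I_d.+1 h.
Proof.
move=> /pureWP[_ h0] l I J /injectiveP II.
pose I' : tup d := [ffun i => I (lift l i)].
pose J' : tup d := [ffun i => J (lift l i)].
have E x : agreeb [set~ l] (act x I) J = (act x I' == J').
  apply/agreebP/eqP => [H|/ffunP H m].
    by apply/ffunP => i; rewrite !ffunE -H ?actE // !inE eq_sym neq_lift.
  rewrite !inE => ml; have [i -> |ml'] := unliftP l m; last by rewrite ml' eqxx in ml.
  by have := H i; rewrite !ffunE.
rewrite (eq_bigl _ _ E); have [J'I|J'I] := boolP (injectiveb J').
  by apply: h0 => //; apply/injectiveP => i j; rewrite !ffunE => /II /lift_inj.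
rewrite big_pred0 // => x; apply: contraNF J'I => /eqP <-.
rewrite injectiveb_act; apply/injectiveP => i j.
by rewrite !ffunE => /II /lift_inj.
Qed.

Lemma resynth_pureW h : h \in pureW -> resynth d.+1 h \in pureW.
Proof.
move=> hU; have cP := ucoef_bipure (pureW_lowfree hU).
apply/pureWP; split; first exact: synth_in_W.
move=> I J II JI; under eq_bigr do rewrite ffunE.
by apply: synth_low => //; rewrite !card_ord.
Qed.

(** By adjointness, pairing [resynth d.+1 h] with [h] gives the sum of the squared coefficients. If
    it vanishes, [h] is orthogonal to [W R n d.+1], which contains it. *)
Lemma resynth_inj h : h \in pureW -> resynth d.+1 h = 0 -> h = 0.
Proof.
move=> /pureWP[hW _] /ffunP r0.
pose c := @ucoef R n 'I_d.+1 h.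
have : \sum_I \sum_J c I J ^+ 2 = 0.
  have E : \sum_x synth c x * (h x : R) = 0.
    by apply: big1 => x _; have := r0 x; rewrite !ffunE => ->; rewrite mul0r.
  rewrite -[RHS]E sum_synth; apply: eq_bigr => I _; apply: eq_bigr => J _.
  by rewrite /c /ucoef; case: injectiveb; rewrite /= ?mul1r ?mul0r ?expr2 ?mul0r.
have sq I J : 0 <= c I J ^+ 2 by exact: sqr_ge0.
move=> /eqP; rewrite psumr_eq0 => [/allP c0|I _]; last exact: sumr_ge0.
have hh : \sum_x (h x : R) * h x = 0.
  apply: W_orth hW => I J II JI.
  have := c0 I (mem_index_enum _); rewrite /= psumr_eq0 // => /allP /(_ J (mem_index_enum _)).
  by rewrite /= sqrf_eq0 /c /ucoef II mul1r => /eqP.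
apply/ffunP => x; rewrite ffunE; apply/eqP.
move/eqP: hh; rewrite psumr_eq0 => [/allP /(_ x (mem_index_enum _))|y _].
  by rewrite /= mulf_eq0 orbb.
by rewrite -expr2 sqr_ge0.
Qed.

(* [resynth] is an injective endomorphism of the finite-dimensional space [pureW]. *)
Lemma pureW_synth f : f \in pureW -> exists c : tup d.+1 -> tup d.+1 -> R,
  [/\ bipure c,
      forall I J (p : {ffun 'I_d.+1 -> 'I_d.+1}), injectiveb p ->
        c (reord I p) (reord J p) = c I J &
      forall x, f x = synth c x].
Proof.
move=> fU; pose F := linfun (@resynth d.+1).
have FU : (F @: pureW <= pureW)%VS.
  apply/subvP => _ /memv_imgP[h hU ->]; rewrite lfunE /=; exact: resynth_pureW.
have F0 : (pureW :&: lker F)%VS = 0%VS.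
  apply/eqP; rewrite -subv0; apply/subvP => h; rewrite memv_cap memv_ker lfunE /=.
  by move=> /andP[hU /eqP h0]; rewrite memv0; apply/eqP; exact: resynth_inj hU h0.
have FE : (F @: pureW)%VS = pureW.
  by apply/eqP; rewrite eqEdim FU /= -(limg_ker_dim F pureW) F0 dimv0.
move: fU; rewrite -{1}FE => /memv_imgP[h hU ->]; rewrite lfunE /=.
exists (@ucoef R n 'I_d.+1 h); split.
- exact: ucoef_bipure (pureW_lowfree hU).
- by move=> I J p; exact: ucoef_sym.
- by move=> x; rewrite ffunE.
Qed.

Lemma Veq_pureW (f : L2fun R n) : (0 < n)%N -> Veq d.+1 f -> f \in pureW.
Proof.
move=> n0 [fW /(_ isT) f0]; apply/pureWP; split=> // I J II JI.
have := f0 _ (W_indicator II JI); rewrite /inner /expect => /eqP.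
rewrite mulf_eq0 invr_eq0 pnatr_eq0 cardsT card_Sn -leqn0 leqNgt fact_gt0 orbF => /eqP E.
rewrite -[RHS]E big_mkcond; apply: eq_big => [x|x _]; first by rewrite inE.
by rewrite ffunE mem_umvirate; case: eqP; rewrite ?mulr1 ?mulr0.
Qed.

End Umvirates.

Section LevelNorm.

Variables (R : realType) (n : nat).

Lemma norm2_sq (f : L2fun R n) :
  norm2 f = Num.sqrt ((\sum_x (f x : R) ^+ 2) / n`!%:R).
Proof.
rewrite /norm2 /inner /expect cardsT card_Sn; congr (Num.sqrt (_ / _)).
by apply: eq_big => x; rewrite ?inE ?expr2.
Qed.

Lemma level_norm_le d (A : {set 'S_n}) (op B : R) :
  (0 < d)%N -> (0 < n)%N -> (2 * 2 ^ d * #|{ffun 'I_d -> 'I_d}| ^ 2 + d <= n)%N ->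
  0 <= op -> 0 <= B ->
  (forall phi : {ffun 'I_d -> 'I_n} -> R, pure phi ->
     \sum_J avgA A (fun a => phi (act a J)) ^+ 2 <= op * \sum_J phi J ^+ 2) ->
  2 * (#|{ffun 'I_d -> 'I_d}|.+1)%:R * op <= B ^+ 2 ->
  (level_norm R d A <= B%:E)%E.
Proof.
case: d => // d _ n0 nl op0 B0 opP opB; apply: ge_ereal_sup => _ [f [fV /eqP f0] <-].
rewrite lee_fin.
have [c [cP cs fc]] := pureW_synth (Veq_pureW n0 fV).
have f2 : 0 < \sum_x (f x : R) ^+ 2.
  rewrite lt_def sumr_ge0 ?andbT => [|x _]; last exact: sqr_ge0.
  apply: contra f0 => /eqP; move=> /psumr_eq0P z; apply/eqP/ffunP => x; rewrite ffunE.
  have /eqP := z (fun x _ => sqr_ge0 (f x : R)) x isT; by rewrite sqrf_eq0 => /eqP.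
have fp : (0 : R) < n`!%:R by rewrite ltr0n fact_gt0.
have nf : 0 < norm2 f by rewrite norm2_sq sqrtr_gt0 divr_gt0.
have BE : B = Num.sqrt (B ^+ 2) by rewrite sqrtr_sqr ger0_norm.
rewrite ler_pdivrMr // !norm2_sq {1}BE -sqrtrM ?sqr_ge0 //.
rewrite ler_sqrt ?mulr_ge0 ?sqr_ge0 // ?divr_ge0 ?(ltW f2) ?ler0n //.
rewrite mulrA ler_wpM2r ?invr_ge0 ?ler0n //.
have nl' : (2 * 2 ^ #|'I_d.+1| * #|{ffun 'I_d.+1 -> 'I_d.+1}| ^ 2 + #|'I_d.+1| <= n)%N.
  by rewrite card_ord.
have := averaging_norm nl' cP cs op0 opP.
have -> : \sum_(x : 'S_n) synth c x ^+ 2 = \sum_x (f x : R) ^+ 2.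
  by apply: eq_bigr => x _; rewrite fc.
have -> : \sum_x (Top A f x : R) ^+ 2 =
    \sum_(x : 'S_n) avgA A (fun a => synth c (x * a)%g) ^+ 2.
  apply: eq_bigr => x _; rewrite ffunE /expect /avgA; congr ((_ / _) ^+ 2).
  by apply: eq_bigr => a _; rewrite fc.
move/le_trans; apply; by rewrite ler_wpM2r // ltW.
Qed.

End LevelNorm.

(** * Consequences of globalness *)

Section Global.

Variables (R : realType) (n t : nat) (K : R) (A : {set 'S_n}).
Hypothesis tn : (t <= n)%N.
Hypothesis glob : relatively_global t K A.

Let agr (X : {set 'I_n}) (y : 'S_n) := [set s : 'S_n | [forall i in X, s i == y i]].

Let card_agr X y : #|agr X y| = (n - #|X|)`!.
Proof. by apply: card_agree => i j _ _ // /perm_inj. Qed.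

Lemma superset_card (X : {set 'I_n}) m : (#|X| <= m <= n)%N ->
  exists2 X' : {set 'I_n}, X \subset X' & #|X'| = m.
Proof.
move=> /andP[Xm]; elim: m Xm => [|m IH] Xm mn.
  by exists X => //; apply/eqP; rewrite -leqn0.
have [Xe|Xlt] := eqVneq #|X| m.+1; first by exists X.
have [|X' XX' X'm] := IH _ (ltnW mn); first by rewrite -ltnS ltn_neqAle Xlt.
have : (0 < #|~: X'|)%N by rewrite cardsCs setCK card_ord X'm subn_gt0.
move=> /card_gt0P[i iX']; exists (i |: X').
  by apply: subset_trans XX' (subsetUr _ _).
by rewrite cardsU1 -X'm; rewrite inE in iX'; rewrite iX'.
Qed.

(** Fewer than [t] conditions are handled by averaging over all ways to extend them to [t]
    conditions. *)
Lemma global_density (X : {set 'I_n}) y : (#|X| <= t)%N ->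
  (#|A :&: agr X y|)%:R <= K * mu R A * (n - #|X|)`!%:R.
Proof.
move=> Xt; have [X' XX' X't] := @superset_card X t (introT andP (conj Xt tn)).
have full x : (#|A :&: agr X' x|)%:R <= K * mu R A * (n - t)`!%:R.
  pose e := enum X'; have se : size e == t by rewrite -cardE X't.
  pose I := Tuple se; pose J := map_tuple x I.
  have uI : uniq I by exact: enum_uniq.
  have uJ : uniq J by rewrite /= map_inj_uniq //; exact: perm_inj.
  have E : umvirate I J = agr X' x.
    apply/setP => s; rewrite !inE; apply/forallP/'forall_implyP => [H i iX'|H l].
      have ie : i \in I by rewrite /= mem_enum.
      have /tnthP[l il] := ie; have := H l.
      by rewrite -il tnth_map -il.
    rewrite tnth_map; apply: H; have := mem_tnth l I; by rewrite /= mem_enum.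
  have := glob uI uJ; rewrite E /density card_agr X't.
  by rewrite ler_pdivrMr // ltr0n fact_gt0.
have fp : (0 : R) < (n - t)`!%:R by rewrite ltr0n fact_gt0.
rewrite -(ler_pM2r fp).
(* Double counting: each [a] lies in [agr X' x] for exactly [(n - t)!] permutations [x], all of
   which agree with [y] on [X]. *)
have -> : #|A :&: agr X y|%:R * (n - t)`!%:R =
    \sum_(x in agr X y) (#|A :&: agr X' x|)%:R :> R.
  transitivity (\sum_(a in A :&: agr X y) (n - t)`!%:R : R).
    by rewrite sumr_const -[RHS]mulr_natl.
  transitivity (\sum_(a in A) \sum_(x in agr X y) (a \in agr X' x)%:R : R); last first.
    rewrite exchange_big; apply: eq_bigr => x _ /=.
    rewrite -sum1_card natr_sum [RHS]big_mkcond [LHS]big_mkcond.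
    by apply: eq_bigr => a _; rewrite [a \in _ :&: _]inE; case: (a \in A); case: (a \in agr X' x).
  rewrite big_mkcond [RHS]big_mkcond; apply: eq_bigr => a _; rewrite inE.
  case: (a \in A) => //=; case: ifP => [|/negbT]; rewrite inE.
    move=> /'forall_implyP ay.
    rewrite -X't -(card_agr X' a) -sum1_card natr_sum big_mkcond [RHS]big_mkcond.
    apply: eq_bigr => x _; rewrite !inE.
    have -> : [forall i in X', a i == x i] = [forall i in X', x i == a i].
      by apply: eq_forallb => i; rewrite eq_sym.
    case: ifP => [/'forall_implyP xa|_]; last by case: ifP.
    rewrite (_ : [forall i in X, x i == y i] = true) //; apply/'forall_implyP => i iX.
    by rewrite (eqP (xa i (subsetP XX' i iX))) (eqP (ay i iX)).
  move=> nay; rewrite big1 // => x; rewrite inE => /'forall_implyP xy; rewrite inE.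
  case: 'forall_implyP => // ax; case/negP: nay; apply/'forall_implyP => i iX.
  by rewrite (eqP (ax i (subsetP XX' i iX))) (eqP (xy i iX)).
apply: (@le_trans _ _ (\sum_(x in agr X y) K * mu R A * (n - t)`!%:R)).
  by apply: ler_sum => x _; exact: full.
by rewrite sumr_const card_agr -[leLHS]mulr_natl le_eqVlt; apply/orP; left; apply/eqP; ring.
Qed.

Hypothesis A0 : (0 < #|A|)%N.

Let mu_ge0 : 0 <= mu R A. Proof. by rewrite divr_ge0 ?ler0n. Qed.

(** Apply [global_density] to the empty set of conditions. *)
Lemma global_ge1 : 1 <= K.
Proof.
have := @global_density set0 1%g; rewrite cards0 subn0 => /(_ (leq0n _)).
have -> : A :&: agr set0 1%g = A.
  by apply/setP => a; rewrite !inE andbC; case: 'forall_implyP => // -[] i; rewrite inE.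
have fp : (0 : R) < n`!%:R by rewrite ltr0n fact_gt0.
rewrite /mu /density setIT cardsT card_Sn -mulrA divfK ?lt0r_neq0 //.
by rewrite -[leLHS]mul1r ler_pM2r // ltr0n.
Qed.

Lemma global_agree (D : finType) (S : {set D}) (I J : {ffun D -> 'I_n}) :
  (0 < n)%N -> (#|D| <= t)%N -> (2 * #|D| <= n)%N -> injectiveb I ->
  avgA A (fun a => (agreeb S (act a I) J)%:R) <= 2 ^+ #|D| * K / n%:R ^+ #|S|.
Proof.
move=> n0 Dt Dn /injectiveP II.
have K0 : 0 <= K by apply: le_trans global_ge1.
have np : (0 : R) < n%:R by rewrite ltr0n.
have Ap : (0 : R) < #|A|%:R by rewrite ltr0n.
have fp : (0 : R) < n`!%:R by rewrite ltr0n fact_gt0.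
have SD : (#|S| <= #|D|)%N by exact: max_card.
have rhs0 : 0 <= 2 ^+ #|D| * K / n%:R ^+ #|S|.
  by rewrite divr_ge0 ?exprn_ge0 ?ler0n // mulr_ge0 ?exprn_ge0.
have [y /agreebP yP|none] := pickP (fun y : 'S_n => agreeb S (act y I) J); last first.
  rewrite (_ : avgA _ _ = 0) // /avgA big1 ?mul0r // => a _.
  by rewrite (none a).
pose X := I @: S.
have cX : #|X| = #|S| by rewrite card_imset.
have E a : agreeb S (act a I) J = (a \in agr X y).
  rewrite inE; apply/agreebP/'forall_implyP => [H i /imsetP[l lS ->]|H l lS].
    by have := H l lS; rewrite -(yP l lS) !actE => ->.
  by rewrite -(yP l lS) !actE; apply/eqP; apply: H; exact: imset_f.
rewrite /avgA ler_pdivrMr //.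
have -> : \sum_(a in A) (agreeb S (act a I) J)%:R = #|A :&: agr X y|%:R :> R.
  rewrite -sum1_card natr_sum big_mkcond [RHS]big_mkcond; apply: eq_bigr => a _.
  by rewrite E [a \in _ :&: _]inE; case: (a \in A); case: (a \in agr X y).
apply: le_trans (@global_density X y _) _; first by rewrite cX; lia.
have := @fact_drop_le R n n #|S| n0 (_ : n + 2 * #|S| <= 2 * n)%N.
rewrite -cX /mu /density setIT cardsT card_Sn => H.
have {}H : (n - #|X|)`!%:R <= (2 / n%:R) ^+ #|X| * n`!%:R :> R by apply: H; rewrite cX; lia.
apply: (@le_trans _ _ (K * (#|A|%:R / n`!%:R) * ((2 / n%:R) ^+ #|X| * n`!%:R))).
  by rewrite ler_wpM2l // mulr_ge0 // divr_ge0 ?ler0n.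
rewrite expr_div_n; have -> : K * (#|A|%:R / n`!%:R) * (2 ^+ #|X| / n%:R ^+ #|X| * n`!%:R) =
    2 ^+ #|X| * (K / n%:R ^+ #|X| * #|A|%:R).
  by field; rewrite expf_neq0 ?lt0r_neq0.
rewrite [leRHS](_ : _ = 2 ^+ #|D| * (K / n%:R ^+ #|X| * #|A|%:R)); last by ring.
rewrite ler_wpM2r //.
  by rewrite mulr_ge0 ?ler0n // divr_ge0 ?exprn_ge0 ?ler0n.
by rewrite ler_weXn2l ?ler1n // cX.
Qed.

End Global.

(** * Choice of parameters *)

Section Final.

Variable R : realType.

Lemma trans_conj n (A : {set 'S_n}) (D : finType) (s : 'S_n) (I J : {ffun D -> 'I_n}) :
  conj_closed A -> trans R A (act s I) (act s J) = trans R A I J.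
Proof.
move=> cA; rewrite /trans /avgA; congr (_ / _).
rewrite (reindex_inj (conjg_inj s)) /=; apply: eq_big => a.
  apply/idP/idP => [h|]; last exact: cA.
  by have := cA _ s^-1%g h; rewrite conjgK.
by move=> _; rewrite -actM -conjgC actM (inj_eq (@act_inj _ _ s)).
Qed.

Section Blocks.

Variables (n d b : nat).
Hypothesis dbn : (d * b.+1 <= n)%N.

Lemma block_subproof (l : 'I_d) (k : 'I_b.+1) : (l * b.+1 + k < n)%N.
Proof.
apply: leq_trans dbn; apply: (@leq_trans (l.+1 * b.+1)); last by rewrite leq_mul2r ltn_ord orbT.
by rewrite mulSn addnC ltn_add2r.
Qed.

Definition block (l : 'I_d) (k : 'I_b.+1) : 'I_n := Ordinal (block_subproof l k).

Lemma block_inj l m j k : block l j = block m k -> l = m /\ j = k.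
Proof.
move=> /(congr1 val) /= E.
have lm : l = m :> nat.
  have := congr1 (divn^~ b.+1) E.
  by rewrite !divnMDl // !divn_small // !addn0.
split; first exact: val_inj.
by apply: val_inj; move/eqP: E; rewrite lm eqn_add2l => /eqP.
Qed.

End Blocks.

(** As [ln 9] is at least one half and [q] at least [2 * C * ln n], the power [9 ^+ q] is at least
    [n ^ C]. *)
Lemma dense_pow n (A : {set 'S_n}) (C : R) q : (0 < n)%N ->
  n%:R `^ (- C) <= mu R A -> 2 * C * ln n%:R <= q%:R -> 0 <= C -> 0 <= ln n%:R :> R ->
  (0 < #|A|)%N /\ n`!%:R <= 9 ^+ q * #|A|%:R :> R.
Proof.
move=> n0 muA qC C0 l0; have np : (0 : R) < n%:R by rewrite ltr0n.
have fp : (0 : R) < n`!%:R by rewrite ltr0n fact_gt0.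
have pp : 0 < n%:R `^ (- C) by rewrite powR_gt0.
have muE : mu R A = #|A|%:R / n`!%:R by rewrite /mu /density setIT cardsT card_Sn.
rewrite muE in muA.
have Ap : (0 : R) < #|A|%:R.
  by have := lt_le_trans pp muA; rewrite pmulr_lgt0 // invr_gt0.
split; first by move: Ap; rewrite ltr0n.
have ln9 : 2^-1 <= ln 9 :> R.
  (* The inequality [ln (1 + x) <= x] at [x = -8/9] gives [ln 9 >= 8/9]. *)
  have := @le_ln1Dx R (- (8 / 9)); rewrite (_ : 1 + - (8 / 9) = 9^-1); last by field.
  rewrite lnV ?posrE // => /(_ _) H.
  have {}H : - ln 9 <= - (8 / 9) :> R by apply: H; lra.
  lra.
have big : 1 <= 9 ^+ q * n%:R `^ (- C).
  have -> : (9 : R) ^+ q = expR (q%:R * ln 9) by rewrite expRM_natl lnK // posrE.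
  have -> : n%:R `^ (- C) = expR (ln n%:R * - C) by rewrite expRM lnK // posrE.
  rewrite -expRD -[leLHS]expR0 ler_expR.
  have : C * ln n%:R <= q%:R * ln 9.
    apply: (@le_trans _ _ (q%:R * 2^-1)); last by rewrite ler_wpM2l ?ler0n.
    by rewrite ler_pdivlMr // mulrC mulrA.
  by rewrite mulrN (mulrC (ln _)) subr_ge0.
rewrite ler_pdivlMr // in muA.
apply: (@le_trans _ _ (9 ^+ q * (n%:R `^ (- C) * n`!%:R))); last by rewrite ler_wpM2l ?exprn_ge0.
by rewrite mulrA -[leLHS]mul1r ler_wpM2r // ltW.
Qed.

(** * Operator bounds for fixed parameters *)

Section Fixed.

Variables (n d : nat) (K : R) (A : {set 'S_n}) (q b : nat).
Hypothesis d_gt0 : (0 < d)%N.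
Hypothesis n_gt0 : (0 < n)%N.
Hypothesis n_2d : (2 * d < n)%N.
Hypothesis glob : relatively_global (2 * d) K A.
Hypothesis A0 : (0 < #|A|)%N.
Hypothesis q_gt0 : (0 < q)%N.
Hypothesis A_dense : n`!%:R <= 9 ^+ q * #|A|%:R :> R.
Hypothesis q_small : (2 * (q * d + d) <= n)%N.
Hypothesis dbn : (d * b.+1 <= n)%N.
Hypothesis b_large : (n <= 2 * d * b.+1)%N.

Let Kge1 : 1 <= K. Proof. exact: global_ge1 (ltnW n_2d) glob A0. Qed.

(** The bound of [level_inequality] for [Kg = 2 ^+ d * K], with [Kg + 1] replaced by [2 * Kg]. *)
Let HS : R := 36 * 4 ^+ d * (128 * (q * (q * d + 2))%N%:R) ^+ d * (2 ^+ d * K) / n%:R ^+ d.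

Lemma coef_block_le (s : 'S_n) :
  \sum_k \sum_J coef R A (fun l k => s (block dbn l k)) k J ^+ 2 <= HS.
Proof.
have inj l m j k : s (block dbn l j) = s (block dbn m k) -> l = m /\ j = k.
  by move=> /perm_inj /block_inj.
have Kg1 : 1 <= 2 ^+ d * K.
  by rewrite -[leLHS]mulr1 ler_pM // exprn_ege1 // ler1n.
have gl (S : {set 'I_d}) k (J : {ffun 'I_d -> 'I_n}) :
    avgA A (fun a => (agreeb S (act a (pt (fun l k => s (block dbn l k)) k)) J)%:R) <=
    2 ^+ d * K / n%:R ^+ #|S|.
  have := @global_agree R n (2 * d) K A (ltnW n_2d) glob A0 'I_d S
    (pt (fun l k => s (block dbn l k)) k) J n_gt0.
  rewrite card_ord; apply; [exact: leq_pmull | exact: ltnW |].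
  by apply/injectiveP; exact: pt_injective.
have qs : (2 * (q * #|'I_d| + #|'I_d|) <= n)%N by rewrite card_ord.
have := level_inequality A0 inj Kg1 gl q_gt0 A_dense qs n_gt0.
rewrite card_ord => /le_trans; apply.
rewrite /HS ler_wpM2r ?invr_ge0 ?exprn_ge0 ?ler0n //.
set L := (128 * _) ^+ d; have L0 : 0 <= L by rewrite exprn_ge0 // mulr_ge0 ?ler0n.
have -> : 36 * 4 ^+ d * L * (2 ^+ d * K) = 18 * 4 ^+ d * L * (2 ^+ d * K + 2 ^+ d * K) by ring.
by rewrite ler_wpM2l ?lerD2l // mulr_ge0 // mulr_ge0 ?exprn_ge0.
Qed.

Let HS_ge0 : 0 <= HS.
Proof.
apply: le_trans (coef_block_le 1%g).
by do 2![apply: sumr_ge0 => ? _]; exact: sqr_ge0.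
Qed.

Let binv : (b.+1%:R ^+ d)^-1 <= (2 * d%:R) ^+ d / n%:R ^+ d :> R.
Proof.
have bp : (0 : R) < b.+1%:R ^+ d by rewrite exprn_gt0 ?ltr0n.
have np : (0 : R) < n%:R ^+ d by rewrite exprn_gt0 ?ltr0n.
rewrite ler_pdivlMr // mulrC ler_pdivrMr // -exprMn -!natrM.
by rewrite lerXn2r ?nnegrE ?ler0n // ler_nat.
Qed.

Let op_gen := 2 * (2 * d%:R) ^+ d * HS.
Let op_conj := 4 ^+ d * ((2 * d%:R) ^+ d / n%:R ^+ d) * HS * #|{ffun 'I_d -> 'I_d}|%:R ^+ 2.

Hypothesis mass : 2 ^+ d * (2 * d%:R / (n%:R - 2 * d%:R) + b.+1%:R^-1) <= 2^-1 :> R.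

Lemma op_genP (phi : {ffun 'I_d -> 'I_n} -> R) : pure phi ->
  \sum_J avgA A (fun a => phi (act a J)) ^+ 2 <= op_gen * \sum_J phi J ^+ 2.
Proof.
move=> phiP.
have n2 : (2 * #|'I_d| < n)%N by rewrite card_ord.
have ms : 2 ^+ #|'I_d| * (2 * #|'I_d|%:R / (n%:R - 2 * #|'I_d|%:R) + b.+1%:R^-1) <= 2^-1 :> R.
  by rewrite card_ord.
have := trans_pure_norm (@block_inj n d b dbn) n2 ms coef_block_le phiP.
rewrite card_ord => /le_trans; apply.
rewrite ler_wpM2r //; first by apply: sumr_ge0 => J _; exact: sqr_ge0.
rewrite /op_gen ler_wpM2r //.
have np : (0 : R) < n%:R ^+ d by rewrite exprn_gt0 ?ltr0n.
have fact_le : n`!%:R / (n - d)`!%:R <= n%:R ^+ d :> R.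
  rewrite ler_pdivrMr ?ltr0n ?fact_gt0 // -natrX -natrM ler_nat.
  have dn : (d <= n)%N by apply: leq_trans (ltnW n_2d); exact: leq_pmull.
  rewrite -(ffact_fact dn) leq_mul2r; apply/orP; right.
  elim: (d) => [//|m IH]; rewrite ffactnSr expnSr leq_mul // leq_subr //.
apply: (@le_trans _ _ (2 * n%:R ^+ d * ((2 * d%:R) ^+ d / n%:R ^+ d))).
  have p1 : 0 <= 2 * (n`!%:R / (n - d)`!%:R) :> R by rewrite mulr_ge0 // divr_ge0 ?ler0n.
  have p2 : 0 <= (b.+1%:R ^+ d)^-1 :> R by rewrite invr_ge0 exprn_ge0 // ler0n.
  by apply: ler_pM => //; rewrite ler_wpM2l.
rewrite le_eqVlt; apply/orP; left; apply/eqP; field.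
by rewrite lt0r_neq0 // ltr0n.
Qed.

Hypothesis b_gt0 : (0 < b)%N.

Lemma op_conjP (phi : {ffun 'I_d -> 'I_n} -> R) : conj_closed A -> pure phi ->
  \sum_J avgA A (fun a => phi (act a J)) ^+ 2 <= op_conj * \sum_J phi J ^+ 2.
Proof.
move=> cA phiP.
have n2 : (2 * #|'I_d| <= n)%N by rewrite card_ord ltnW.
have H1 : \sum_k \sum_J coef R A (block dbn) k J ^+ 2 <= HS.
  have := coef_block_le 1%g; congr (_ <= _); apply: eq_bigr => k _.
  apply: eq_bigr => J _; congr (coef R A _ k J ^+ 2).
  by apply/funext => l; apply/funext => j; rewrite perm1.
have conjT s I J := @trans_conj n A 'I_d s I J cA.
have := trans_pure_norm_conj (@block_inj n d b dbn) b_gt0 n2 conjT H1 phiP.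
rewrite card_ord => /le_trans; apply.
rewrite ler_wpM2r //; first by apply: sumr_ge0 => J _; exact: sqr_ge0.
rewrite /op_conj ler_wpM2r ?exprn_ge0 ?ler0n // ler_wpM2r // ler_wpM2l ?exprn_ge0 //.
Qed.

Hypothesis energy : (2 * 2 ^ d * #|{ffun 'I_d -> 'I_d}| ^ 2 + d <= n)%N.

Variables (a l : R).
Hypothesis a0 : 0 <= a.
Hypothesis l1 : 1 <= l.
Hypothesis q_le : q%:R <= a * l.

(** Collects the factors that depend on [d] and [C] only. The last sum serves both cases: 2 for a
    general set, [4 ^+ d * N ^+ 2] for one closed under conjugation. *)
Definition level_const (N : R) : R :=
  2 * (N + 1) * (2 * d%:R) ^+ d *
   (36 * 4 ^+ d * (128 * a ^+ 2 * (d%:R + 2)) ^+ d * 2 ^+ d) * (2 + 4 ^+ d * N ^+ 2).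

Hypothesis l_large : level_const #|{ffun 'I_d -> 'I_d}|%:R <= l.

Let HS_le : HS <=
  36 * 4 ^+ d * (128 * a ^+ 2 * (d%:R + 2)) ^+ d * 2 ^+ d * (K * l ^+ (2 * d) / n%:R ^+ d).
Proof.
have K0 : 0 <= K by apply: le_trans Kge1.
have l0 : 0 <= l by apply: le_trans l1.
have qq : (q * (q * d + 2))%N%:R <= a ^+ 2 * (d%:R + 2) * l ^+ 2 :> R.
  have q1 : (q * (q * d + 2) <= q * q * (d + 2))%N.
    by rewrite -mulnA leq_mul2l mulnDr leq_add2l; apply/orP; right; rewrite -[leqLHS]mul1n leq_mul2r q_gt0 orbT.
  apply: (@le_trans _ _ (q%:R * q%:R * (d%:R + 2))); first by rewrite -natrD -!natrM ler_nat.
  have -> : a ^+ 2 * (d%:R + 2) * l ^+ 2 = (a * l) * (a * l) * (d%:R + 2) by ring.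
  by rewrite ler_wpM2r ?addr_ge0 ?ler0n // ler_pM ?ler0n.
have LE : (128 * (q * (q * d + 2))%N%:R) ^+ d <=
    (128 * a ^+ 2 * (d%:R + 2)) ^+ d * l ^+ (2 * d) :> R.
  rewrite exprM -exprMn lerXn2r ?nnegrE ?mulr_ge0 ?ler0n ?exprn_ge0 ?addr_ge0 ?ler0n //.
  have -> : 128 * a ^+ 2 * (d%:R + 2) * l ^+ 2 = 128 * (a ^+ 2 * (d%:R + 2) * l ^+ 2) by ring.
  by rewrite ler_wpM2l.
have np : (0 : R) < n%:R ^+ d by rewrite exprn_gt0 ?ltr0n.
rewrite /HS; set L := (128 * _%:R) ^+ d in LE *; set M := (128 * a ^+ 2 * _) ^+ d in LE *.
have -> : 36 * 4 ^+ d * M * 2 ^+ d * (K * l ^+ (2 * d) / n%:R ^+ d) =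
   36 * 4 ^+ d * (M * l ^+ (2 * d)) * (2 ^+ d * K) / n%:R ^+ d by ring.
rewrite ler_wpM2r ?invr_ge0 ?(ltW np) // ler_wpM2r ?mulr_ge0 ?exprn_ge0 //.
by rewrite ler_wpM2l // mulr_ge0 // exprn_ge0.
Qed.

Let N := #|{ffun 'I_d -> 'I_d}|%:R : R.
Let E := 36 * 4 ^+ d * (128 * a ^+ 2 * (d%:R + 2)) ^+ d * 2 ^+ d : R.

Let N0 : 0 <= N. Proof. exact: ler0n. Qed.
Let E0 : 0 <= E.
Proof.
by rewrite /E !mulr_ge0 ?exprn_ge0 // !mulr_ge0 ?exprn_ge0 ?addr_ge0 ?ler0n.
Qed.

(** A single factor [l] already exceeds the constant; spending [l ^+ (2 * d)] keeps the exponent a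
    multiple of [d]. *)
Let absorb (c x : R) : 0 <= c -> c <= level_const N -> 0 <= x ->
  c * (K * l ^+ (2 * d) * x) <= K * l ^+ (4 * d) * x.
Proof.
move=> c0 cl x0.
have K0 : 0 <= K by apply: le_trans Kge1.
have l0 : 0 <= l by apply: le_trans l1.
have -> : K * l ^+ (4 * d) * x = l ^+ (2 * d) * (K * l ^+ (2 * d) * x).
  have -> : (4 * d = 2 * d + 2 * d)%N by rewrite -mulnDl.
  by rewrite exprD; ring.
rewrite ler_wpM2r ?mulr_ge0 ?exprn_ge0 //; apply: le_trans cl _; apply: le_trans l_large _.
by rewrite -[leLHS]expr1 ler_weXn2l // muln_gt0.
Qed.

Lemma op_gen_le : 0 <= op_gen /\
  2 * (#|{ffun 'I_d -> 'I_d}|.+1)%:R * op_gen <= K * l ^+ (4 * d) * (n%:R ^+ d)^-1.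
Proof.
have x0 : 0 <= (n%:R ^+ d)^-1 :> R by rewrite invr_ge0 exprn_ge0 // ler0n.
have D0 : 0 <= (2 * d%:R) ^+ d :> R by rewrite exprn_ge0 // mulr_ge0 ?ler0n.
have cN : 0 <= 2 * (N + 1) by rewrite mulr_ge0 ?addr_ge0.
have cN1 : 0 <= 2 * (N + 1) * (2 * d%:R) ^+ d * E by rewrite mulr_ge0 // mulr_ge0.
split; first by rewrite /op_gen mulr_ge0 // mulr_ge0.
have NS : (#|{ffun 'I_d -> 'I_d}|.+1)%:R = N + 1 :> R by rewrite -natr1.
rewrite NS; apply: le_trans (absorb (c := 2 * (N + 1) * (2 * d%:R) ^+ d * E * 2) _ _ x0).
- have -> : 2 * (N + 1) * (2 * d%:R) ^+ d * E * 2 * (K * l ^+ (2 * d) / n%:R ^+ d) =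
    2 * (N + 1) * (2 * (2 * d%:R) ^+ d * (E * (K * l ^+ (2 * d) / n%:R ^+ d))) by ring.
  rewrite ler_wpM2l ?mulr_ge0 ?addr_ge0 // /op_gen ler_wpM2l ?mulr_ge0 //.
- by rewrite mulr_ge0.
- by rewrite /level_const -/E ler_wpM2l // lerDl mulr_ge0 ?exprn_ge0.
Qed.

Lemma op_conj_le : 0 <= op_conj /\
  2 * (#|{ffun 'I_d -> 'I_d}|.+1)%:R * op_conj <= K * l ^+ (4 * d) * (n%:R ^+ (2 * d))^-1.
Proof.
have x0 m : 0 <= (n%:R ^+ m)^-1 :> R by rewrite invr_ge0 exprn_ge0 // ler0n.
have D0 : 0 <= (2 * d%:R) ^+ d :> R by rewrite exprn_ge0 // mulr_ge0 ?ler0n.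
have f0 : 0 <= 4 ^+ d :> R by rewrite exprn_ge0.
have N20 : 0 <= N ^+ 2 by rewrite exprn_ge0.
have cN : 0 <= 2 * (N + 1) by rewrite mulr_ge0 ?addr_ge0.
have cN1 : 0 <= 2 * (N + 1) * (2 * d%:R) ^+ d * E by rewrite mulr_ge0 // mulr_ge0.
split; first by rewrite /op_conj mulr_ge0 // mulr_ge0 // mulr_ge0 // mulr_ge0.
have NS : (#|{ffun 'I_d -> 'I_d}|.+1)%:R = N + 1 :> R by rewrite -natr1.
rewrite NS; apply: le_trans (absorb (c := 2 * (N + 1) * (2 * d%:R) ^+ d * E * (4 ^+ d * N ^+ 2)) _ _ (x0 _)).
- have -> : 2 * (N + 1) * (2 * d%:R) ^+ d * E * (4 ^+ d * N ^+ 2) * (K * l ^+ (2 * d) / n%:R ^+ (2 * d)) =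
    2 * (N + 1) * (4 ^+ d * ((2 * d%:R) ^+ d / n%:R ^+ d) * (E * (K * l ^+ (2 * d) / n%:R ^+ d)) * N ^+ 2).
    rewrite (mulnC 2 d) !exprM; field; rewrite expf_neq0 // pnatr_eq0 -lt0n //.
  rewrite ler_wpM2l ?mulr_ge0 ?addr_ge0 // /op_conj ler_wpM2r // ler_wpM2l ?mulr_ge0 //.
- by rewrite mulr_ge0 // mulr_ge0.
- by rewrite /level_const -/E ler_wpM2l // lerDr.
Qed.

End Fixed.

End Final.

Lemma ln_le_2sqrt (R : realType) (x : R) : 0 < x -> ln x <= 2 * Num.sqrt x.
Proof.
move=> x0; have s0 : 0 < Num.sqrt x by rewrite sqrtr_gt0.
have E : ln x = 2 * ln (Num.sqrt x).
  by rewrite -{1}(sqr_sqrtr (ltW x0)) lnXn // mulr_natl.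
rewrite E ler_pM2l //; have := @le_ln1Dx R (Num.sqrt x - 1).
rewrite (_ : 1 + (Num.sqrt x - 1) = Num.sqrt x); last by ring.
have h : -1 < Num.sqrt x - 1 by lra.
move=> /(_ h); lra.
Qed.

Lemma large_params (R : realType) (C : R) (d : nat) : 0 < C -> (0 < d)%N ->
  exists n0 : nat, forall n : nat, (n0 <= n)%N ->
    let N := #|{ffun 'I_d -> 'I_d}| in let l : R := ln n%:R in
    exists q b : nat,
    [/\ [/\ (0 < n)%N, (2 * d < n)%N, (0 < q)%N, (0 < b)%N & (2 * (q * d + d) <= n)%N],
        [/\ (d * b.+1 <= n)%N, (n <= 2 * d * b.+1)%N & (2 * 2 ^ d * N ^ 2 + d <= n)%N],
        2 ^+ d * (2 * d%:R / (n%:R - 2 * d%:R) + b.+1%:R^-1) <= 2^-1 :> R &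
        [/\ 1 <= l, 2 * C * l <= q%:R, q%:R <= (2 * C + 1) * l &
            level_const d (2 * C + 1) N%:R <= l]].
Proof.
move=> C0 d0; pose N := #|{ffun 'I_d -> 'I_d}|.
pose L0 := level_const d (2 * C + 1) N%:R.
pose M := 4 * d%:R * (2 * C + 2) : R.
(* The summands make, in turn, [ln n] exceed [level_const] and 1, [q * d] small against [n] (through
   [ln_le_2sqrt]), the blocks long enough for [pure_block_mass], and [n] large enough for the energy
   bounds. *)
exists ((Num.truncn (expR (1 + `|L0|))).+1 + (Num.truncn (M ^+ 2)).+1 +
  (2 ^ d * 4 * d + (2 ^ d * 8 * d + 2 * d).+1) + (2 * 2 ^ d * N ^ 2 + d))%N.
move=> n nn; set l : R := ln n%:R => /=.
have n1 : expR (1 + `|L0|) <= n%:R.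
  apply: ltW; apply: lt_le_trans (proj2 (andP (truncn_itv (ltW (expR_gt0 _))))) _.
  by rewrite ler_nat; apply: leq_trans nn; rewrite -!addnA leq_addr.
have n2 : M ^+ 2 <= n%:R.
  apply: ltW; apply: lt_le_trans (proj2 (andP (truncn_itv (sqr_ge0 M)))) _.
  by rewrite ler_nat; apply: leq_trans nn; rewrite -!addnA addnCA leq_addr.
have n34 : (2 ^ d * 4 * d + (2 ^ d * 8 * d + 2 * d).+1 + (2 * 2 ^ d * N ^ 2 + d) <= n)%N.
  by apply: leq_trans nn; rewrite leq_add2r leq_addl.
have n4 : (2 * 2 ^ d * N ^ 2 + d <= n)%N by apply: leq_trans n34; rewrite leq_addl.
have n3 : (2 ^ d * 4 * d + (2 ^ d * 8 * d + 2 * d).+1 <= n)%N.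
  by apply: leq_trans n34; rewrite leq_addr.
clear nn n34.
have n3a : (2 ^ d * 4 * d <= n)%N by apply: leq_trans n3; rewrite leq_addr.
have n3b : (2 ^ d * 8 * d + 2 * d < n)%N by apply: leq_trans n3; rewrite leq_addl.
have n_gt0 : (0 < n)%N by apply: leq_ltn_trans n3b.
have n_2d : (2 * d < n)%N by apply: leq_ltn_trans n3b; rewrite leq_addl.
have np : (0 : R) < n%:R by rewrite ltr0n.
have lL : 1 + `|L0| <= l.
  by rewrite /l -[leLHS]expRK ler_ln ?posrE ?expR_gt0.
have l1 : 1 <= l by apply: le_trans lL; rewrite lerDl.
have Ll : L0 <= l.
  apply: le_trans (ler_norm _) _; apply: le_trans lL; by rewrite lerDr.
have Cl0 : 0 <= 2 * C * l by rewrite mulr_ge0 ?mulr_ge0 // ?ltW // (lt_le_trans ltr01).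
have /andP[t1 t2] := truncn_itv Cl0.
pose q := (Num.truncn (2 * C * l)).+1.
have qle : q%:R <= 2 * C * l + 1 by rewrite /q -natr1 lerD2r.
(* The longest possible blocks, [b.+1 = n %/ d]; together they cover at least half of the points. *)
pose b := (n %/ d).-1.
have bd : (2 ^ d * 4 <= n %/ d)%N by rewrite leq_divRL.
have dd0 : (0 < 2 ^ d)%N by rewrite expn_gt0.
have bS : b.+1 = (n %/ d)%N by rewrite prednK //; apply: leq_trans bd; rewrite muln_gt0 dd0.
exists q, b; split; last 1 first.
- split=> //; first exact: ltW.
  by apply: le_trans qle _; rewrite [leRHS]mulrDl mul1r lerD2l.
- split=> //.
    rewrite -ltnS bS; apply: leq_trans bd; apply: (@leq_trans (1 * 4)) => //.
    by rewrite leq_mul2r dd0 orbT.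
  rewrite -(ler_nat R) natrM natrD natrM.
  have s0 : 0 <= Num.sqrt (n%:R : R) by exact: sqrtr_ge0.
  have ls := ln_le_2sqrt np; rewrite -/l in ls.
  have dR : 0 < d%:R :> R by rewrite ltr0n.
  have M0 : 0 <= M by rewrite /M mulr_ge0 ?mulr_ge0 ?ler0n // addr_ge0 // mulr_ge0 // ltW.
  have Ms : M <= Num.sqrt n%:R.
    by rewrite -(ler_pXn2r (n := 2)) ?nnegrE // sqr_sqrtr ?ler0n.
  have q1 : q%:R + 1 <= (2 * C + 2) * l.
    have -> : (2 * C + 2) * l = 2 * C * l + 2 * l by ring.
    by move: qle l1; move: (2 * C * l) => u; lra.
  have C2 : 0 < 2 * C + 2 by lra.
  apply: (@le_trans _ _ (2 * d%:R * ((2 * C + 2) * l))).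
    have -> : 2 * (q%:R * d%:R + d%:R) = 2 * d%:R * (q%:R + 1) :> R by ring.
    by rewrite ler_wpM2l // mulr_ge0 // ltW.
  apply: (@le_trans _ _ (2 * d%:R * ((2 * C + 2) * (2 * Num.sqrt n%:R)))).
    by rewrite ler_wpM2l ?mulr_ge0 ?(ltW dR) // ler_wpM2l // ltW.
  have -> : 2 * d%:R * ((2 * C + 2) * (2 * Num.sqrt n%:R)) = M * Num.sqrt n%:R by rewrite /M; ring.
  by rewrite -{2}(sqr_sqrtr (ltW np)) expr2 ler_wpM2r.
- rewrite bS; split=> //; first by rewrite mulnC leq_trunc_div.
  have := ltn_ceil n d0; rewrite mulnC => /ltnW /leq_trans; apply.
  rewrite -mulnA mulnCA leq_mul2l mul2n -addnn -addn1 leq_add2l.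
  by rewrite -bS orbT.
have p2 : (0 : R) < 2 ^+ d by rewrite exprn_gt0.
have nd : 2 ^+ d * 8 * d%:R <= n%:R - 2 * d%:R :> R.
  by rewrite lerBrDr -natrX -!natrM -natrD ler_nat ltnW.
have dR : 0 < d%:R :> R by rewrite ltr0n.
have nd0 : 0 < n%:R - 2 * d%:R :> R by apply: lt_le_trans nd; rewrite !mulr_gt0.
have h1 : 2 ^+ d * (2 * d%:R / (n%:R - 2 * d%:R)) <= 4^-1 :> R.
  rewrite mulrA ler_pdivrMr // ler_pdivlMl //; apply: le_trans nd.
  by rewrite le_eqVlt; apply/orP; left; apply/eqP; ring.
have h2 : 2 ^+ d * b.+1%:R^-1 <= 4^-1 :> R.
  rewrite ler_pdivrMr ?ltr0n // ler_pdivlMl //.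
  by rewrite mulrC -natrX -natrM ler_nat bS.
rewrite [leLHS]mulrDr; apply: le_trans (lerD h1 h2) _; lra.
Qed.

Theorem theorem1p9 (R : realType) :
  exists c : R, 0 < c /\
    forall (C : R) (d : nat), 0 < C -> (1 <= d)%N ->
      exists n0 : nat, forall n : nat, (n0 <= n)%N ->
        forall (K : R) (A : {set 'S_n}),
          relatively_global (2 * d) K A ->
          n%:R `^ (- C) <= mu R A ->
          (level_norm R d A <=
             (Num.sqrt K * ln n%:R `^ (c * d%:R) / n%:R `^ (d%:R / 2))%:E)%E /\
          (conj_closed A ->
             (level_norm R d A <=
                (Num.sqrt K * ln n%:R `^ (c * d%:R) / n%:R ^+ d)%:E)%E).
Proof.
(* The squared bounds carry [ln n ^+ (4 * d)], whose root is [ln n ^+ (2 * d)]. *)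
exists 2; split=> // C d C0 d0; have [n0 H] := large_params C0 d0.
exists n0 => n nn K A glob muA.
have [q [b [[n_gt0 n_2d q_gt0 b_gt0 q_small] [dbn b_large energy] mass [l1 ql qu lL]]]] := H n nn.
have l0 : 0 <= ln n%:R :> R by apply: le_trans l1.
have [A0 A_dense] := dense_pow n_gt0 muA ql (ltW C0) l0.
have K1 := global_ge1 (ltnW n_2d) glob A0.
have K0 : 0 <= K by apply: le_trans K1.
have a0 : 0 <= 2 * C + 1 by rewrite addr_ge0 // mulr_ge0 // ltW.
have np : (0 : R) < n%:R by rewrite ltr0n.
have lp : ln n%:R `^ (2 * d%:R) = ln n%:R ^+ (2 * d) :> R.
  by rewrite -natrM powR_mulrn.
have lp2 : (ln n%:R ^+ (2 * d)) ^+ 2 = ln n%:R ^+ (4 * d) :> R.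
  by rewrite -exprM mulnAC.
have np2 : (n%:R `^ (d%:R / 2)) ^+ 2 = n%:R ^+ d :> R.
  by rewrite -powR_mulrn ?powR_ge0 // -powRrM divfK ?pnatr_eq0 // powR_mulrn ?ler0n.
have B1 : 0 <= Num.sqrt K * ln n%:R `^ (2 * d%:R) / n%:R `^ (d%:R / 2).
  by rewrite divr_ge0 ?powR_ge0 // mulr_ge0 ?sqrtr_ge0 ?powR_ge0.
have B2 : 0 <= Num.sqrt K * ln n%:R `^ (2 * d%:R) / n%:R ^+ d.
  by rewrite divr_ge0 ?exprn_ge0 ?ler0n // mulr_ge0 ?sqrtr_ge0 ?powR_ge0.
split=> [|cA].
  have [gen0 genB] := op_gen_le d0 n_gt0 n_2d glob A0 q_gt0 A_dense q_small dbn a0 l1 qu lL.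
  apply: (level_norm_le d0 n_gt0 energy gen0 B1).
    by move=> phi; exact: (op_genP n_gt0 n_2d glob A0 q_gt0 A_dense q_small dbn b_large mass).
  by apply: le_trans genB _; rewrite expr_div_n exprMn sqr_sqrtr // lp lp2 np2.
have [conj0 conjB] := op_conj_le d0 n_gt0 n_2d glob A0 q_gt0 A_dense q_small dbn a0 l1 qu lL.
apply: (level_norm_le d0 n_gt0 energy conj0 B2).
  by move=> phi; exact: (op_conjP n_gt0 n_2d glob A0 q_gt0 A_dense q_small dbn b_large b_gt0 cA).
by apply: le_trans conjB _; rewrite expr_div_n exprMn sqr_sqrtr // lp lp2 -[(n%:R ^+ d) ^+ 2]exprM (mulnC d 2).
Qed.
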